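(* Let $U \subset \mathbb{C}$ be a connected open neighborhood of $\overline{\mathbb{D}}$, and let $f$ be a holomorphic function on $U$ that is not identically zero and whose zero set in $U$ is non-empty. Let $p_1,\dots,p_m \in \mathbb{D}$ be all the (distinct) zeros of $f$ in $\mathbb{D}$, with multiplicities $k_1,\dots,k_m$, and let $q_1,\dots,q_r \in \partial\mathbb{D}$ be all the (distinct) zeros of $f$ on $\partial \mathbb{D}$, with multiplicities $\ell_1,\dots,\ell_r$. For $\varepsilon>0$ set $\Gamma_\varepsilon := \{z\in\mathbb{D}: |f(z)|=\varepsilon\}$ and $E_\varepsilon := \{z\in\mathbb{D}: |f(z)|<\varepsilon\}$. Then, as $\varepsilon\to 0^+$, $$\int_{\Gamma_{\varepsilon}} |f'(z)|\,ds = 2\pi \left( \sum_{j=1}^{m} k_{j} + \frac{1}{2} \sum_{\nu=1}^{r} \ell_{\nu} \right) \varepsilon + o(\varepsilon),$$ and $$\int_{E_{\varepsilon}} |f'(z)|^{2}\,dA = \pi \left( \sum_{j=1}^{m} k_{j} + \frac{1}{2} \sum_{\nu=1}^{r} \ell_{\nu} \right) \varepsilon^{2} + o(\varepsilon^{2}).$$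
   Context: $\mathbb{D}=\{z\in\mathbb{C}:|z|<1\}$ is the unit disk. $ds$ denotes arc length (one-dimensional Hausdorff measure) on $\Gamma_\varepsilon$, and $dA$ denotes two-dimensional Lebesgue measure on $\mathbb{C}\cong\mathbb{R}^2$. Either of the two lists of zeros may be empty, in which case the corresponding sum is $0$. *)

(* Defs.v *)
From HB Require Import structures.
From mathcomp Require Import all_boot all_order all_algebra.
From mathcomp Require Import complex.
From mathcomp Require Import all_classical all_reals all_analysis.

Set Implicit Arguments.
Unset Strict Implicit.
Unset Printing Implicit Defensive.

Import Order.TTheory GRing.Theory Num.Theory.
Import numFieldNormedType.Exports.
Import ComplexField.Normc.

Local Open Scope classical_set_scope.
Local Open Scope ring_scope.
Local Open Scope complex_scope.

(* The topology of R[i] is the one induced by its norm, as for any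
   numFieldType; the library does not declare it for the concrete type. *)
HB.instance Definition _ (R : realType) :=
  NormedModule.copy R[i] ((R[i] : numFieldType)^o).

Section ComplexAnalysis.
Context {R : realType}.
Implicit Types (f g : R[i] -> R[i]) (U : set R[i]) (a z : R[i]).

(* normc is the modulus as an element of R; the norm `|z| lies in R[i]. *)
Definition unit_disk : set R[i] := [set z | normc z < 1].
Definition unit_circle : set R[i] := [set z | normc z = 1].
Definition closed_unit_disk : set R[i] := [set z | normc z <= 1].

(* The scalar field of the difference quotient is R[i], so derivability in the
   direction 1 is complex differentiability. *)
Definition holomorphic_on U f := forall z, U z -> derivable f z 1.

Definition zero_multiplicity f a (k : nat) :=
  exists g, [/\ \forall z \near a, derivable g z 1,
                g a != 0 &
                \forall z \near a, f z = (z - a) ^+ k * g z].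

Definition level_curve f (e : R) : set R[i] :=
  [set z | unit_disk z /\ normc (f z) = e].

Definition sublevel_set f (e : R) : set R[i] :=
  [set z | unit_disk z /\ normc (f z) < e].

End ComplexAnalysis.

Section Hausdorff.
Context {R : realType}.
Implicit Types (A : set R[i]) (F : (set R[i])^nat).
Local Open Scope ereal_scope.

(* The maximum with 0 only matters for the empty set. *)
Definition diameter A : \bar R :=
  maxe 0 (ereal_sup [set (normc (x - y)%R)%:E | x in A & y in A]).

Definition hausdorff_cover (d : R) A : set ((set R[i])^nat) :=
  [set F | (forall i, diameter (F i) <= d%:E) /\ A `<=` \bigcup_i F i].

Definition hausdorff_content (d : R) A : \bar R :=
  ereal_inf [set \sum_(i <oo) diameter (F i) | F in hausdorff_cover d A].

Definition hausdorff1 A : \bar R :=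
  ereal_sup [set hausdorff_content d A | d in [set d : R | (0 < d)%R]].

Lemma diameter_ge0 A : 0 <= diameter A.
Proof. by rewrite /diameter le_max lexx. Qed.

Lemma diameter0 : diameter set0 = 0.
Proof.
rewrite /diameter (_ : [set _ | _ in _ & _ in _] = set0).
  by rewrite ereal_sup0 max_l// leNye.
by apply/seteqP; split => // x [].
Qed.

Lemma hausdorff_content_ge0 d A : 0 <= hausdorff_content d A.
Proof.
apply: le_ereal_inf_tmp => x [F _ <-].
by apply: nneseries_ge0 => n _ _; exact: diameter_ge0.
Qed.

Lemma hausdorff_content0 d : (0 < d)%R -> hausdorff_content d set0 = 0.
Proof.
move=> d0; apply/eqP; rewrite eq_le hausdorff_content_ge0 andbT.
apply: ereal_inf_lbound; exists (fun=> set0).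
  by split => // i; rewrite diameter0 lee_fin ltW.
by rewrite eseries0// => i _ _; rewrite diameter0.
Qed.

Lemma hausdorff_content_sigma_subadditive d :
  sigma_subadditive (hausdorff_content d).
Proof.
move=> A; have [[i ioo]|] :=
    pselect (exists i, hausdorff_content d (A i) = +oo).
  rewrite (eseries_pinfty _ _ ioo) ?leey// => n _.
  by rewrite -ltNye (lt_le_trans _ (hausdorff_content_ge0 _ _)).
rewrite -forallNE => Aoo.
suff add2e (e : {posnum R}) : hausdorff_content d (\bigcup_n A n) <=
    \sum_(i <oo) hausdorff_content d (A i) + e%:num%:E.
  by apply/lee_addgt0Pr => _/posnumP[].
rewrite (le_trans _ (epsilon_trick _ _ _))//; last first.
  by move=> n; exact: hausdorff_content_ge0.
pose P n F := hausdorff_cover d (A n) F /\ \sum_(k <oo) diameter (F k) <=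
  hausdorff_content d (A n) + (e%:num / (2 ^ n.+1)%:R)%:E.
have [G PG] : {G : ((set R[i])^nat)^nat & forall n, P n (G n)}.
  apply: (@choice _ _ P) => n; rewrite /P /hausdorff_content.
  set S := (X in ereal_inf X); move infS : (ereal_inf S) => iS.
  case: iS infS => [r Sr|Soo|Soo].
  - have en1 : (0 < e%:num / (2 ^ n.+1)%:R)%R by [].
    have /(lb_ereal_inf_adherent en1) : ereal_inf S \is a fin_num by rewrite Sr.
    move=> [x [B cB muBx] xS].
    by exists B; split => //; rewrite muBx -Sr; exact/ltW.
  - by have := Aoo n; rewrite /hausdorff_content Soo.
  - by have := hausdorff_content_ge0 d (A n); rewrite /hausdorff_content Soo.
have G_ge0 x : 0 <= (diameter \o uncurry G) x by exact: diameter_ge0.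
apply: (@le_trans _ _ (\esum_(i in setT) (diameter \o uncurry G) i)).
  rewrite /hausdorff_content; apply: ereal_inf_lbound => /=.
  have /card_esym/ppcard_eqP[f] := card_nat2.
  exists (uncurry G \o f).
    split => [i|].
      by move=> /=; case: (f i) => a b; exact: (PG a).1.1 b.
    apply: (@subset_trans _ (\bigcup_n \bigcup_k G n k)) => [t [i _]|].
      by move=> /(PG i).1.2 [j _ ?]; exists i => //; exists j.
    move=> t [i _ [j _ Bijt]]; exists (f^-1%FUN (i, j)) => //=.
    by rewrite invK ?inE.
  rewrite -(esum_pred_image (diameter \o uncurry G) _ xpredT) ?[fun=> _]set_true//.
  by rewrite image_eq.
rewrite (_ : esum _ _ = \sum_(i <oo) \sum_(j <oo) diameter (G i j)); last first.
  pose J : nat -> set (nat * nat) := fun i => [set (i, j) | j in setT].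
  rewrite (_ : setT = \bigcup_k J k); last first.
    by rewrite predeqE => -[a b]; split => // _; exists a => //; exists b.
  rewrite esum_bigcupT /=; last 2 first.
    - apply/trivIsetP => i j _ _ ij.
      rewrite predeqE => -[n m] /=; split => //= -[] [_] _ [<-{n} _].
      by move=> [m' _] [] /esym/eqP; rewrite (negbTE ij).
    - by move=> /= x; exact: G_ge0.
  rewrite -(image_id [set: nat]) -fun_true esum_pred_image//; last first.
    by move=> n _; apply: esum_ge0 => x _; exact: G_ge0.
  apply: eq_eseriesr => /= j _.
  rewrite -(esum_pred_image (diameter \o uncurry G) (pair j) predT)//=; last 2 first.
    by move=> n _; exact: diameter_ge0.
    by move=> ? ? _ _; exact: (@can_inj _ _ _ snd).
  by congr esum; rewrite predeqE => -[a b]; split; move=> [i _ <-]; exists i.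
apply: lee_nneseries => [n _ _|n _].
- by apply: nneseries_ge0 => m _ _; exact: diameter_ge0.
- exact: (PG n).2.
Qed.

Lemma hausdorff_content_le d A :
  (0 < d)%R -> hausdorff_content d A <= hausdorff1 A.
Proof. by move=> d0; apply: ereal_sup_ubound; exists d. Qed.

Lemma hausdorff1_ge0 A : 0 <= hausdorff1 A.
Proof. exact: le_trans (hausdorff_content_ge0 1 A) (hausdorff_content_le _ _). Qed.

Lemma hausdorff1_0 : hausdorff1 set0 = 0.
Proof.
apply/eqP; rewrite eq_le hausdorff1_ge0 andbT.
by apply: ge_ereal_sup => _ [d d0 <-]; rewrite hausdorff_content0.
Qed.

Lemma le_hausdorff1 : {homo hausdorff1 : A B / A `<=` B >-> A <= B}.
Proof.
move=> A B AB; apply: ge_ereal_sup => _ [d d0 <-].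
apply: le_trans (hausdorff_content_le B d0).
apply/ereal_inf_le_tmp => _ [F [dF BF] <-].
by exists F => //; split => //; exact: subset_trans BF.
Qed.

Lemma hausdorff1_sigma_subadditive : sigma_subadditive hausdorff1.
Proof.
move=> F; apply: ge_ereal_sup => _ [d d0 <-].
apply: le_trans (hausdorff_content_sigma_subadditive d F) _.
apply: lee_nneseries => [n _ _|n _]; first exact: hausdorff_content_ge0.
exact: hausdorff_content_le.
Qed.

HB.instance Definition _ := isOuterMeasure.Build R R[i] hausdorff1
  hausdorff1_0 hausdorff1_ge0 le_hausdorff1 hausdorff1_sigma_subadditive.

End Hausdorff.

Definition hausdorff1_outer (R : realType) :
  {outer_measure set R[i] -> \bar R} := @hausdorff1 R.

(* One-dimensional Hausdorff measure, as a measure on the sigma-algebra of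
   Caratheodory-measurable subsets of the plane; no normalizing constant is
   needed in dimension one. *)
Definition arc_length (R : realType) :
    {measure set (caratheodory_type (hausdorff1_outer R)) -> \bar R} :=
  (hausdorff1_outer R : set (caratheodory_type (hausdorff1_outer R)) -> \bar R).

Definition area (R : realType) :
    {measure set (measurableTypeR R * measurableTypeR R)%type -> \bar R} :=
  ((@lebesgue_measure R) \x (@lebesgue_measure R))%E.

(* Main.v *)
(* Near a zero a of multiplicity k, |f(z)| = |g(a)| (|w| G(w))^k with w = z - a
   and G close to 1, so that the level curve {|f| = eps} is, up to a factor
   close to 1, the circle of radius rho = (eps / |g(a)|)^(1/k) around a, on which
   |f'| is about k |g(a)| rho^(k-1). The unit disk sees this circle under the
   angle Theta = 2 pi if a is interior and in the limit Theta = pi if a lies on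
   the boundary, whence the contributions Theta rho k |g(a)| rho^(k-1) =
   Theta k eps and, after integrating k^2 |g(a)|^2 |w|^(2k-2) over the
   corresponding sector, Theta k eps^2 / 2. By compactness {|f| <= eps} is
   contained in small disks around the zeros when eps is small.
   Only derivability of g is assumed; that w |-> G(w) w is almost isometric
   requires a bound on g', which Goursat's lemma and the mean value property
   provide. *)
Require Import Defs.
From HB Require Import structures.
From mathcomp Require Import all_boot all_order all_algebra.
From mathcomp Require Import complex.
From mathcomp Require Import all_classical all_reals all_analysis.
From mathcomp Require Import measurable_realfun.
From mathcomp Require Import ring lra.
Import Order.TTheory GRing.Theory Num.Theory.
Import numFieldNormedType.Exports.
Import ComplexField.Normc.

Local Open Scope classical_set_scope.
Local Open Scope ring_scope.
Local Open Scope complex_scope.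

Local Notation Re := (@complex.Re _).
Local Notation Im := (@complex.Im _).

Set Implicit Arguments.
Unset Strict Implicit.

(** * Complex numbers and their modulus *)

(** Every distortion is measured by one factor [lam > 1]: near a zero each estimate holds up to a
    power of [lam] fixed by the multiplicity, and [lam] is chosen so that this power is within a
    prescribed eta of 1. Two obstacles shape the lower bound for the length. The circle around an
    interior zero closes up, so close points may have distant parameters, whereas a lower bound for
    Hausdorff measure compares chords with parameter differences; and at a boundary zero the nearly
    tangent directions enter the disk only for very small radii. Shortening the parameter interval
    from Theta to Theta / [lam] settles both. The area needs no polar coordinates: powers of |w|^2
    are integrated over a full disc by slicing it into annuli, and at a boundary zero half of this
    value is obtained from a point reflection, at the cost of a thin strip along the tangent. *)

Section ComplexBasics.
Context {R : realType}.
Implicit Types (z w : R[i]) (x y : R).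

Lemma normrE z : `|z| = (normc z)%:C.
Proof. by case: z => a b; rewrite normc_def. Qed.

Lemma normc_ge0 z : 0 <= normc z.
Proof. by case: z => a b; exact: sqrtr_ge0. Qed.

Lemma normc_eq0 z : (normc z == 0) = (z == 0).
Proof. by apply/eqP/eqP => [/eq0_normc|->]//; rewrite normc0. Qed.

Lemma normc_gt0 z : (0 < normc z) = (z != 0).
Proof. by rewrite lt_def normc_eq0 normc_ge0 andbT. Qed.

Lemma normc_distC z w : normc (z - w) = normc (w - z).
Proof. by rewrite -normcN opprB. Qed.

Lemma normcX z n : normc (z ^+ n) = normc z ^+ n.
Proof.
elim: n => [|n IHn]; first by rewrite !expr0 normc1.
by rewrite !exprS normcM IHn.
Qed.

Lemma normcR x : normc x%:C = `|x|.
Proof. by rewrite /normc/= expr0n/= addr0 sqrtr_sqr. Qed.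

Lemma normc_sqr z : normc z ^+ 2 = Re z ^+ 2 + Im z ^+ 2.
Proof. by case: z => a b /=; rewrite sqr_sqrtr// addr_ge0 ?sqr_ge0. Qed.

Lemma le_Re_normc z : `|Re z| <= normc z.
Proof.
rewrite -ler_sqr ?nnegrE ?normc_ge0// normc_sqr real_normK ?num_real//.
by rewrite lerDl sqr_ge0.
Qed.

Lemma le_Im_normc z : `|Im z| <= normc z.
Proof.
rewrite -ler_sqr ?nnegrE ?normc_ge0// normc_sqr real_normK ?num_real//.
by rewrite lerDr sqr_ge0.
Qed.

Lemma normc_le_ReIm z : normc z <= `|Re z| + `|Im z|.
Proof.
rewrite -ler_sqr ?nnegrE ?addr_ge0 ?normc_ge0// normc_sqr sqrrD.
by rewrite !real_normK ?num_real// lerD2r lerDl mulrn_wge0// mulr_ge0.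
Qed.

Lemma le_normcB z w : normc z - normc w <= normc (z - w).
Proof. by rewrite lerBlDr (le_trans _ (le_normcD _ _))// subrK. Qed.

Lemma le_normc_distD w z z' : normc (z - z') <= normc (z - w) + normc (w - z').
Proof. by rewrite (le_trans _ (le_normcD _ _))// addrA subrK. Qed.

Lemma ltr_normc z (e : R[i]) : 0 < e -> (`|z| < e) = (normc z < Re e).
Proof.
case: e => a b; rewrite ltcE/= => /andP[/eqP -> a0].
by rewrite normrE ltcE/= eqxx.
Qed.

(** Balls of [R[i]] have radii in [R[i]], but a positive radius is real; this passage lets all later
    estimates use real moduli. *)
Lemma near_normcP (a : R[i]) (P : set R[i]) :
  (\forall z \near a, P z) <->
  exists2 d : R, 0 < d & forall z, normc (z - a) < d -> P z.
Proof.
split=> [/nbhs_ballP[e /= e0 eP]|[d d0 dP]].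
  have Re0 : 0 < Re e by move: e0; rewrite ltcE/= => /andP[].
  exists (Re e) => // z za; apply: eP.
  by rewrite -ball_normE/= ltr_normc// normc_distC.
apply/nbhs_ballP; exists d%:C; first by rewrite /= ltcR.
move=> z; rewrite -ball_normE/= ltr_normc ?ltcR//= normc_distC; exact: dP.
Qed.

Lemma Re_mulc (z w : R[i]) : Re (z * w) = Re z * Re w - Im z * Im w.
Proof. by case: z w => a b [c d]. Qed.

Lemma Im_mulc (z w : R[i]) : Im (z * w) = Re z * Im w + Im z * Re w.
Proof. by case: z w => a b [c d]. Qed.

Lemma Re_mul_pair (z : R[i]) (p q : R) : Re (z * (p +i* q)) = Re z * p - Im z * q.
Proof. by rewrite Re_mulc. Qed.

Lemma Im_mul_pair (z : R[i]) (p q : R) : Im (z * (p +i* q)) = Im z * p + Re z * q.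
Proof. by rewrite Im_mulc addrC. Qed.

Lemma ReB (z w : R[i]) : Re (z - w) = Re z - Re w.
Proof. by case: z w => a b [c d]. Qed.

Lemma ImB (z w : R[i]) : Im (z - w) = Im z - Im w.
Proof. by case: z w => a b [c d]. Qed.

(* Complex differentiability at [z] with derivative [L], on real moduli. *)
Definition cdiff (g : R[i] -> R[i]) (z L : R[i]) :=
  forall eta : R, 0 < eta -> exists2 d : R, 0 < d &
    forall z', normc (z' - z) < d ->
      normc (g z' - g z - L * (z' - z)) <= eta * normc (z' - z).

Lemma derivable_cdiff (g : R[i] -> R[i]) z :
  derivable g z 1 -> cdiff g z (derive1 g z).
Proof.
move=> dg eta eta0.
have : h^-1 *: (g (h + z) - g z) @[h --> 0^'] --> derive1 g z.
  by have := dg; rewrite /derivable/=; under eq_fun do rewrite [_ *: 1]mulr1.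
move/cvgrPdist_le => /(_ eta%:C); rewrite ltcR => /(_ eta0).
rewrite near_withinE => /near_normcP[d d0 dP]; exists d => // z' z'z.
have [->|z'nz] := eqVneq z' z; first by rewrite !subrr mulr0 subr0 normc0 mulr0.
have h0 : z' - z != 0 by rewrite subr_eq0.
have := dP (z' - z); rewrite subr0 => /(_ z'z h0).
rewrite normrE lecR subrK => H.
rewrite [X in normc X](_ : _ =
  - ((derive1 g z - (z' - z)^-1 *: (g z' - g z)) * (z' - z))).
  by rewrite normcN normcM ler_wpM2r ?normc_ge0.
by rewrite mulrBl [_ *: _](mulrC _ (_ - _)) divfK// opprB.
Qed.

End ComplexBasics.

(** * Goursat's lemma *)

Section RectangleIntegral.
Context {R : realType}.
Local Notation mu := (@lebesgue_measure R).
Implicit Types (phi psi : R -> R) (a b c : R).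

(** Continuity in [R] at each point, from both sides even at the endpoints; the functions integrated
    below are controlled on a neighborhood of the rectangle. *)
Definition continuous_on a b phi := forall t, t \in `[a, b] -> {for t, continuous phi}.

Definition sint phi a b := \int[mu]_(t in `[a, b]) phi t.

Lemma continuous_on_integrable phi a b : continuous_on a b phi ->
  mu.-integrable `[a, b] (EFin \o phi).
Proof.
move=> cf; apply: continuous_compact_integrable; first exact: segment_compact.
by apply: continuous_in_subspaceT => x; rewrite inE/= => /cf.
Qed.

Lemma sint_split phi a b c : a <= c -> c <= b -> continuous_on a b phi ->
  sint phi a b = sint phi a c + sint phi c b.
Proof.
move=> ac cb cf; rewrite /sint.
have itf := continuous_on_integrable cf.
have := @Rintegral_itvB _ phi (BLeft a) (BRight b) c itf.
rewrite !bnd_simp => /(_ ac cb) /eqP; rewrite subr_eq => /eqP ->.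
rewrite addrC; congr (_ + _); apply: Rintegral_itv_obnd_cbnd.
by apply: integrableS itf => //; apply: subset_itvr; rewrite bnd_simp.
Qed.

Lemma sintB phi psi a b : continuous_on a b phi -> continuous_on a b psi ->
  sint (fun t => phi t - psi t) a b = sint phi a b - sint psi a b.
Proof.
by move=> /continuous_on_integrable iphi /continuous_on_integrable ipsi; exact: RintegralB.
Qed.

Lemma sint_cst r a b : a <= b -> sint (fun=> r) a b = r * (b - a).
Proof.
move=> ab; rewrite /sint Rintegral_cst//= lebesgue_measure_itv/= lte_fin.
by move: ab; rewrite le_eqVlt => /predU1P[->|->]//; rewrite ltxx subrr.
Qed.

Lemma sint_approx phi a b (r eta : R) : a <= b -> continuous_on a b phi ->
  (forall t, t \in `[a, b] -> `|phi t - r| <= eta) ->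
  `|sint phi a b - r * (b - a)| <= eta * (b - a).
Proof.
move=> ab cf H; rewrite -!sint_cst// ler_norml.
have cc s : continuous_on a b (fun=> s) by move=> t _; exact: cvg_cst.
have i0 := continuous_on_integrable cf.
have ic s := continuous_on_integrable (cc s).
have i1 s : mu.-integrable `[a, b] (EFin \o (fun t => r + s)) by exact: ic.
have E s : sint (fun=> s) a b + sint (fun=> r) a b = sint (fun=> s + r) a b.
  by rewrite /sint -RintegralD//; exact: ic.
have E' : - sint (fun=> eta) a b = sint (fun=> - eta) a b by rewrite !sint_cst// mulNr.
rewrite lerBlDr lerBrDr E' !E; apply/andP; split; apply: le_Rintegral => //.
- by move=> t /H; rewrite ler_norml; lra.
- by move=> t /H; rewrite ler_norml; lra.
Qed.

Lemma continuous_onB phi psi a b : continuous_on a b phi -> continuous_on a b psi ->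
  continuous_on a b (fun t => phi t - psi t).
Proof. by move=> c1 c2 t tab; apply: cvgB; [exact: c1|exact: c2]. Qed.

End RectangleIntegral.

Lemma lipschitz_at_continuous (R : realType) (phi : R -> R) (x B d : R) : 0 < d ->
  (forall t, `|t - x| < d -> `|phi t - phi x| <= B * `|t - x|) ->
  {for x, continuous phi}.
Proof.
move=> d0 H; apply/cvgrPdist_lt => eta eta0.
(* The sign of [B] is unknown, hence the positive divisor. *)
have B0 : 0 < `|B| + 1 by rewrite ltr_wpDl.
apply/nbhs_ballP; exists (Num.min d (eta / (`|B| + 1))).
  by rewrite /= lt_min d0 divr_gt0.
move=> t; rewrite /ball_/= distrC lt_min => /andP[t1 t2].
rewrite distrC (le_lt_trans (H _ t1))//; rewrite ltr_pdivlMr// in t2.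
apply: le_lt_trans t2; rewrite mulrC ler_wpM2l// (le_trans (ler_norm B))// lerDl.
exact: ler01.
Qed.

Section Goursat.
Context {R : realType}.
Variables u v : R -> R -> R.
Variables a1 b1 a2 b2 : R.

(** Differentiability of u + i v with derivative the multiplication by al + i be: the matrix with
    rows (al, - be) and (be, al) encodes the Cauchy-Riemann equations without partial
    derivatives. *)
Definition CR_at x0 y0 := exists al be : R, forall eta : R, 0 < eta ->
  exists2 d : R, 0 < d & forall x y, `|x - x0| < d -> `|y - y0| < d ->
   `|u x y - u x0 y0 - (al * (x - x0) - be * (y - y0))| <= eta * (`|x - x0| + `|y - y0|) /\
   `|v x y - v x0 y0 - (be * (x - x0) + al * (y - y0))| <= eta * (`|x - x0| + `|y - y0|).

Hypothesis crP : forall x y, x \in `[a1, b1] -> y \in `[a2, b2] -> CR_at x y.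

(** These are the two directions in which [flux] integrates: u along vertical sides, v along
    horizontal ones. In both only [be] survives in the linear part, whence the Lipschitz
    constant. *)
Lemma CR_continuous x y : x \in `[a1, b1] -> y \in `[a2, b2] ->
  {for y, continuous (u x)} /\ {for x, continuous (v^~ y)}.
Proof.
move=> xa ya; have [al [be H]] := crP xa ya.
have [d d0 dP] := H 1 ltr01.
split; apply: (@lipschitz_at_continuous _ _ _ (`|be| + 1) d) => // t td.
- have [] := dP x t; rewrite ?subrr ?normr0//.
  rewrite mulr0 !add0r mul1r opprK => + _.
  have := normrM be (t - y).
  have := ler_norm (be * (t - y)); have := lerNnormlW (lexx `|be * (t - y)|).
  by rewrite !ler_norml mulrDl mul1r => ? ? <-; lra.
- have [] := dP t y; rewrite ?subrr ?normr0//.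
  rewrite mulr0 !addr0 mul1r => _.
  have := normrM be (t - x).
  have := ler_norm (be * (t - x)); have := lerNnormlW (lexx `|be * (t - x)|).
  by rewrite !ler_norml mulrDl mul1r => ? ? <-; lra.
Qed.

(* Imaginary part of the integral of u + i v along the boundary of the rectangle
   with lower left corner (x, y), width w and height h. *)
Definition flux x y w h :=
  sint (fun t => u (x + w) t - u x t) y (y + h) -
  sint (fun s => v s (y + h) - v s y) x (x + w).

Definition subrect x y w h :=
  [/\ a1 <= x, x + w <= b1, a2 <= y, y + h <= b2 & 0 < w /\ 0 < h].

Lemma continuous_on_u x c d : x \in `[a1, b1] -> a2 <= c -> d <= b2 ->
  continuous_on c d (u x).
Proof.
move=> xa ac db t; rewrite in_itv/= => /andP[ct td].
by apply: (CR_continuous xa _).1; rewrite in_itv/=; lra.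
Qed.

Lemma continuous_on_v y c d : y \in `[a2, b2] -> a1 <= c -> d <= b1 ->
  continuous_on c d (v^~ y).
Proof.
move=> ya ac db t; rewrite in_itv/= => /andP[ct td].
by apply: (CR_continuous _ ya).2; rewrite in_itv/=; lra.
Qed.

(** Sides shared by two quarters are traversed in opposite directions and cancel; each outer side is
    cut at its midpoint. *)
Lemma flux_split x y w h : subrect x y (w + w) (h + h) ->
  flux x y (w + w) (h + h) =
  (flux x y w h + flux (x + w) y w h) + (flux x (y + h) w h + flux (x + w) (y + h) w h).
Proof.
move=> [ax xb ay yb [w0 h0]].
have xI s : s \in `[x, x + (w + w)] -> s \in `[a1, b1] by rewrite !in_itv/=; lra.
have yI s : s \in `[y, y + (h + h)] -> s \in `[a2, b2] by rewrite !in_itv/=; lra.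
have cu s c d : s \in `[x, x + (w + w)] -> y <= c -> d <= y + (h + h) ->
  continuous_on c d (u s) by move=> /xI ? ? ?; apply: continuous_on_u => //; lra.
have cv s c d : s \in `[y, y + (h + h)] -> x <= c -> d <= x + (w + w) ->
  continuous_on c d (v^~ s) by move=> /yI ? ? ?; apply: continuous_on_v => //; lra.
rewrite /flux.
have x0 : x \in `[x, x + (w + w)] by rewrite in_itv/=; lra.
have x1 : x + w \in `[x, x + (w + w)] by rewrite in_itv/=; lra.
have x2 : x + (w + w) \in `[x, x + (w + w)] by rewrite in_itv/=; lra.
have y0 : y \in `[y, y + (h + h)] by rewrite in_itv/=; lra.
have y1 : y + h \in `[y, y + (h + h)] by rewrite in_itv/=; lra.
have y2 : y + (h + h) \in `[y, y + (h + h)] by rewrite in_itv/=; lra.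
rewrite -!(addrA x w w) -!(addrA y h h).
(* Five fluxes with two integrals of differences each. *)
do 10 (rewrite sintB; [|by [apply: cu => //; lra|apply: cv => //; lra]|
  by [apply: cu => //; lra|apply: cv => //; lra]]).
rewrite (@sint_split _ (u (x + (w + w))) y _ (y + h)); [|lra|lra|by apply: cu => //; lra].
rewrite (@sint_split _ (u x) y _ (y + h)); [|lra|lra|by apply: cu => //; lra].
rewrite (@sint_split _ (v^~ (y + (h + h))) x _ (x + w)); [|lra|lra|by apply: cv => //; lra].
rewrite (@sint_split _ (v^~ y) x _ (x + w)); [|lra|lra|by apply: cv => //; lra].
ring.
Qed.

End Goursat.

Lemma nested_segments (R : realType) (a b : nat -> R) :
  (forall n, a n <= a n.+1) -> (forall n, b n.+1 <= b n) -> (forall n, a n <= b n) ->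
  exists x, forall n, a n <= x <= b n.
Proof.
move=> na nb ab.
have am n m : (n <= m)%N -> a n <= a m.
  move=> nm; rewrite -(subnK nm); elim: (m - n)%N => [//|j IH].
  exact: le_trans IH (na _).
have bm n m : (n <= m)%N -> b m <= b n.
  move=> nm; rewrite -(subnK nm); elim: (m - n)%N => [//|j IH].
  exact: le_trans (nb _) IH.
have abm n m : a n <= b m.
  have [nm|/ltnW nm] := leqP n m; first exact: le_trans (am _ _ nm) (ab m).
  exact: le_trans (ab n) (bm _ _ nm).
exists (sup (range a)) => n; apply/andP; split.
  apply: ub_le_sup; last by exists n.
  by exists (b 0%N) => _ [m _ <-]; exact: abm.
apply: ge_sup; first by exists (a 0%N); exists 0%N.
by move=> _ [m _ <-]; exact: abm.
Qed.

Lemma half_pow_lt (R : realType) (w d : R) : 0 < d -> exists n, w * 2^-1 ^+ n < d.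
Proof.
move=> d0; exists (Num.bound (w / d)).
have := archi_boundP (normr_ge0 (w / d)).
have [w0|w0] := ltP 0 w; last first.
  move=> _; apply: le_lt_trans d0; rewrite mulr_le0_ge0// exprn_ge0//.
rewrite gtr0_norm ?divr_gt0//.
set N := Num.bound _ => H.
rewrite exprVn ltr_pdivrMr ?exprn_gt0// mulrC -ltr_pdivrMr//.
by apply: lt_trans H _; rewrite -natrX ltr_nat ltn_expl.
Qed.

Lemma dependent_choice_nat (T : Type) (P : nat -> T -> Prop) (Q : nat -> T -> T -> Prop) x0 :
  P 0%N x0 -> (forall n x, P n x -> exists2 y, P n.+1 y & Q n x y) ->
  exists s : nat -> T, [/\ s 0%N = x0, (forall n, P n (s n)) & forall n, Q n (s n) (s n.+1)].
Proof.
move=> P0 step.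
have /choice[f fP] : forall nx : nat * T, exists y, P nx.1 nx.2 -> P nx.1.+1 y /\ Q nx.1 nx.2 y.
  move=> [n x] /=; have [Px|nP] := pselect (P n x).
    by have [y Py Qy] := step _ _ Px; exists y.
  by exists x => /nP.
pose s := fix s n := if n is n'.+1 then f (n', s n') else x0.
have Ps n : P n (s n) by elim: n => [//|n IH]; exact: (fP (n, s n) IH).1.
by exists s; split => // n; exact: (fP (n, s n) (Ps n)).2.
Qed.

Section GoursatSubdivision.
Context {R : realType}.
Variables u v : R -> R -> R.
Variables a1 b1 a2 b2 : R.
Hypothesis crP : forall x y, x \in `[a1, b1] -> y \in `[a2, b2] -> CR_at u v x y.

(** The linear part has no flux: by the Cauchy-Riemann equations both of its integrals equal al * w
    * h. What remains is the differentiability error times the side lengths. *)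
Lemma flux_small x0 y0 eta : x0 \in `[a1, b1] -> y0 \in `[a2, b2] -> 0 < eta ->
  exists2 d : R, 0 < d & forall x y w h, subrect a1 b1 a2 b2 x y w h ->
    x0 \in `[x, x + w] -> y0 \in `[y, y + h] -> w + h < d ->
    `|flux u v x y w h| <= eta * (w + h) ^+ 2.
Proof.
move=> x0a y0a eta0; have [al [be H]] := crP x0a y0a.
(* Each integrand is a difference of two values, and each value has its own error. *)
have [|d d0 dP] := H (eta / 2); first by rewrite divr_gt0.
exists d => // x y w h [ax xb ay yb [w0 h0]] x0I y0I whd.
move: x0I y0I; rewrite !in_itv/= => /andP[x0x x0w] /andP[y0y y0h].
have D s t : x <= s <= x + w -> y <= t <= y + h ->
   `|u s t - u x0 y0 - (al * (s - x0) - be * (t - y0))| <= eta / 2 * (w + h) /\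
   `|v s t - v x0 y0 - (be * (s - x0) + al * (t - y0))| <= eta / 2 * (w + h).
  move=> sx ty.
  have sd : `|s - x0| <= w by rewrite ler_norml; lra.
  have td : `|t - y0| <= h by rewrite ler_norml; lra.
  have [|| A B] := dP s t; [lra|lra|].
  have E : eta / 2 * (`|s - x0| + `|t - y0|) <= eta / 2 * (w + h).
    by rewrite ler_wpM2l ?lerD// divr_ge0// ltW.
  by split; exact: le_trans E.
have cu s : x <= s <= x + w -> continuous_on y (y + h) (u s).
  by move=> ?; apply: (continuous_on_u crP) => //; rewrite in_itv/=; lra.
have cv s : y <= s <= y + h -> continuous_on x (x + w) (v^~ s).
  by move=> ?; apply: (continuous_on_v crP) => //; rewrite in_itv/=; lra.
have xx : x <= x <= x + w by lra.
have xw : x <= x + w <= x + w by lra.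
have yy : y <= y <= y + h by lra.
have yh : y <= y + h <= y + h by lra.
have I1 : `|sint (fun t => u (x + w) t - u x t) y (y + h) - al * w * (y + h - y)|
    <= eta * (w + h) * (y + h - y).
  apply: sint_approx; [lra|by apply: continuous_onB; exact: cu|].
  move=> t; rewrite in_itv/= => ty.
  have := (D _ _ xw ty).1; have := (D _ _ xx ty).1.
  by rewrite !ler_norml; lra.
have I2 : `|sint (fun s => v s (y + h) - v s y) x (x + w) - al * h * (x + w - x)|
    <= eta * (w + h) * (x + w - x).
  apply: sint_approx; [lra|by apply: continuous_onB; exact: cv|].
  move=> t; rewrite in_itv/= => ty.
  have := (D _ _ ty yh).2; have := (D _ _ ty yy).2.
  by rewrite !ler_norml; lra.
rewrite /flux; move: I1 I2; set A := sint _ _ _; set B := sint _ _ _.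
rewrite (_ : y + h - y = h) 1?(_ : x + w - x = w); [|ring|ring].
have -> : eta * (w + h) ^+ 2 = eta * (w + h) * h + eta * (w + h) * w by ring.
have -> : al * h * w = al * w * h by ring.
by rewrite !ler_norml; lra.
Qed.

Lemma flux_quarter x y w h : subrect a1 b1 a2 b2 x y (w + w) (h + h) ->
  exists x' y', [/\ x <= x', x' + w <= x + (w + w), y <= y', y' + h <= y + (h + h) &
    `|flux u v x y (w + w) (h + h)| <= 4 * `|flux u v x' y' w h| ].
Proof.
move=> S; have := flux_split crP S; have [ax xb ay yb [w0 h0]] := S.
set F := flux u v x y (w + w) (h + h) => E.
have [?|n1] := leP `|F| (4 * `|flux u v x y w h|).
  by exists x, y; split => //; lra.
have [?|n2] := leP `|F| (4 * `|flux u v (x + w) y w h|).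
  by exists (x + w), y; split => //; lra.
have [?|n3] := leP `|F| (4 * `|flux u v x (y + h) w h|).
  by exists x, (y + h); split => //; lra.
(* Three quarters carry less than a fourth of [F] each, so by the triangle inequality the last one
   carries at least a fourth. *)
exists (x + w), (y + h); split => //; try lra.
have := ler_normD (flux u v x y w h + flux u v (x + w) y w h)
  (flux u v x (y + h) w h + flux u v (x + w) (y + h) w h).
have := ler_normD (flux u v x y w h) (flux u v (x + w) y w h).
have := ler_normD (flux u v x (y + h) w h) (flux u v (x + w) (y + h) w h).
rewrite -E; lra.
Qed.

(** Quartering repeatedly keeps at least 4^-n of the flux in a rectangle whose squared size is of
    order 4^-n, while at the common point of these rectangles the flux is small compared with the
    squared size. *)
Lemma goursat : a1 < b1 -> a2 < b2 -> flux u v a1 a2 (b1 - a1) (b2 - a2) = 0.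
Proof.
move=> ab1 ab2; set F := flux _ _ _ _ _ _.
pose w n := (b1 - a1) * 2^-1 ^+ n; pose h n := (b2 - a2) * 2^-1 ^+ n.
have w0 n : 0 < w n by rewrite mulr_gt0 ?subr_gt0// exprn_gt0// invr_gt0.
have h0 n : 0 < h n by rewrite mulr_gt0 ?subr_gt0// exprn_gt0// invr_gt0.
have wS n : w n = w n.+1 + w n.+1 by rewrite /w exprS; field.
have hS n : h n = h n.+1 + h n.+1 by rewrite /h exprS; field.
pose P n (p : R * R) := subrect a1 b1 a2 b2 p.1 p.2 (w n) (h n) /\
  `|F| <= 4 ^+ n * `|flux u v p.1 p.2 (w n) (h n)|.
pose Q n (p q : R * R) := [/\ p.1 <= q.1, q.1 + w n.+1 <= p.1 + w n,
   p.2 <= q.2 & q.2 + h n.+1 <= p.2 + h n].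
have [|n [x y] [/= S]|s [s0 Ps Qs]] := @dependent_choice_nat _ P Q (a1, a2).
- rewrite /P /w /h !expr0 !mulr1 mul1r/=; split => //.
  by rewrite /subrect !subrKC !lexx; split => //; rewrite !subr_gt0.
- rewrite wS hS in S *; have [x' [y' [? ? ? ? Fq]]] := flux_quarter S.
  have [? ? ? ? _] := S.
  move=> FF; exists (x', y'); rewrite /P /Q/=; last first.
    by rewrite (wS n) (hS n).
  split; first by split => //; try lra.
  rewrite exprSr -mulrA (le_trans FF)// ler_wpM2l// exprn_ge0//.
have [x0 x0P] : exists x, forall n, (s n).1 <= x <= (s n).1 + w n.
  apply: nested_segments => n; [by have [] := Qs n|by have [] := Qs n|].
  by rewrite lerDl ltW.
have [y0 y0P] : exists x, forall n, (s n).2 <= x <= (s n).2 + h n.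
  apply: nested_segments => n; [by have [] := Qs n|by have [] := Qs n|].
  by rewrite lerDl ltW.
have x0I : x0 \in `[a1, b1].
  rewrite in_itv/=; have [[? ? _ _ _] _] := Ps 0%N; have := x0P 0%N; lra.
have y0I : y0 \in `[a2, b2].
  rewrite in_itv/=; have [[_ _ ? ? _] _] := Ps 0%N; have := y0P 0%N; lra.
apply/eqP; rewrite -normr_le0; apply/ler_addgt0Pr => eta eta0; rewrite add0r.
set L := (b1 - a1) + (b2 - a2).
have L0 : 0 < L by rewrite addr_gt0 ?subr_gt0.
(* The n-th rectangle has w + h = L / 2^n, so the factors 4^n and [L ^+ 2] cancel and exactly [eta]
   is left. *)
have [|d d0 dP] := flux_small x0I y0I (eta := eta / L ^+ 2).
  by rewrite divr_gt0// exprn_gt0.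
have [n nd] := half_pow_lt L d0.
have [Sn Fn] := Ps n.
have whL : w n + h n = L * 2^-1 ^+ n by rewrite /w /h -mulrDl.
have := dP _ _ _ _ Sn; rewrite !in_itv/= whL => /(_ (x0P n) (y0P n) nd) B.
apply: le_trans Fn _.
apply: (@le_trans _ _ (4 ^+ n * (eta / L ^+ 2 * (L * 2^-1 ^+ n) ^+ 2))).
  by rewrite ler_wpM2l// exprn_ge0.
have E : 4 ^+ n * (2^-1 ^+ n) ^+ 2 = 1 :> R.
  rewrite -exprM mulnC exprM -exprMn (_ : 4 * 2^-1 ^+ 2 = 1) ?expr1n//; by field.
rewrite le_eqVlt; apply/orP; left; apply/eqP.
move: E; move: (4 ^+ n) (2^-1 ^+ n) => X Y E.
transitivity (eta * (X * Y ^+ 2)); last by rewrite E mulr1.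
by field; rewrite gt_eqF.
Qed.

End GoursatSubdivision.

(** * Local Lipschitz bound for holomorphic functions *)

Section CauchyEstimate.
Context {R : realType}.

Lemma sint_le (phi : R -> R) (a b r : R) : a <= b -> continuous_on a b phi ->
  (forall t, t \in `[a, b] -> phi t <= r) -> sint phi a b <= r * (b - a).
Proof.
move=> ab cf H; rewrite -sint_cst//; apply: le_Rintegral => //.
- exact: continuous_on_integrable.
- by apply: continuous_on_integrable => t _; exact: cvg_cst.
Qed.

(** Complex differentiability of H as a function of x + i y. Two real arguments suit logarithmic
    coordinates, where x is the logarithm of the radius and y the angle. *)
Definition hol2 (H : R -> R -> R[i]) (x y : R) := exists L : R[i], forall eta : R, 0 < eta ->
  exists2 d : R, 0 < d & forall x' y', `|x' - x| < d -> `|y' - y| < d ->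
    normc (H x' y' - H x y - L * ((x' - x) +i* (y' - y))) <=
      eta * (`|x' - x| + `|y' - y|).

(** The unimodular factor [c] preserves the error bound; it serves to rotate a prescribed value onto
    the positive real axis. *)
Lemma hol2_CR H (c : R[i]) x y : normc c = 1 -> hol2 H x y ->
  CR_at (fun x y => Re (c * H x y)) (fun x y => Im (c * H x y)) x y.
Proof.
move=> c1 [L HL]; exists (Re (c * L)), (Im (c * L)) => eta eta0.
have [d d0 dP] := HL _ eta0; exists d => // x' y' x'd y'd.
have := dP _ _ x'd y'd; set D := _ - _ - _ => Dle.
have -> : Re (c * H x' y') - Re (c * H x y) -
   (Re (c * L) * (x' - x) - Im (c * L) * (y' - y)) = Re (c * D).
  by rewrite /D !mulrBr !ReB mulrA Re_mul_pair; ring.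
have -> : Im (c * H x' y') - Im (c * H x y) -
   (Im (c * L) * (x' - x) + Re (c * L) * (y' - y)) = Im (c * D).
  by rewrite /D !mulrBr !ImB mulrA Im_mul_pair; ring.
have cD : normc (c * D) <= eta * (`|x' - x| + `|y' - y|) by rewrite normcM c1 mul1r.
by split; [apply: le_trans (le_Re_normc _) cD|apply: le_trans (le_Im_normc _) cD].
Qed.

(* The mean of a holomorphic function over circles does not depend on the
   radius; in logarithmic coordinates circles become vertical segments. *)
Lemma circle_mean_bound (H : R -> R -> R[i]) (x1 M : R) (l : R[i]) :
  (forall x y, x <= x1 -> hol2 H x y) ->
  (forall x, H x (pi *+ 2) = H x 0) ->
  (forall eta : R, 0 < eta -> exists2 x0 : R, x0 < x1 & forall y, normc (H x0 y - l) <= eta) ->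
  (forall y, normc (H x1 y) <= M) -> normc l <= M.
Proof.
move=> hH per liml HM; rewrite leNgt; apply/negP => Ml.
have M0 : 0 <= M := le_trans (normc_ge0 _) (HM 0).
have l0 : 0 < normc l := le_lt_trans M0 Ml.
(* Half of the gap: with this tolerance at the inner radius, the real parts at the two radii still
   differ by [eta]. *)
set eta := (normc l - M) / 2.
have eta0 : 0 < eta by rewrite divr_gt0// subr_gt0.
have [x0 x01 x0P] := liml _ eta0.
(* This rotation turns [l] into its modulus, so that comparing real parts suffices. *)
pose c := (l^*)%C / (normc l)%:C.
have c1 : normc c = 1.
  rewrite /c normcM normcV normcR ger0_norm ?normc_ge0//.
  have -> : normc (l^*)%C = normc l by case: (l) => p q /=; rewrite sqrrN.
  by rewrite divff// gt_eqF.
have cl : c * l = (normc l)%:C.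
  rewrite /c mulrAC (_ : (l^*)%C * l = ((normc l) ^+ 2)%:C); last first.
    by rewrite normc_sqr; case: (l) => p q; simpc; congr (_ +i* _); rewrite/=; ring.
  rewrite rmorphXn/= expr2 mulfK//.
  by apply/eqP => -[] /eqP; rewrite gt_eqF.
set u := fun x y => Re (c * H x y); set v := fun x y => Im (c * H x y).
have crP x y : x \in `[x0, x1] -> y \in `[0, pi *+ 2] -> CR_at u v x y.
  by rewrite in_itv/= => /andP[_ xx1] _; apply: hol2_CR => //; exact: hH.
have pi0 : 0 < pi *+ 2 :> R by rewrite mulrn_wgt0// pi_gt0.
have := goursat crP x01 pi0; rewrite /flux subr0 !subrKC add0r.
(* Periodicity makes the two horizontal sides cancel; the vertical sides then have equal
   integrals. *)
rewrite (_ : (fun s => v s (pi *+ 2) - v s 0) = (fun=> 0)); last first.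
  by apply/funext => s; rewrite /v per subrr.
rewrite sint_cst; last exact: ltW.
rewrite mul0r subr0 => I0.
have : sint (fun t => u x1 t - u x0 t) 0 (pi *+ 2) <= - eta * (pi *+ 2 - 0).
  apply: sint_le; first exact: ltW.
    apply: continuous_onB; apply: (continuous_on_u crP) => //;
    by rewrite in_itv/= lexx ?ltW.
  move=> t _; rewrite /u.
  have A1 : Re (c * H x1 t) <= M.
    apply: le_trans (ler_norm _) (le_trans (le_Re_normc _) _).
    by rewrite normcM c1 mul1r.
  have : `|Re (c * (H x0 t - l))| <= eta.
    by apply: le_trans (le_Re_normc _) _; rewrite normcM c1 mul1r.
  rewrite mulrBr ReB cl/= ler_norml => /andP[A2 _].
  (* On the outer side the real part is at most [M], on the inner one at least the modulus of [l]
     minus [eta]. *)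
  have -> : - eta = M - (normc l - eta) by rewrite /eta; field.
  by lra.
by rewrite I0 subr0 mulNr oppr_ge0 leNgt mulr_gt0.
Qed.

Lemma is_derive_eps (phi : R -> R) (t L : R) :
  (forall eta : R, 0 < eta -> exists2 d : R, 0 < d & forall t', `|t' - t| < d ->
     `|phi t' - phi t - L * (t' - t)| <= eta * `|t' - t|) -> is_derive t 1 phi L.
Proof.
move=> H.
have cv : (fun h : R => h^-1 *: (phi (h *: 1 + t) - phi t)) @ 0^' --> L.
  apply/cvgrPdist_le => eta eta0; have [d d0 dP] := H _ eta0.
  rewrite near_withinE; apply/nbhs_ballP; exists d => //= h.
  rewrite -ball_normE/= sub0r normrN => hd h0.
  have := dP (h + t); rewrite addrK => /(_ hd) B.
  rewrite [h *: 1]mulr1 [_ *: _]mulrC.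
  rewrite (_ : L - _ = - ((phi (h + t) - phi t - L * h) / h)); last by field.
  by rewrite normrN normrM normfV ler_pdivrMr ?normr_gt0.
by apply: DeriveDef; [apply/cvg_ex; exists L|apply: cvg_lim].
Qed.

Lemma eps_is_derive (phi : R -> R) (t L : R) : is_derive t 1 phi L ->
  forall eta : R, 0 < eta -> exists2 d : R, 0 < d & forall t', `|t' - t| < d ->
     `|phi t' - phi t - L * (t' - t)| <= eta * `|t' - t|.
Proof.
move=> D eta eta0.
have cv : (fun h : R => h^-1 *: (phi (h *: 1 + t) - phi t)) @ 0^' --> L.
  by have [dv <-] := D; exact: dv.
move/cvgrPdist_le : cv => /(_ _ eta0).
rewrite near_withinE => /nbhs_ballP[d /= d0 dP]; exists d => // t' t'd.
have [->|h0] := eqVneq t' t; first by rewrite !subrr mulr0 subr0 normr0 mulr0.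
have := dP (t' - t); rewrite -ball_normE/= sub0r normrN => /(_ t'd).
rewrite subr_eq0 => /(_ h0); rewrite [_ *: 1]mulr1 subrK [_ *: _]mulrC.
have h1 : t' - t != 0 by rewrite subr_eq0.
rewrite (_ : L - _ = - ((phi t' - phi t - L * (t' - t)) / (t' - t))); last by field.
by rewrite normrN normrM normfV ler_pdivrMr ?normr_gt0.
Qed.

Definition cis (t : R) : R[i] := cos t +i* sin t.

Lemma normc_cis t : normc (cis t) = 1.
Proof. by rewrite /cis/= cos2Dsin2 sqrtr1. Qed.

Lemma cisD s t : cis (s + t) = cis s * cis t.
Proof. by rewrite /cis cosD sinD; simpc; congr (_ +i* _); rewrite addrC. Qed.

Definition cexp (x y : R) : R[i] := (expR x)%:C * cis y.

Lemma normc_cexp x y : normc (cexp x y) = expR x.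
Proof. by rewrite /cexp normcM normc_cis mulr1 normcR ger0_norm// expR_ge0. Qed.

Lemma cexpD x y x' y' : cexp (x + x') (y + y') = cexp x y * cexp x' y'.
Proof. by rewrite /cexp expRD cisD rmorphM/= mulrACA. Qed.

Lemma cexp_approx0 (eta : R) : 0 < eta -> exists2 d : R, 0 < d & forall p r,
  `|p| < d -> `|r| < d -> normc (cexp p r - 1 - (p +i* r)) <= eta * (`|p| + `|r|).
Proof.
(* The coefficients of [|r|] add up to 2 + 4 + 1 = 7, from C2, C3 and B3; the bound e <= 1 gives |1
   + p| <= 2. *)
move=> eta0; pose e := Num.min 1 (eta / 7).
have e0 : 0 < e by rewrite lt_min ltr01/= divr_gt0.
have e1 : e <= 1 by rewrite ge_min lexx.
have e7 : 7 * e <= eta by rewrite mulrC -ler_pdivlMr// ge_min lexx orbT.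
have [d1 d10 E1] := eps_is_derive (is_derive_expR (0 : R)) e0.
have [d2 d20 E2] := eps_is_derive (is_derive_cos (0 : R)) e0.
have [d3 d30 E3] := eps_is_derive (is_derive_sin (0 : R)) e0.
exists (Num.min (Num.min d1 d2) (Num.min d3 e)).
  by rewrite !lt_min d10 d20 d30 ltr01 divr_gt0.
move=> p r; rewrite !lt_min => /andP[/andP[p1 _] /andP[_ /andP[pa pb]]] /andP[/andP[_ r2] /andP[r3 _]].
have pe : `|p| < e by rewrite lt_min pa pb.
have := E1 p; rewrite subr0 expR0 mul1r => /(_ p1) B1.
have := E2 r; rewrite subr0 sin0 oppr0 mul0r subr0 cos0 => /(_ r2) B2.
have := E3 r; rewrite subr0 cos0 sin0 subr0 mul1r => /(_ r3) B3.
apply: le_trans (normc_le_ReIm _) _.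
have -> : Re (cexp p r - 1 - (p +i* r)) = (expR p - 1 - p) * cos r + (1 + p) * (cos r - 1).
  by rewrite !ReB /cexp Re_mulc/=; ring.
have -> : Im (cexp p r - 1 - (p +i* r)) = (expR p - 1) * sin r + (sin r - r).
  by rewrite !ImB /cexp Im_mulc/=; ring.
have C1 : `|(expR p - 1 - p) * cos r| <= e * `|p|.
  by rewrite normrM -[leRHS]mulr1 ler_pM// cos_max.
have C2 : `|(1 + p) * (cos r - 1)| <= 2 * (e * `|r|).
  rewrite normrM ler_pM//; apply: le_trans (ler_normD _ _) _; rewrite normr1; lra.
have P1 : `|expR p - 1| <= 2 * e.
  have := ler_normD (expR p - 1 - p) p; rewrite subrK => /le_trans; apply.
  have : e * `|p| <= 1 * e by rewrite mul1r ger_pMr// (le_trans (ltW pe)).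
  by lra.
have P2 : `|sin r| <= 2 * `|r|.
  have := ler_normD (sin r - r) r; rewrite subrK => /le_trans; apply.
  have : e * `|r| <= 1 * `|r| by rewrite ler_wpM2r.
  by lra.
have C3 : `|(expR p - 1) * sin r| <= 4 * (e * `|r|).
  rewrite normrM (le_trans (ler_pM _ _ P1 P2))//; lra.
have := ler_normD ((expR p - 1 - p) * cos r) ((1 + p) * (cos r - 1)).
have := ler_normD ((expR p - 1) * sin r) (sin r - r).
have K : 7 * e * (`|p| + `|r|) <= eta * (`|p| + `|r|) by rewrite ler_wpM2r// addr_ge0.
have : 0 <= e * `|p| by rewrite mulr_ge0// ltW.
lra.
Qed.

Lemma hol2_cexp (q : R[i] -> R[i]) (w L : R[i]) x y :
  cdiff q (w + cexp x y) L -> hol2 (fun x y => q (w + cexp x y)) x y.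
Proof.
move=> dq; set E := cexp x y; exists (L * E) => eta eta0.
have NE : normc E = expR x by exact: normc_cexp.
have e0 : 0 < expR x := expR_gt0 x.
(* [k1] and [k2] allot eta / 2 each to the remainder of q and to that of the exponential. The
   minimum with 1 in [k2] bounds the increment of the exponential by 2 S, and S < 2 d3 keeps the
   argument of q within [d1]. *)
pose k1 := eta / (2 * (expR x * 2)).
have k10 : 0 < k1 by rewrite divr_gt0// !mulr_gt0.
pose k2 := Num.min 1 (eta / (2 * (expR x * (normc L + 1)))).
have k20 : 0 < k2.
  by rewrite lt_min ltr01 divr_gt0// !mulr_gt0// ltr_wpDl// normc_ge0.
have [d1 d10 D1] := dq _ k10.
have [d2 d20 D2] := cexp_approx0 k20.
pose d3 := d1 / (expR x * 2 * 2).
have d30 : 0 < d3 by rewrite divr_gt0// !mulr_gt0.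
exists (Num.min d2 d3); first by rewrite lt_min d20.
move=> x' y'; rewrite !lt_min => /andP[x2 x3] /andP[y2 y3].
set p := x' - x in x2 x3 *; set r := y' - y in y2 y3 *.
set S := `|p| + `|r|.
have S0 : 0 <= S by rewrite addr_ge0.
have -> : cexp x' y' = E * cexp p r by rewrite -cexpD !subrKC.
have := D2 _ _ x2 y2; set T := cexp p r - 1 - _ => TS.
have T1 : normc (cexp p r - 1) <= 2 * S.
  have -> : cexp p r - 1 = T + (p +i* r) by rewrite subrK.
  rewrite (le_trans (le_normcD _ _))// mulr2n mulrDl mul1r lerD//.
    by rewrite (le_trans TS)// ler_piMl// ge_min lexx.
  exact: (normc_le_ReIm (p +i* r)).
have ze : w + E * cexp p r - (w + E) = E * (cexp p r - 1) by ring.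
have zS : normc (w + E * cexp p r - (w + E)) <= expR x * 2 * S.
  by rewrite ze normcM NE -mulrA ler_wpM2l// ltW.
have zd : normc (w + E * cexp p r - (w + E)) < d1.
  apply: le_lt_trans zS _.
  have : S < d3 * 2 by rewrite /S; lra.
  rewrite -(ltr_pM2l (mulr_gt0 e0 (ltr0n R 2))) => /lt_le_trans; apply.
  rewrite /d3 le_eqVlt; apply/orP; left; apply/eqP; field; rewrite gt_eqF//.
have := D1 _ zd; rewrite ze.
set Q := q _ - q _ - _ => Qle.
have -> : q (w + E * cexp p r) - q (w + E) - L * E * (p +i* r) = Q + L * E * T.
  rewrite /Q /T; ring.
apply: le_trans (le_normcD _ _) _.
have A1 : normc Q <= eta / 2 * S.
  apply: le_trans Qle _; rewrite -ze.
  apply: le_trans (ler_wpM2l (ltW k10) zS) _.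
  by rewrite /k1 le_eqVlt; apply/orP; left; apply/eqP; field; rewrite gt_eqF.
have A2 : normc (L * E * T) <= eta / 2 * S.
  rewrite normcM (normcM L) NE.
  have K : normc L * expR x * k2 <= eta / 2.
    apply: (@le_trans _ _ ((normc L + 1) * expR x * (eta / (2 * (expR x * (normc L + 1)))))).
      have n0 := normc_ge0 L.
      apply: ler_pM; [by rewrite mulr_ge0// ltW|exact: ltW| |by rewrite ge_min lexx orbT].
      by apply: ler_wpM2r; [exact: ltW|rewrite lerDl].
    rewrite le_eqVlt; apply/orP; left; apply/eqP; field.
    by rewrite !gt_eqF// ltr_wpDl// normc_ge0.
  apply: le_trans (ler_wpM2r S0 K); rewrite -[leRHS]mulrA ler_wpM2l//.
  by rewrite mulr_ge0// ?normc_ge0// ltW.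
have -> : eta * S = eta / 2 * S + eta / 2 * S by field.
exact: lerD.
Qed.

End CauchyEstimate.

Section LipschitzEstimate.
Context {R : realType}.
Implicit Types (g : R[i] -> R[i]) (a w z : R[i]).

Lemma derivable_slope g w z : derivable g z 1 -> z != w ->
  derivable (fun z => (g z - g w) / (z - w)) z 1.
Proof.
move=> dg zw.
have d1 : derivable (fun z => g z - g w) z 1 := derivableB dg (derivable_cst (g w) z 1).
have d2 : derivable (fun z => z - w) z 1 :=
  derivableB (@derivable_id _ _ z 1) (derivable_cst w z 1).
apply: (derivableM d1); apply: (derivableV _ d2).
by rewrite subr_eq0.
Qed.

(** Cauchy's estimate: the slope of g at w tends to g'(w) on small circles and is bounded by K / s
    on the circle of radius s, so that its circle means bound the limit. *)
Lemma derive1_bound g w (s K : R) : 0 < s ->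
  (forall z, normc (z - w) <= s -> derivable g z 1) ->
  (forall z, normc (z - w) <= s -> normc (g z - g w) <= K) ->
  normc (derive1 g w) <= K / s.
Proof.
move=> s0 dg gK; pose q z := (g z - g w) / (z - w).
have ne x y : w + cexp x y != w.
  by rewrite -subr_eq0 addrC addKr -normc_gt0 normc_cexp expR_gt0.
have nw x y : normc (w + cexp x y - w) = expR x by rewrite addrC addKr normc_cexp.
apply: (@circle_mean_bound _ (fun x y => q (w + cexp x y)) (ln s)).
- move=> x y xs; apply: hol2_cexp; apply: derivable_cdiff.
  apply: derivable_slope => //; apply: dg; rewrite nw.
  by rewrite -(lnK s0) ler_expR.
- by move=> x; rewrite /cexp /cis cos2pi sin2pi cos0 sin0.
- move=> eta eta0.
  have [|d d0 dP] := derivable_cdiff (dg w _) eta0; first by rewrite subrr normc0 ltW.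
  (* The first entry makes the radius smaller than [s], the second makes it smaller than [d]. *)
  exists (Num.min (ln s - 1) (ln (d / 2))).
    by rewrite gt_min ltrBlDr ltrDl ltr01.
  move=> y; set x := Num.min _ _.
  have xd : expR x < d.
    apply: (@le_lt_trans _ _ (d / 2)); last by rewrite ltr_pdivrMr// ltr_pMr// ltr1n.
    have d20 : 0 < d / 2 by rewrite divr_gt0.
    by rewrite -[leRHS](lnK d20) ler_expR ge_min lexx orbT.
  have := dP (w + cexp x y); rewrite nw => /(_ xd).
  set D := w + _ - w; have nD : normc D = expR x by rewrite /D nw.
  have D0 : D != 0 by rewrite subr_eq0.
  rewrite -nD => B; rewrite /q -/D.
  rewrite (_ : _ - _ = (g (w + cexp x y) - g w - derive1 g w * D) / D); last by field.
  by rewrite normcM normcV ler_pdivrMr// normc_gt0.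
- move=> y; rewrite /q normcM normcV nw lnK// ler_pM2r ?invr_gt0//.
  by apply: gK; rewrite nw lnK.
Qed.

Lemma mean_value01 (phi dphi : R -> R) :
  (forall t : R, t \in `[0, 1] -> is_derive t 1 phi (dphi t)) ->
  exists2 t : R, t \in `[0, 1] & phi 1 - phi 0 = dphi t.
Proof.
move=> H; have [|t t01] := @MVT_segment R phi dphi 0 1 ler01 (fun t t01 => H t (subset_itv_oo_cc t01)).
  apply: continuous_in_subspaceT => t; rewrite inE/= => t01.
  by apply/differentiable_continuous/derivable1_diffP; case: (H t t01).
by rewrite subr0 mulr1; exists t.
Qed.

(** The mean value theorem fails for complex values. It is applied to the real part of conj(D) g
    along the segment, where D = g z - g w; the increment of this function is |D|^2. *)
Lemma mean_value_normc g z w (C : R) :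
  (forall t : R, t \in `[0, 1] -> derivable g (w + t%:C * (z - w)) 1 /\
     normc (derive1 g (w + t%:C * (z - w))) <= C) ->
  normc (g z - g w) <= C * normc (z - w).
Proof.
move=> H; have [->|gzw] := eqVneq (g z) (g w).
  rewrite subrr normc0 mulr_ge0 ?normc_ge0//.
  by apply: le_trans (normc_ge0 _) (H 0 _).2; rewrite in_itv/= lexx ler01.
set D := g z - g w; have D0 : 0 < normc D by rewrite normc_gt0 subr_eq0.
pose c := (D^*)%C.
have nc : normc c = normc D by rewrite /c; case: (D) => p q /=; rewrite sqrrN.
pose phi (t : R) := Re (c * g (w + t%:C * (z - w))).
have dphi (t : R) : t \in `[0, 1] ->
    is_derive t 1 phi (Re (c * (derive1 g (w + t%:C * (z - w)) * (z - w)))).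
  move=> t01; apply: is_derive_eps => eta eta0.
  have [dg _] := H t t01.
  have B0 : 0 < normc D * (normc (z - w) + 1).
    by rewrite mulr_gt0// ltr_wpDl// normc_ge0.
  have [|d d0 dP] := derivable_cdiff dg (eta := eta / (normc D * (normc (z - w) + 1))).
    by rewrite divr_gt0.
  exists (d / (normc (z - w) + 1)); first by rewrite divr_gt0// ltr_wpDl// normc_ge0.
  move=> t' t'd.
  have E : w + t'%:C * (z - w) - (w + t%:C * (z - w)) = (t' - t)%:C * (z - w).
    by rewrite rmorphB/=; ring.
  have N : normc ((t' - t)%:C * (z - w)) <= `|t' - t| * (normc (z - w) + 1).
    by rewrite normcM normcR ler_wpM2l// lerDl.
  have := dP (w + t'%:C * (z - w)); rewrite E.
  move: t'd; rewrite ltr_pdivlMr ?ltr_wpDl ?normc_ge0// => t'd /(_ (le_lt_trans N t'd)).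
  set Q := _ - _ - _ => QB.
  rewrite (_ : _ - _ - _ = Re (c * Q)); last first.
    rewrite /phi /Q; set A := g _; set B := g _; set L := derive1 _ _.
    have -> : c * (A - B - L * ((t' - t)%:C * (z - w))) =
        c * A - c * B - (c * (L * (z - w))) * (t' - t)%:C by ring.
    by rewrite !ReB Re_mul_pair mulr0 subr0.
  apply: le_trans (le_Re_normc _) _; rewrite normcM nc.
  apply: le_trans (ler_wpM2l (ltW D0) QB) _.
  apply: (@le_trans _ _ (normc D * (eta / (normc D * (normc (z - w) + 1)) *
     (`|t' - t| * (normc (z - w) + 1))))).
    by apply: ler_wpM2l; [exact: ltW|apply: ler_wpM2l => //; apply: ltW; rewrite divr_gt0].
  rewrite le_eqVlt; apply/orP; left; apply/eqP; field.
  by rewrite !gt_eqF// ltr_wpDl// normc_ge0.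
have [t t01 E] := mean_value01 dphi.
have : normc D ^+ 2 <= normc D * (C * normc (z - w)).
  have -> : normc D ^+ 2 = phi 1 - phi 0.
    rewrite /phi rmorph1 rmorph0 mul1r mul0r addr0 subrKC -ReB -mulrBr -/D.
    by rewrite normc_sqr /c; case: (D) => p q /=; ring.
  rewrite E (le_trans (ler_norm _))// (le_trans (le_Re_normc _))//.
  rewrite !normcM nc ler_wpM2l ?normc_ge0// ler_wpM2r ?normc_ge0//.
  exact: (H t t01).2.
by rewrite expr2 ler_pM2l.
Qed.

(* Goursat's theorem is what makes this work: derivability alone does not
   assume any bound on the derivative. *)
Lemma holomorphic_locally_lipschitz g a : (\forall z \near a, derivable g z 1) ->
  exists C d : R, [/\ 0 < C, 0 < d,
    forall z, normc (z - a) < d -> derivable g z 1 /\ normc (derive1 g z) <= C &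
    forall z w, normc (z - a) < d -> normc (w - a) < d ->
      normc (g z - g w) <= C * normc (z - w)].
Proof.
move/near_normcP => [d1 d10 D1].
have da : derivable g a 1 by apply: D1; rewrite subrr normc0.
have [d2 d20 D2] := derivable_cdiff da ltr01.
(* Differentiability at [a] alone bounds g - g(a) linearly near [a], and this is the bound on
   circles that Cauchy's estimate requires. *)
pose B := normc (derive1 g a) + 1.
have B0 : 0 < B by rewrite ltr_wpDl// normc_ge0.
(* Circles of radius d / 2 around points of the d-ball have to stay where g is controlled, which is
   the ball of radius 2 d. *)
pose d := Num.min d1 d2 / 2.
have d0 : 0 < d by rewrite divr_gt0// lt_min d10.
have dd : d + d <= Num.min d1 d2 by rewrite /d; lra.
have [d1d d2d] : d + d <= d1 /\ d + d <= d2.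
  by split; apply: le_trans dd _; rewrite ge_min lexx ?orbT.
have s0 : 0 < d / 2 by rewrite divr_gt0.
have ga z : normc (z - a) < d + d -> normc (g z - g a) <= B * (d + d).
  move=> zd; have := D2 z (lt_le_trans zd d2d); rewrite mul1r => H.
  rewrite -(subrK (derive1 g a * (z - a)) (g z - g a)).
  apply: le_trans (le_normcD _ _) _.
  rewrite normcM; apply: (@le_trans _ _ (B * normc (z - a))).
    by rewrite /B mulrDl mul1r addrC lerD2l.
  by rewrite ler_wpM2l// ltW.
(* |g z' - g z| is estimated through g a by two terms B * 2d, and then divided by the radius d /
   2. *)
pose C := (B * (d + d) + B * (d + d)) / (d / 2).
have C0 : 0 < C by rewrite divr_gt0// addr_gt0// mulr_gt0// addr_gt0.
have dC z : normc (z - a) < d -> derivable g z 1 /\ normc (derive1 g z) <= C.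
  move=> zd.
  have near z' : normc (z' - z) <= d / 2 -> normc (z' - a) < d + d.
    move=> z'z; apply: le_lt_trans (le_normc_distD z _ _) _; lra.
  split; first by apply: D1; lra.
  apply: (@derive1_bound _ z _ _ s0) => z' /near z'd; first by apply: D1; lra.
  apply: le_trans (le_normc_distD (g a) _ _) _; apply: lerD; first exact: ga.
  by rewrite normc_distC; apply: ga; lra.
exists C, d; split => // z w zd wd; apply: mean_value_normc => t t01.
apply: dC; move: t01; rewrite in_itv/= => /andP[t0 t1].
have -> : w + t%:C * (z - w) - a = t%:C * (z - a) + (1 - t)%:C * (w - a).
  by rewrite rmorphB rmorph1; ring.
apply: le_lt_trans (le_normcD _ _) _; rewrite !normcM !normcR !ger0_norm ?subr_ge0//.
have [->|tp] := eqVneq t 0; first by rewrite mul0r add0r subr0 mul1r.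
have : t * normc (z - a) < t * d by rewrite ltr_pM2l// lt_def tp.
have : (1 - t) * normc (w - a) <= (1 - t) * d by rewrite ler_wpM2l ?subr_ge0// ltW.
lra.
Qed.

End LipschitzEstimate.

(** * Hausdorff measure of curves *)

Section Hausdorff.
Context {R : realType}.
Implicit Types (A B C X : set R[i]).
Local Open Scope ereal_scope.

Lemma le_diameter A x y : A x -> A y -> (normc (x - y))%:E <= diameter A.
Proof.
move=> Ax Ay; rewrite /diameter le_max; apply/orP; right.
by apply: ereal_sup_ubound; exists x => //; exists y.
Qed.

Lemma diameter_le A (d : R) : (0 <= d)%R ->
  (forall x y, A x -> A y -> (normc (x - y) <= d)%R) -> diameter A <= d%:E.
Proof.
move=> d0 H; rewrite /diameter ge_max lee_fin d0/=.
by apply: ge_ereal_sup => _ [x Ax [y Ay <-]]; rewrite lee_fin; exact: H.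
Qed.

Lemma nneseries_le_bound (u : nat -> \bar R) M : (forall n, 0 <= u n) ->
  (forall n, \sum_(0 <= i < n) u i <= M) -> \sum_(i <oo) u i <= M.
Proof.
move=> u0 H; apply: lime_le; first exact: is_cvg_nneseries.
by apply: nearW => n; exact: H.
Qed.

Lemma hausdorff_content_anti (d d' : R) A : (d <= d')%R ->
  hausdorff_content d' A <= hausdorff_content d A.
Proof.
move=> dd; apply: ereal_inf_le_tmp => _ [F [dF AF] <-]; exists F => //; split => // i.
by apply: le_trans (dF i) _; rewrite lee_fin.
Qed.

(** A set of diameter at most d < r cannot meet both A and B, so a cover of the union splits into a
    cover of A and one of B without repetition. *)
Lemma hausdorff_content_separated (r d : R) A B : (d < r)%R ->
  (forall x y, A x -> B y -> (r <= normc (x - y))%R) ->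
  hausdorff_content d A + hausdorff_content d B <= hausdorff_content d (A `|` B).
Proof.
move=> dr sep; apply: le_ereal_inf_tmp => _ [F [dF ABF] <-].
pose FA i := if `[< exists x, A x /\ F i x >] then F i else set0.
pose FB i := if `[< exists x, B x /\ F i x >] then F i else set0.
have d0 : (0 <= d%:E).
  by apply: le_trans (dF 0%N); exact: diameter_ge0.
have FAB i : diameter (FA i) + diameter (FB i) <= diameter (F i).
  rewrite /FA /FB; case: asboolP => [[x [Ax Fx]]|_]; case: asboolP => [[y [By Fy]]|_];
    rewrite ?diameter0 ?adde0 ?add0e ?diameter_ge0//.
  have := le_trans (le_diameter Fx Fy) (dF i); rewrite lee_fin.
  by move=> ?; exfalso; have := sep _ _ Ax By; lra.
have cA : hausdorff_cover d A FA.
  split=> [i|x Ax]; first by rewrite /FA; case: asboolP => // _; rewrite diameter0.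
  have [i _ Fx] := ABF _ (or_introl Ax); exists i => //; rewrite /FA.
  by case: asboolP => // -[]; exists x.
have cB : hausdorff_cover d B FB.
  split=> [i|x Bx]; first by rewrite /FB; case: asboolP => // _; rewrite diameter0.
  have [i _ Fx] := ABF _ (or_intror Bx); exists i => //; rewrite /FB.
  by case: asboolP => // -[]; exists x.
apply: (@le_trans _ _ (\sum_(i <oo) diameter (FA i) + \sum_(i <oo) diameter (FB i))).
  by apply: leeD; apply: ereal_inf_lbound; [exists FA|exists FB].
rewrite -nneseriesD; [|by move=> *; exact: diameter_ge0..].
by apply: lee_nneseries => [i _ _|i _]; rewrite ?adde_ge0 ?diameter_ge0.
Qed.

Lemma hausdorff1_separated (r : R) A B : (0 < r)%R ->
  (forall x y, A x -> B y -> (r <= normc (x - y))%R) ->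
  hausdorff1 A + hausdorff1 B <= hausdorff1 (A `|` B).
Proof.
move=> r0 sep.
have [->|fin] := eqVneq (hausdorff1 (A `|` B)) +oo; first exact: leey.
have ABfin : hausdorff1 (A `|` B) \is a fin_num by rewrite ge0_fin_numE ?hausdorff1_ge0// ltey.
have Bfin : hausdorff1 B \is a fin_num.
  rewrite ge0_fin_numE ?hausdorff1_ge0//; apply: le_lt_trans (_ : _ <= hausdorff1 (A `|` B)) _.
    by apply: le_hausdorff1; exact: subsetUr.
  by rewrite ltey.
(* The two suprema range over independent scales; both contents are compared with those at one scale
   that is also below [r]. *)
have K (d d' : R) : (0 < d)%R -> (0 < d')%R ->
    hausdorff_content d A + hausdorff_content d' B <= hausdorff1 (A `|` B).
  move=> d0 d'0; pose e := Num.min (Num.min d d') (r / 2)%R.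
  have e0 : (0 < e)%R by rewrite !lt_min d0 d'0 divr_gt0.
  apply: le_trans (hausdorff_content_le _ e0).
  apply: le_trans (hausdorff_content_separated _ sep).
    by apply: leeD; apply: hausdorff_content_anti; rewrite !ge_min lexx ?orbT.
  by rewrite (@le_lt_trans _ _ (r / 2)%R) ?ge_min ?lexx ?orbT// ltr_pdivrMr// ltr_pMr// ltr1n.
rewrite -leeBrDr//; apply: ge_ereal_sup => _ [d /= d0 <-].
have cfin : hausdorff_content d A \is a fin_num.
  rewrite ge0_fin_numE ?hausdorff_content_ge0//.
  apply: le_lt_trans (_ : _ <= hausdorff1 (A `|` B)) _; last by rewrite ltey.
  apply: le_trans (hausdorff_content_le _ d0) _.
  by apply: le_hausdorff1; exact: subsetUl.
rewrite leeBrDr// addeC -leeBrDr//; apply: ge_ereal_sup => _ [d' /= d'0 <-].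
by rewrite leeBrDr// addeC; exact: K.
Qed.

(* Caratheodory's criterion for metric outer measures: the shells of points
   at distance about 1/n from [C] have summable measure because every second
   one is separated from the previous ones. *)
Lemma caratheodory_separated C :
  (forall x, ~ C x -> exists2 r : R, (0 < r)%R & forall y, C y -> (r <= normc (x - y))%R) ->
  caratheodory_measurable (@hausdorff1 R) C.
Proof.
move=> sepC; apply: (@le_caratheodory_measurable R R[i] (hausdorff1_outer R)) => X.
change (hausdorff1 (X `&` C) + hausdorff1 (X `&` ~` C) <= hausdorff1 X).
have [->|Xoo] := eqVneq (hausdorff1 X) +oo; first exact: leey.
have Xfin : hausdorff1 X < +oo by rewrite ltey.
pose An n := [set x | X x /\ forall y, C y -> (n.+1%:R^-1 <= normc (x - y) :> R)%R].
pose D n := An n.+1 `\` An n.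
have AnX n : An n `<=` X by move=> x [].
have fin Y : Y `<=` X -> hausdorff1 Y \is a fin_num.
  move=> YX; rewrite ge0_fin_numE ?hausdorff1_ge0//.
  by apply: le_lt_trans Xfin; exact: le_hausdorff1.
have DX n : D n `<=` X by move=> x [[]].
have Anm n m : (n <= m)%N -> An n `<=` An m.
  move=> nm x [Xx H]; split => // y Cy; apply: le_trans (H y Cy).
  by rewrite lef_pV2 ?posrE// ler_nat.
(* A point of [D m.+1] is closer than 1/(m+2) to some point of [C], a point of [An m] is at least
   1/(m+1) away from it: the two sets are a positive distance apart. *)
have step m : hausdorff1 (D m.+1) + hausdorff1 (An m) <= hausdorff1 (An m.+2).
  pose r := (m.+1%:R^-1 - m.+2%:R^-1 : R)%R.
  have r0 : (0 < r)%R by rewrite subr_gt0 ltf_pV2 ?posrE// ltr_nat.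
  apply: le_trans (hausdorff1_separated r0 _) _; last first.
    apply: le_hausdorff1 => x [[]//|]; apply: Anm; exact: leqW.
  move=> x y [[Xx H1] nH] [Xy Hy].
  have [w Cw ww] : exists2 w, C w & (normc (x - w) < m.+2%:R^-1)%R.
    apply: contrapT => nex; apply: nH; split => // w Cw; rewrite leNgt.
    by apply/negP => ?; apply: nex; exists w.
  move: ww (Hy w Cw) (le_normc_distD x y w); rewrite (normc_distC y x) /r.
  by move: (m.+1%:R^-1 : R)%R (m.+2%:R^-1 : R)%R => p q; lra.
set a := fun n => fine (hausdorff1 (An n)).
have aE n : hausdorff1 (An n) = (a n)%:E by rewrite fineK// fin.
have aX n : (a n <= fine (hausdorff1 X))%R by rewrite fine_le ?fin// le_hausdorff1.
have hsup : has_sup (range a).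
  split; first by exists (a 0%N); exists 0%N.
  by exists (fine (hausdorff1 X)) => _ [n _ <-].
apply/lee_addgt0Pr => e e0.
have e20 : (0 < e / 2)%R by rewrite divr_gt0.
(* With a n within e/2 of the supremum L, all further shells together weigh at most 2 L - 2 a n <
   e. *)
have [_ [n _ <-] Ln] := sup_adherent e20 hsup.
set L := sup (range a) in Ln.
have aL m : (a m <= L)%R by apply: ub_le_sup; [case: hsup|exists m].
(* Keeping two consecutive sets on each side treats the shells of even and of odd index at once. *)
have tail N : \sum_(0 <= k < N) hausdorff1 (D (n + k).+1) + hausdorff1 (An n) + hausdorff1 (An n.+1)
     <= hausdorff1 (An (n + N)%N) + hausdorff1 (An (n + N).+1).
  elim: N => [|N IH]; first by rewrite big_nil add0e addn0.
  rewrite big_nat_recr//= addnS; have := leeD (step (n + N)%N) IH.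
  set S := \sum_(0 <= k < N) _.
  have Sf : S \is a fin_num by apply/sum_fin_numP => i _ _; exact: fin.
  by rewrite !aE -(fineK (fin _ (@DX (n + N).+1))) -(fineK Sf) -!EFinD !lee_fin; lra.
have cov : X `&` ~` C `<=` An n.+1 `|` \bigcup_k D (n + k).+1.
  move=> x [Xx /sepC[r r0 rP]].
  have [m mr] : exists m : nat, (m.+1%:R^-1 <= r)%R.
    exists (Num.bound r^-1); rewrite invf_ple ?posrE//.
    have /archi_boundP : (0 <= r^-1)%R by rewrite invr_ge0 ltW.
    by move/ltW/le_trans; apply; rewrite ler_nat.
  have xm : An m x by split => // y Cy; exact: le_trans mr (rP y Cy).
  have [mn|nm] := leqP m n.+1; first by left; exact: Anm mn _ xm.
  have [xn|xn] := pselect (An n.+1 x); [by left|right].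
  have first j : An (n.+1 + j)%N x -> exists k, D (n + k).+1 x.
    elim: j => [|j IH]; first by rewrite addn0.
    have [/IH//|nj] := pselect (An (n.+1 + j)%N x).
    by rewrite addnS => Aj; exists j.
  have [|k Dk] := first (m - n.+1)%N; first by rewrite subnKC// ltnW.
  by exists k.
have tails : \sum_(k <oo) hausdorff1 (D (n + k).+1) <= e%:E.
  apply: nneseries_le_bound => [k|N]; first exact: hausdorff1_ge0.
  have := tail N; set S := \sum_(0 <= k < N) _.
  have Sf : S \is a fin_num by apply/sum_fin_numP => i _ _; exact: fin.
  rewrite !aE -(fineK Sf) -!EFinD !lee_fin.
  have : (a n <= a n.+1)%R.
    by rewrite fine_le ?fin// le_hausdorff1//; exact: Anm.
  by have := aL (n + N)%N; have := aL (n + N).+1; lra.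
apply: (@le_trans _ _ (hausdorff1 (X `&` C) + (hausdorff1 (An n.+1) + e%:E))).
  apply: leeD => //; apply: le_trans (le_hausdorff1 cov) _.
  apply: le_trans (outer_measureU2 (hausdorff1_outer R) _ _) _.
  apply: leeD => //; apply: le_trans tails.
  exact: hausdorff1_sigma_subadditive.
rewrite addeA leeD2r//.
apply: le_trans (hausdorff1_separated (r := n.+2%:R^-1) _ _) _.
- by rewrite invr_gt0.
- move=> x y [_ Cx] [_ Hy]; rewrite normc_distC; exact: Hy.
- by apply: le_hausdorff1 => x [[]//|[]].
Qed.

Lemma itv_cover (a h t : R) n : (0 <= h)%R -> (a <= t <= a + n.+1%:R * h)%R ->
  exists2 i, (i < n.+1)%N & (a + i%:R * h <= t <= a + i.+1%:R * h)%R.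
Proof.
move=> h0; elim: n => [|n IH] /andP[ta tn].
  by exists 0%N => //; rewrite mul0r addr0 ta.
have [tn'|tn'] := leP t (a + n.+1%:R * h)%R.
  by have [|i ni it] := IH; [rewrite ta|exists i => //; exact: leqW].
by exists n.+1 => //; rewrite (ltW tn').
Qed.

Lemma hausdorff1_curve_le (gam : R -> R[i]) (a b L : R) : (a <= b)%R -> (0 <= L)%R ->
  (forall s t, s \in `[a, b] -> t \in `[a, b] -> (normc (gam s - gam t) <= L * `|s - t|)%R) ->
  hausdorff1 (gam @` `[a, b]) <= (L * (b - a))%:E.
Proof.
move=> ab L0 gL; apply: ge_ereal_sup => _ [d /= d0 <-].
have ba0 : (0 <= b - a)%R by rewrite subr_ge0.
have LB0 : (0 <= L * (b - a) / d)%R by rewrite divr_ge0 ?mulr_ge0// ltW.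
(* Fine enough for each of the n + 1 equal pieces to have an image of diameter at most [d]. *)
pose n := Num.bound (L * (b - a) / d); pose h := ((b - a) / n.+1%:R)%R.
have h0 : (0 <= h)%R by rewrite divr_ge0.
have nh : (n.+1%:R * h = b - a)%R by rewrite mulrC divfK// pnatr_eq0.
have Lh : (L * h <= d)%R.
  rewrite /h mulrA ler_pdivrMr ?ltr0n// -ler_pdivrMl// mulrC.
  by apply: le_trans (ltW (archi_boundP LB0)) _; rewrite ler_nat.
(* Covers are indexed by all of [nat]; the empty sets at the end have diameter 0. *)
pose F i := if (i < n.+1)%N then
  gam @` [set t | t \in `[a, b] /\ (a + i%:R * h <= t <= a + i.+1%:R * h)%R] else set0.
have dF i : diameter (F i) <= if (i < n.+1)%N then (L * h)%:E else 0.
  rewrite /F; case: ifP => _; last by rewrite diameter0.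
  apply: diameter_le; first exact: mulr_ge0.
  move=> _ _ [s [sab sI] <-] [t [tab tI] <-]; apply: le_trans (gL _ _ sab tab) _.
  rewrite ler_wpM2l// ler_norml; move: sI tI; rewrite -[i.+1%:R]natr1 mulrDl mul1r.
  by move: (i%:R * h)%R => u; lra.
apply: (@le_trans _ _ (\sum_(i <oo) diameter (F i))).
  apply: ereal_inf_lbound; exists F => //; split.
    move=> i; apply: le_trans (dF i) _; case: ifP => _; rewrite lee_fin//; exact: ltW.
  move=> _ [t tab <-]; have tab' := tab; move: tab'; rewrite /= in_itv/= => /andP[ta tb].
  have [|i ni it] := @itv_cover a h t n h0; first by rewrite nh ta subrKC.
  by exists i => //; rewrite /F ni; exists t.
rewrite (@nneseries_split _ _ 0 n.+1); last by move=> *; exact: diameter_ge0.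
rewrite add0n [X in _ + X]eseries0 ?adde0; last first.
  by move=> i ni _; rewrite /F ltnNge ni/= diameter0.
apply: (@le_trans _ _ (\sum_(0 <= i < n.+1) (L * h)%:E)).
  rewrite !big_nat; apply: lee_sum => i /andP[_ ni].
  by apply: le_trans (dF i) _; rewrite ni.
by rewrite sumEFin lee_fin sumr_const_nat subn0 -mulr_natl mulrCA nh.
Qed.

(* A cover of the curve by small sets pulls back to a cover of the parameter
   interval by sets of diameter at most 1/c times as large. *)
Lemma hausdorff1_curve_ge (gam : R -> R[i]) (a b c sig d0 : R) : (0 < c)%R -> (0 < d0)%R ->
  (forall s t, s \in `[a, b] -> t \in `[a, b] -> (`|s - t| < sig)%R ->
     (c * `|s - t| <= normc (gam s - gam t))%R) ->
  (forall s t, s \in `[a, b] -> t \in `[a, b] -> (sig <= `|s - t|)%R ->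
     (d0 <= normc (gam s - gam t))%R) ->
  (c * (b - a))%:E <= hausdorff1 (gam @` `[a, b]).
Proof.
move=> c0 d00 H1 H2.
(* At this scale a set of the cover cannot contain points whose parameters are [sig] or more apart,
   so the local bound with constant [c] always applies. *)
have d20 : (0 < d0 / 2)%R by rewrite divr_gt0.
apply: le_trans (hausdorff_content_le _ d20).
apply: le_ereal_inf_tmp => _ [F [dF cov] <-].
have Ffin i : diameter (F i) \is a fin_num.
  rewrite ge0_fin_numE ?diameter_ge0//; apply: le_lt_trans (dF i) _; exact: ltry.
pose r i := fine (diameter (F i)).
have r0 i : (0 <= r i)%R by rewrite fine_ge0// diameter_ge0.
pose E i := [set t | t \in `[a, b] /\ F i (gam t)].
have EE i s t : E i s -> E i t -> (c * `|s - t| <= r i)%R.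
  move=> [sI Fs] [tI Ft].
  have := le_diameter Fs Ft; rewrite -(fineK (Ffin i)) lee_fin => D1.
  have D2 : (r i <= d0 / 2)%R by have := dF i; rewrite -(fineK (Ffin i)) lee_fin.
  have [st|st] := ltP `|s - t|%R sig; first exact: le_trans (H1 _ _ sI tI st) D1.
  have := H2 _ _ sI tI st; have := r0 i; rewrite -/(r i) in D1; lra.
(* A set of parameters of diameter at most r i / c lies in the segment of that length that starts at
   its infimum; if it is empty, any segment will do. *)
have [J JP] : exists J : nat -> R, forall i, E i `<=` `[J i, (J i + r i / c)%R].
  suff /choice[J JP] : forall i, exists j : R, E i `<=` `[j, (j + r i / c)%R] by exists J.
  move=> i; have [[t0 Et0]|nE] := pselect (E i !=set0); last first.
    by exists 0%R => t Et; exfalso; apply: nE; exists t.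
  have li : lbound (E i) (t0 - r i / c)%R.
    move=> t Et; have := EE _ _ _ Et0 Et; rewrite mulrC -ler_pdivlMr// ler_norml; lra.
  have hi : has_inf (E i) by split; [exists t0|exists (t0 - r i / c)%R].
  exists (inf (E i)) => t Et /=; rewrite in_itv/=; apply/andP; split.
    by apply: ge_inf => //; case: hi.
  rewrite -lerBlDr; apply: lb_le_inf; first by exists t0.
  move=> s Es; have := EE _ _ _ Et Es; rewrite mulrC -ler_pdivlMr// ler_norml; lra.
have [ba|ab] := ltP b a.
  apply: (@le_trans _ _ 0); last by apply: nneseries_ge0 => *; exact: diameter_ge0.
  by rewrite lee_fin mulr_ge0_le0 ?ltW// subr_lt0.
have mJ i : lebesgue_measure `[J i, (J i + r i / c)%R] = (c^-1)%:E * diameter (F i).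
  rewrite lebesgue_measure_itv/= lte_fin ltrDl -(fineK (Ffin i)) -/(r i) -EFinM.
  case: ifPn => [_|]; first by rewrite -EFinD; congr (_%:E); ring.
  rewrite -leNgt => H; have -> : (c^-1 * r i = 0)%R; last by [].
  by apply/eqP; rewrite eq_le mulrC H divr_ge0// ltW.
have : lebesgue_measure `[a, b] <= \sum_(i <oo) lebesgue_measure `[J i, (J i + r i / c)%R].
  apply: measure_sigma_subadditive => // t /= tab.
  have [i _ Ft] : (\bigcup_i F i) (gam t) by apply: cov; exists t.
  by exists i => //; apply: JP.
under eq_eseriesr do rewrite mJ.
rewrite nneseriesZl; last by move=> *; exact: diameter_ge0.
have -> : lebesgue_measure `[a, b] = (b - a)%:E.
  rewrite lebesgue_measure_itv/= lte_fin; move: ab; rewrite le_eqVlt.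
  by move=> /predU1P[->|->//]; rewrite ltxx subrr.
by rewrite lee_pdivlMl// -EFinM.
Qed.

End Hausdorff.

(** * Level curves near a zero *)

Section ChordLength.
Context {R : realType}.
Implicit Types s t x : R.

Lemma normr_sin_le x : `|sin x| <= `|x|.
Proof.
wlog x0 : x / 0 <= x.
  move=> W; have [/W//|/ltW x0] := leP 0 x.
  by rewrite -(normrN x) -[X in X <= _]normrN -sinN; apply: W; rewrite oppr_ge0.
move: x0; rewrite le_eqVlt => /predU1P[<-|x0]; first by rewrite sin0 !normr0.
have [|c _] := @MVT_segment R sin cos 0 x (ltW x0) (fun t _ => is_derive_sin t).
  by apply: continuous_subspaceT => t; exact: continuous_sin.
by rewrite sin0 !subr0 => ->; rewrite normrM ler_piMl// cos_max.
Qed.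

Lemma normc_cisB s t : normc (cis s - cis t) = 2 * `|sin ((s - t) / 2)|.
Proof.
apply/eqP; rewrite -(@eqrXn2 _ 2) ?normc_ge0 ?mulr_ge0//; apply/eqP.
rewrite normc_sqr ReB ImB /= exprMn real_normK ?num_real//.
have E : cos (s - t) = 1 - 2 * sin ((s - t) / 2) ^+ 2.
  rewrite {1}(_ : s - t = (s - t) / 2 *+ 2); last by rewrite -mulr_natr divfK.
  by rewrite cos_mulr2n sin2cos2; ring.
have := E; rewrite cosB => E1.
have := cos2Dsin2 s; have := cos2Dsin2 t => C1 C2.
transitivity ((cos s ^+ 2 + sin s ^+ 2) + (cos t ^+ 2 + sin t ^+ 2)
  - 2 * (cos s * cos t + sin s * sin t)); first by ring.
by rewrite C1 C2 E1; ring.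
Qed.

Lemma normc_cisB_le s t : normc (cis s - cis t) <= `|s - t|.
Proof.
rewrite normc_cisB (le_trans (ler_wpM2l _ (normr_sin_le _)))// normrM.
by rewrite [`|2^-1|]gtr0_norm// mulrCA divff// mulr1.
Qed.

(* The bound [L < 2 * pi] keeps the chord from closing up. *)
Lemma normc_cisB_ge (lam L : R) : 1 < lam -> L < pi *+ 2 ->
  exists sig d0 : R, [/\ 0 < sig, 0 < d0,
    forall s t, `|s - t| < sig -> lam^-1 * `|s - t| <= normc (cis s - cis t) &
    forall s t, sig <= `|s - t| <= L -> d0 <= normc (cis s - cis t)].
Proof.
move=> lam1 Lpi.
have lam0 : 0 < lam := lt_trans ltr01 lam1.
have li1 : lam^-1 < 1 by rewrite invf_lt1.
(* Since sin'(0) = 1, this accuracy gives |sin x| >= |x| / lam for small x, and a chord is 2 |sin|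
   of half the angle. *)
have [|d d0 dP] := eps_is_derive (is_derive_sin (0 : R)) (eta := 1 - lam^-1).
  by rewrite subr_gt0.
have near s t : `|s - t| < d -> lam^-1 * `|s - t| <= normc (cis s - cis t).
  move=> st; rewrite normc_cisB.
  have st2 : `|(s - t) / 2| = `|s - t| / 2 by rewrite normrM [`|2^-1|]gtr0_norm.
  have := dP ((s - t) / 2); rewrite subr0 sin0 subr0 cos0 mul1r st2.
  have -> : `|s - t| / 2 < d by have := normr_ge0 (s - t); lra.
  move/(_ isT) => B.
  have := ler_normD ((s - t) / 2 - sin ((s - t) / 2)) (sin ((s - t) / 2)).
  rewrite subrK st2 (distrC ((s - t) / 2)); lra.
(* If L < d, no pair satisfies the far condition and the bound 1 is arbitrary. *)
have [Ld|dL] := ltP L d.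
  exists d, 1; split => // s t /andP[st stL]; have := le_lt_trans (le_trans st stL) Ld.
  by rewrite ltxx.
(* The half angles range over a segment strictly between 0 and pi, where the minimum of sin is
   positive. *)
have [||c cI cP] := @EVT_min R sin (d / 2) (L / 2).
- by rewrite ler_pM2r.
- by apply: continuous_subspaceT => t; exact: continuous_sin.
have sc : 0 < sin c.
  apply: sin_gt0_pi; move: cI; rewrite in_itv/= => /andP[c1 c2].
  have : L / 2 < pi by rewrite ltr_pdivrMr// mulr_natr.
  have : 0 < d / 2 by rewrite divr_gt0.
  lra.
exists d, (2 * sin c); split => //; first by rewrite mulr_gt0.
move=> s t /andP[ds sL]; rewrite normc_cisB ler_pM2l//.
have E : `|sin ((s - t) / 2)| = `|sin (`|s - t| / 2)|.
  have [st|st] := leP 0 (s - t); first by rewrite (ger0_norm st).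
  by rewrite (ltr0_norm st) mulNr sinN normrN.
rewrite E; apply: le_trans (ler_norm _); apply: cP.
by rewrite in_itv/= !ler_pM2r// ds.
Qed.

End ChordLength.

Lemma normc_natr (R : realType) n : normc (n%:R : R[i]) = n%:R.
Proof. by rewrite normcMn normc1. Qed.

Section Root.
Context {R : realType}.
Implicit Types x y : R.

Definition nroot (k : nat) x := x `^ k%:R^-1.

Lemma nroot_ge0 k x : 0 <= nroot k x.
Proof. exact: powR_ge0. Qed.

Lemma nrootK k x : (0 < k)%N -> 0 <= x -> nroot k x ^+ k = x.
Proof.
move=> k0 x0; rewrite -powR_mulrn ?nroot_ge0// /nroot -powRrM mulVf ?powRr1//.
by rewrite pnatr_eq0 -lt0n.
Qed.

Lemma nroot_gt0 k x : 0 < x -> 0 < nroot k x.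
Proof. exact: powR_gt0. Qed.

(** In the factorization of the difference of powers the summand x^k alone is at least m^k. The
    lemma transfers a Lipschitz bound from a power to its root. *)
Lemma expr_dist_ge (k : nat) x y (m : R) : 0 <= m <= 1 -> m <= x -> m <= y ->
  m ^+ k * `|x - y| <= `|x ^+ k.+1 - y ^+ k.+1|.
Proof.
move=> /andP[m0 m1] mx my; rewrite subrXX normrM mulrC ler_wpM2l//.
apply: le_trans (ler_norm _).
rewrite (bigD1 ord0)//= expr0 mulr1 subn0.
apply: (@le_trans _ _ (x ^+ k)); first by rewrite lerXn2r ?nnegrE// (le_trans m0).
rewrite lerDl sumr_ge0// => i _.
by rewrite mulr_ge0// exprn_ge0// (le_trans m0).
Qed.

End Root.

Section LocalForm.
Context {R : realType}.
Variables (f g : R[i] -> R[i]) (a : R[i]) (k : nat).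
Hypothesis dg : \forall z \near a, derivable g z 1.
Hypothesis ga : g a != 0.
Hypothesis fE : \forall z \near a, f z = (z - a) ^+ k.+1 * g z.

Lemma derive1_local : \forall z \near a,
  derive1 f z = k.+1%:R * (z - a) ^+ k * g z + (z - a) ^+ k.+1 * derive1 g z.
Proof.
have /near_normcP[d1 d10 D1] := dg; have /near_normcP[d2 d20 D2] := fE.
apply/near_normcP; exists (Num.min d1 d2); first by rewrite lt_min d10.
move=> z; rewrite lt_min => /andP[z1 z2].
have E : \forall z' \near z, f z' = (z' - a) ^+ k.+1 * g z'.
  apply/near_normcP; exists (d2 - normc (z - a)); first by rewrite subr_gt0.
  move=> z' z'z; apply: D2; apply: le_lt_trans (le_normc_distD z _ _) _; lra.
rewrite !derive1E.
have dz : derivable (fun z => z - a) z 1 :=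
  derivableB (@derivable_id _ _ z 1) (derivable_cst a z 1).
have FE : (fun z => (z - a) ^+ k.+1 * g z) = (fun z => z - a) ^+ k.+1 * g.
  by apply/funext => x; rewrite /GRing.mul/= exprfctE.
rewrite (_ : 'D_1 f z = 'D_1 ((fun z => z - a) ^+ k.+1 * g) z); last first.
  by rewrite -FE; exact: near_eq_derive.
have dX : derivable ((fun z => z - a) ^+ k.+1) z 1 by exact: derivableX.
rewrite (deriveM dX (D1 _ z1)) (deriveX k.+1 dz).
rewrite (deriveB (@derivable_id _ _ z 1) (derivable_cst a z 1)).
rewrite derive_id derive_cst subr0 exprfctE /= [_ *: 1]mulr1.
by rewrite addrC; congr (_ + _); exact: mulrC.
Qed.

Let M := normc (g a).

Let M_gt0 : 0 < M. Proof. by rewrite normc_gt0. Qed.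

(* In the almost isometric coordinate w |-> G(w) w, the modulus of f is that of a
   power map. *)
Lemma local_form (lam delta : R) : 1 < lam -> 0 < delta ->
  exists (d : R) (G : R[i] -> R), [/\ 0 < d, d <= delta,
    forall w, normc w < d -> [/\ normc (f (a + w)) = M * (normc w * G w) ^+ k.+1,
      lam^-1 <= G w, G w <= lam,
      lam^-1 * (k.+1%:R * M * normc w ^+ k) <= normc (derive1 f (a + w)) &
      normc (derive1 f (a + w)) <= lam * (k.+1%:R * M * normc w ^+ k)] &
    forall w w', normc w < d -> normc w' < d ->
      lam^-1 * normc (w - w') <= normc ((G w)%:C * w - (G w')%:C * w') /\
      normc ((G w)%:C * w - (G w')%:C * w') <= lam * normc (w - w')].
Proof.
move=> lam1 delta0.
have lam0 : 0 < lam := lt_trans ltr01 lam1.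
have li1 : lam^-1 < 1 by rewrite invf_lt1.
have li0 : 0 < lam^-1 by rewrite invr_gt0.
(* This is lam + 1/lam >= 2: a deviation of 1 - 1/lam from 1 is then admissible in both
   directions. *)
have lam2 : 1 + (1 - lam^-1) <= lam.
  have : 0 <= (lam - 1) ^+ 2 / lam by rewrite divr_ge0 ?sqr_ge0// ltW.
  by rewrite (_ : _ / lam = lam - 2 + lam^-1); [lra|field; rewrite gt_eqF].
(* Small enough for the two errors of size eta in the isometry estimate, and at most 1/4, which
   keeps G above 1/2. *)
pose eta := (1 - lam^-1) / 4.
have eta0 : 0 < eta by rewrite divr_gt0// subr_gt0.
have eta1 : eta <= 1 / 4 by rewrite /eta; lra.
have [C [d1 [C0 d10 D1 L1]]] := holomorphic_locally_lipschitz dg.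
have /near_normcP[d2 d20 D2] := derive1_local.
have /near_normcP[d3 d30 D3] := fE.
(* A Lipschitz constant for G: that of h is C / M, and taking the root costs 2^k because G >=
   1/2. *)
pose C' := 2 ^+ k * (C / M).
have C'0 : 0 < C' by rewrite mulr_gt0 ?exprn_gt0 ?divr_gt0.
have CM : C / M <= C'.
  rewrite -[leLHS]mul1r; apply: ler_wpM2r; first by rewrite divr_ge0// ltW.
  by rewrite exprn_ege1// ler1n.
pose d := Num.min (Num.min delta d1) (Num.min (Num.min d2 d3)
   (Num.min (eta / C') (eta * M / (C * 2)))).
have e1 : 0 < eta / C' by exact: divr_gt0.
have e2 : 0 < eta * M / (C * 2) by apply: divr_gt0; exact: mulr_gt0.
have d0 : 0 < d by rewrite !lt_min delta0 d10 d20 d30 e1 e2.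
have dle x : normc x < d -> [/\ normc x < d1, normc x < d2, normc x < d3,
    C' * normc x <= eta & C * 2 * normc x <= eta * M].
  rewrite !lt_min => /andP[/andP[_ ->]] /andP[/andP[-> ->]] /andP[H1 H2]; split => //.
    by rewrite mulrC -ler_pdivlMr// ltW.
  by rewrite mulrC -ler_pdivlMr ?mulr_gt0// ltW.
have aw w : a + w - a = w by rewrite addrC addKr.
have a0 : normc (a - a) < d1 by rewrite subrr normc0.
have gw w : normc w < d -> normc (g (a + w) - g a) <= C * normc w.
  by move=> /dle[wd _ _ _ _]; have := L1 (a + w) a; rewrite aw; exact.
pose h w := normc (g (a + w)) / M.
have h1 w : normc w < d -> `|h w - 1| <= C / M * normc w.
  move=> wd; rewrite /h -(@divff _ M) ?gt_eqF// -mulrBl normrM normfV (gtr0_norm M_gt0).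
  rewrite mulrAC ler_pM2r ?invr_gt0//; apply: le_trans (gw _ wd).
  have := le_normcB (g (a + w)) (g a); have := le_normcB (g a) (g (a + w)).
  by rewrite (normc_distC (g a)) ler_norml -/M; lra.
have hh w w' : normc w < d -> normc w' < d -> `|h w - h w'| <= C / M * normc (w - w').
  move=> wd w'd; rewrite /h -mulrBl normrM normfV (gtr0_norm M_gt0).
  rewrite mulrAC ler_pM2r ?invr_gt0//.
  apply: (@le_trans _ _ (normc (g (a + w) - g (a + w')))).
    have := le_normcB (g (a + w)) (g (a + w')); have := le_normcB (g (a + w')) (g (a + w)).
    by rewrite (normc_distC (g (a + w'))) ler_norml; lra.
  have [wd1 _ _ _ _] := dle _ wd; have [wd2 _ _ _ _] := dle _ w'd.
  have := L1 (a + w) (a + w'); rewrite !aw => /(_ wd1 wd2).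
  by rewrite opprD addrACA subrr add0r.
have h0 w : 0 <= h w by rewrite divr_ge0 ?normc_ge0// ltW.
pose G w := nroot k.+1 (h w).
have G0 w : 0 <= G w := nroot_ge0 _ _.
have GK w : G w ^+ k.+1 = h w by rewrite nrootK.
(* G^(k+1) - 1 is G - 1 times a sum of nonnegative terms that includes 1, so the root is at least as
   close to 1 as the power. *)
have G1 w : normc w < d -> `|G w - 1| <= eta.
  move=> wd; apply: (@le_trans _ _ `|h w - 1|); last first.
    apply: le_trans (h1 _ wd) _; have [_ _ _ H _] := dle _ wd; apply: le_trans H.
    by rewrite ler_wpM2r ?normc_ge0.
  have -> : h w - 1 = G w ^+ k.+1 - 1 ^+ k.+1 by rewrite GK expr1n.
  rewrite subrXX normrM ler_peMr//.
  apply: le_trans (ler_norm _); rewrite (bigD1 ord_max)//= subnn expr0 mul1r expr1n.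
  by rewrite lerDl sumr_ge0// => i _; rewrite mulr_ge0// exprn_ge0.
have Ghalf w : normc w < d -> 2^-1 <= G w.
  by move=> /G1; rewrite ler_norml; lra.
have GG w w' : normc w < d -> normc w' < d -> `|G w - G w'| <= C' * normc (w - w').
  move=> wd w'd; have := hh _ _ wd w'd; rewrite -!GK => H.
  have h2 : (0 : R) <= 2^-1 <= (1 : R).
    by rewrite invr_ge0 ler0n invf_le1// ler1n.
  have := le_trans (expr_dist_ge k h2 (Ghalf _ wd) (Ghalf _ w'd)) H.
  by rewrite exprVn -ler_pdivlMl ?invr_gt0 ?exprn_gt0// invrK mulrA.
have fd w : normc w < d -> (1 - eta) * (k.+1%:R * M * normc w ^+ k) <=
    normc (derive1 f (a + w)) <= (1 + eta) * (k.+1%:R * M * normc w ^+ k).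
  move=> wd; have [wd1 wd2 wd3 H1 H2] := dle _ wd.
  (* [A] is the derivative of the leading term, with g frozen at [a]; the two parts of [X] are of
     order |w|^(k+1). *)
  rewrite D2 aw//; pose A : R[i] := k.+1%:R * w ^+ k * g a.
  pose X := k.+1%:R * w ^+ k * (g (a + w) - g a) + w ^+ k.+1 * derive1 g (a + w).
  have EAX : k.+1%:R * w ^+ k * g (a + w) + w ^+ k.+1 * derive1 g (a + w) = A + X.
    by rewrite /A /X; ring.
  have wk : 0 <= normc w ^+ k by rewrite exprn_ge0// normc_ge0.
  have nA : normc A = k.+1%:R * M * normc w ^+ k.
    by rewrite /A !normcM normcX normc_natr mulrAC.
  have nX : normc X <= eta * normc A.
    rewrite nA; apply: le_trans (le_normcD _ _) _; rewrite !normcM !normcX normc_natr.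
    have Q1 : normc (derive1 g (a + w)) <= C by have := D1 (a + w); rewrite aw => /(_ wd1)[].
    have Q2 := gw _ wd.
    apply: (@le_trans _ _ (k.+1%:R * normc w ^+ k * (C * normc w) + normc w ^+ k.+1 * C)).
      by apply: lerD; apply: ler_wpM2l => //; rewrite ?mulr_ge0// exprn_ge0// normc_ge0.
    apply: (@le_trans _ _ (k.+1%:R * normc w ^+ k * (C * 2 * normc w))).
      have -> : k.+1%:R * normc w ^+ k * (C * 2 * normc w) =
         k.+1%:R * normc w ^+ k * (C * normc w) + k.+1%:R * (normc w ^+ k.+1 * C).
        by rewrite exprS; ring.
      rewrite lerD2l ler_peMl ?ler1n//; apply: mulr_ge0; last exact: ltW.
      by rewrite exprn_ge0// normc_ge0.
    have -> : eta * (k.+1%:R * M * normc w ^+ k) = k.+1%:R * normc w ^+ k * (eta * M).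
      by ring.
    by rewrite ler_wpM2l// mulr_ge0.
  rewrite EAX -nA; apply/andP; split.
    have := le_normcB A (- X); rewrite opprK normcN; lra.
  have := le_normcD A X; lra.
have kM w : 0 <= k.+1%:R * M * normc w ^+ k.
  by rewrite mulr_ge0 ?exprn_ge0 ?normc_ge0// mulr_ge0// ltW.
exists d, G; split => //; first by rewrite !ge_min lexx.
- move=> w wd; have [wd1 wd2 wd3 H1 H2] := dle _ wd; split.
  + rewrite D3 aw// normcM normcX exprMn GK /h; field; rewrite gt_eqF//.
  + have := G1 _ wd; rewrite ler_norml /eta; lra.
  + have := G1 _ wd; rewrite ler_norml /eta; lra.
  + have := fd _ wd; set A := _ * _ => /andP[+ _]; apply: le_trans.
    by rewrite ler_wpM2r// /eta; lra.
  + have := fd _ wd; set A := _ * _ => /andP[_ +]; move/le_trans; apply.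
    by rewrite ler_wpM2r// /eta; lra.
- move=> w w' wd w'd.
  have [_ _ _ H1 _] := dle _ wd; have [_ _ _ H2 _] := dle _ w'd.
  set P := (G w)%:C * w - (G w')%:C * w'.
  (* This splitting separates the size of G - 1 from the variation of G, for which a Lipschitz bound
     suffices. *)
  pose X := (G w - 1)%:C * (w - w') + (G w - G w')%:C * w'.
  have PE : P = (w - w') + X by rewrite /P /X !rmorphB rmorph1; ring.
  have B1 : normc ((G w - 1)%:C * (w - w')) <= eta * normc (w - w').
    by rewrite normcM normcR ler_wpM2r ?normc_ge0// G1.
  have B2 : normc ((G w - G w')%:C * w') <= eta * normc (w - w').
    rewrite normcM normcR (le_trans (ler_wpM2r (normc_ge0 _) (GG _ _ wd w'd)))//.
    by rewrite mulrAC ler_wpM2r ?normc_ge0.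
  have B3 : normc X <= _ := le_normcD ((G w - 1)%:C * (w - w')) ((G w - G w')%:C * w').
  have X2 : normc X <= (1 - lam^-1) * normc (w - w').
    have e4 : (1 - lam^-1) * normc (w - w') = 4 * (eta * normc (w - w')).
      by rewrite /eta; field; rewrite gt_eqF.
    have : 0 <= eta * normc (w - w') by rewrite mulr_ge0 ?normc_ge0// ltW.
    rewrite e4; lra.
  have L2 : (1 + (1 - lam^-1)) * normc (w - w') <= lam * normc (w - w').
    by rewrite ler_wpM2r ?normc_ge0.
  split.
    have := le_normcB (w - w') (- X); rewrite opprK -PE normcN; lra.
  have := le_normcD (w - w') X; rewrite -PE; lra.
Qed.

End LocalForm.

Section Arc.
Context {R : realType}.

(** The distance from a point off the curve to the compact parameter segment's image attains its
    minimum, which is then positive. *)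
Lemma lipschitz_curve_caratheodory (gam : R -> R[i]) (a b L : R) : a <= b ->
  (forall s t, normc (gam s - gam t) <= L * `|s - t|) ->
  caratheodory_measurable (@hausdorff1 R) (gam @` `[a, b]).
Proof.
move=> ab gL; apply: caratheodory_separated => x nx.
have [|c cab cP] := @EVT_min R (fun t => normc (x - gam t)) a b ab.
  apply: continuous_subspaceT => t; apply: (@lipschitz_at_continuous _ _ _ L 1) => // s _.
  apply: le_trans (gL s t).
  have := le_normcB (x - gam s) (x - gam t); have := le_normcB (x - gam t) (x - gam s).
  have E : x - gam s - (x - gam t) = - (gam s - gam t) by ring.
  rewrite (normc_distC (x - gam t)) E normcN ler_norml; lra.
exists (normc (x - gam c)).
  by rewrite normc_gt0 subr_eq0; apply/eqP => xc; apply: nx; exists c.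
by move=> _ [t tab <-]; exact: cP.
Qed.

(* [Theta] is the angle under which the unit disk is seen from [a]; the zero has
   multiplicity k+1. Up to powers of [lam], the level curve near [a] lies
   between S and T, and |f'| between c and C. *)
Definition arc_estimate (f : R[i] -> R[i]) (a : R[i]) (k : nat) (Theta : R) :=
  forall lam delta : R, 1 < lam -> 0 < delta ->
  exists d e0 : R, [/\ 0 < d, d <= delta, 0 < e0 &
    forall e, 0 < e < e0 -> exists (S T : set R[i]) (c C : R),
    [/\ caratheodory_measurable (@hausdorff1 R) S,
        caratheodory_measurable (@hausdorff1 R) T, 0 <= c & 0 <= C] /\
    [/\ forall z, S z -> [/\ level_curve f e z, normc (z - a) < d & c <= normc (derive1 f z)],
        forall z, level_curve f e z -> normc (z - a) < d -> T z /\ normc (derive1 f z) <= C,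
        ((lam ^- k.+4 * (Theta * k.+1%:R * e))%:E <= c%:E * hausdorff1 S)%E &
        (C%:E * hausdorff1 T <= (lam ^+ k.+4 * (Theta * k.+1%:R * e))%:E)%E]].

Variables (f g : R[i] -> R[i]) (a u : R[i]) (k : nat) (Theta : R).
Hypothesis dg : \forall z \near a, derivable g z 1.
Hypothesis ga : g a != 0.
Hypothesis fE : \forall z \near a, f z = (z - a) ^+ k.+1 * g z.
Hypothesis u1 : normc u = 1.
Hypothesis Theta_gt0 : 0 < Theta.
Hypothesis Theta_le2pi : Theta <= pi *+ 2.
Hypothesis disk_angle : forall w, unit_disk (a + w) -> w != 0 ->
  exists2 th, th \in `[0, Theta] & w = (normc w)%:C * (u * cis th).
Hypothesis angle_disk : forall tau : R, 0 < tau -> exists2 d : R, 0 < d &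
  forall th t, th \in `[tau, Theta - tau] -> 0 < t < d ->
    unit_disk (a + t%:C * (u * cis th)).

Let M := normc (g a).

Let M_gt0 : 0 < M. Proof. by rewrite normc_gt0. Qed.

(** [u] is the direction of angle 0. The curve [gam] meets each ray in a level point; the full arc
    over [0, Theta] contains the level curve, and the arc shortened by [tau] at both ends is
    contained in it. *)
Lemma level_arc : arc_estimate f a k Theta.
Proof.
move=> lam delta lam1 delta0.
have lam0 : 0 < lam := lt_trans ltr01 lam1.
have li1 : lam^-1 < 1 by rewrite invf_lt1.
have li0 : 0 < lam^-1 by rewrite invr_gt0.
have [d [G [d0 dd H P]]] := local_form dg ga fE lam1 delta0.
have TL : Theta * lam^-1 < pi *+ 2.
  by apply: lt_le_trans Theta_le2pi; rewrite gtr_pMr.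
have [sig [d1 [sig0 d10 C1 C2]]] := normc_cisB_ge lam1 TL.
(* The shortened arc has angle Theta / lam, strictly less than 2 pi. *)
pose tau := Theta * (1 - lam^-1) / 2.
have tau0 : 0 < tau by rewrite divr_gt0// mulr_gt0// subr_gt0.
have tauE : Theta - tau - tau = Theta * lam^-1 by rewrite /tau; field; rewrite gt_eqF.
have TL0 : 0 < Theta * lam^-1 by rewrite mulr_gt0.
have [d2 d20 D2] := angle_disk tau0.
(* The bound e < M m^(k+1) amounts to lam * rho < min d d2. *)
pose m := Num.min d d2 / lam.
have m0 : 0 < m by rewrite divr_gt0// lt_min d0.
exists d, (M * m ^+ k.+1); split => //; first by rewrite mulr_gt0// exprn_gt0.
move=> e /andP[e0 em].
pose rho := nroot k.+1 (e / M).
have rho0 : 0 < rho by rewrite nroot_gt0// divr_gt0.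
have rhoK : M * rho ^+ k.+1 = e.
  by rewrite nrootK// ?divr_ge0 ?ltW// mulrC divfK// gt_eqF.
have rhom : lam * rho < Num.min d d2.
  rewrite mulrC -ltr_pdivlMr// -/m -(@ltr_pXn2r _ k.+1) ?nnegrE ?ltW//.
  by rewrite -(ltr_pM2l M_gt0) rhoK.
have /andP[rhod rhod2] : (lam * rho < d) && (lam * rho < d2) by rewrite -lt_min.
have [E EE] : exists E : R -> R[i], forall th, E th = u * cis th by exists (fun th => u * cis th).
have nE th : normc (E th) = 1 by rewrite EE normcM u1 normc_cis mulr1.
have ntE t th : 0 <= t -> normc (t%:C * E th) = t.
  by move=> t0; rewrite normcM nE mulr1 normcR ger0_norm.
have nsE t th : normc (t%:C * E th) = `|t| by rewrite normcM nE mulr1 normcR.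
have EB s t : normc (E s - E t) = normc (cis s - cis t).
  by rewrite !EE -mulrBr normcM u1 mul1r.
have Gpos w : normc w < d -> 0 < G w by move=> /H[_ + _ _ _]; exact: lt_le_trans.
(* Along a ray t * G grows continuously from 0 to at least rho, since G >= 1/lam at t = lam * rho;
   the intermediate value theorem provides a level point. *)
have sol th : exists t, 0 < t <= lam * rho /\ t * G (t%:C * E th) = rho.
  pose psi t := normc ((G (t%:C * E th))%:C * (t%:C * E th)).
  have psiE t : `|t| < d -> psi t = `|t| * G (t%:C * E th).
    move=> td; have g0 : 0 < G (t%:C * E th) by apply: Gpos; rewrite nsE.
    by rewrite /psi normcM nsE normcR (gtr0_norm g0) [RHS]mulrC.
  have lr0 : 0 <= lam * rho by rewrite mulr_ge0 ?ltW.
  have lrN : `|lam * rho| < d by rewrite ger0_norm.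
  have [| |t tI tE] := @IVT R psi 0 (lam * rho) rho lr0.
  - apply: continuous_in_subspaceT => t; rewrite inE/= in_itv/= => /andP[t0 tl].
    apply: (@lipschitz_at_continuous _ _ _ lam (d - t)).
      by rewrite subr_gt0 (le_lt_trans tl).
    move=> s st.
    have sd : `|s| < d.
      have := ler_normD (s - t) t; rewrite subrK (ger0_norm t0); lra.
    have td : `|t| < d by rewrite ger0_norm// (le_lt_trans tl).
    have := P (s%:C * E th) (t%:C * E th); rewrite !nsE => /(_ sd td)[_].
    rewrite -mulrBl -rmorphB nsE; apply: le_trans.
    rewrite /psi; set x := _ * _; set y := _ * _.
    have := le_normcB x y; have := le_normcB y x; rewrite (normc_distC y x) ler_norml; lra.
  - rewrite !psiE ?normr0// mul0r (ger0_norm lr0).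
    have : rho <= lam * rho * G ((lam * rho)%:C * E th).
      have [|_ h _ _ _] := H ((lam * rho)%:C * E th); first by rewrite ntE.
      by rewrite mulrAC ler_peMl ?(ltW rho0)// -ler_pdivrMl// mulr1.
    by move=> h; rewrite ge_min le_max h orbT (ltW rho0).
  move: tI; rewrite in_itv/= => /andP[t0 tl]; exists t.
  have td : `|t| < d by rewrite ger0_norm// (le_lt_trans tl).
  have tE' : t * G (t%:C * E th) = rho by rewrite -tE psiE// ger0_norm.
  rewrite tl lt_def t0 !andbT; split => //.
  by apply/eqP => tz; move: tE' rho0; rewrite tz mul0r => <-; rewrite ltxx.
have /choice[t tP] := sol.
have t0 th : 0 < t th by have [/andP[]] := tP th.
have tl th : t th <= lam * rho by have [/andP[]] := tP th.
have tG th : t th * G ((t th)%:C * E th) = rho by have [] := tP th.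
pose w th := (t th)%:C * E th.
have nw th : normc (w th) = t th by rewrite ntE// ltW.
have wd th : normc (w th) < d by rewrite nw (le_lt_trans (tl th)).
have PsiE th : (G (w th))%:C * w th = rho%:C * E th.
  by rewrite /w mulrA -rmorphM -/(w th) [G _ * _]mulrC tG.
have Psid s s' : normc ((G (w s))%:C * w s - (G (w s'))%:C * w s') = rho * normc (cis s - cis s').
  by rewrite !PsiE -mulrBr normcM EB normcR gtr0_norm.
pose gam th := a + w th.
have gamB s s' : gam s - gam s' = w s - w s' by rewrite /gam opprD addrACA subrr add0r.
have gam_up s s' : normc (gam s - gam s') <= lam * rho * `|s - s'|.
  rewrite gamB; have [] := P _ _ (wd s) (wd s'); rewrite Psid ler_pdivrMl// mulrA => + _.
  move/le_trans; apply; rewrite ler_wpM2l ?normc_cisB_le// mulr_ge0// ltW//.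
have gam_lo s s' : lam^-1 * rho * normc (cis s - cis s') <= normc (gam s - gam s').
  rewrite gamB; have [_] := P _ _ (wd s) (wd s'); rewrite Psid -mulrA.
  by rewrite ler_pdivrMl.
have ga_ th : gam th - a = w th by rewrite /gam addrC addKr.
have fgam th : normc (f (gam th)) = e.
  by have [-> _ _ _ _] := H _ (wd th); rewrite nw tG.
have kM0 : 0 < k.+1%:R * M by rewrite mulr_gt0.
have lvl_w x : normc x < d -> normc (f (a + x)) = e -> normc x * G x = rho.
  move=> xd; have [-> _ _ _ _] := H _ xd; rewrite -rhoK => /(mulfI (lt0r_neq0 M_gt0)).
  move/eqP; rewrite eqrXn2 ?(ltW rho0)//; first by move/eqP.
  by rewrite mulr_ge0 ?normc_ge0// ltW// Gpos.
have T0 : 0 <= Theta by exact: ltW.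
have tt : tau <= Theta - tau by rewrite -subr_ge0 tauE ltW.
pose S : set R[i] := [set gam th | th in `[tau, Theta - tau]].
pose T : set R[i] := [set gam th | th in `[0, Theta]].
have c0 : 0 <= lam^-1 * (k.+1%:R * M * (rho / lam) ^+ k).
  by apply: ltW; rewrite mulr_gt0// mulr_gt0// exprn_gt0// divr_gt0.
have C0 : 0 <= lam * (k.+1%:R * M * (lam * rho) ^+ k).
  by apply: ltW; rewrite mulr_gt0// mulr_gt0// exprn_gt0// mulr_gt0.
exists S, T.
exists (lam^-1 * (k.+1%:R * M * (rho / lam) ^+ k)), (lam * (k.+1%:R * M * (lam * rho) ^+ k)).
split; split.
- exact: lipschitz_curve_caratheodory gam_up.
- exact: lipschitz_curve_caratheodory gam_up.
- by [].
- by [].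
- move=> _ [th thI <-]; split.
  + split; last exact: fgam.
    by rewrite /gam /w EE; apply: D2 => //; rewrite t0 (le_lt_trans (tl th)).
  + by rewrite ga_.
  + have [_ _ GU B _] := H _ (wd th); apply: le_trans B.
    rewrite ler_wpM2l ?(ltW li0)// ler_wpM2l ?(ltW kM0)// lerXn2r ?nnegrE ?normc_ge0//.
      by rewrite divr_ge0 ?ltW.
    by rewrite nw ler_pdivrMr// -{1}(tG th) ler_wpM2l// ltW.
- move=> z [zD fz] zd; have xE : z = a + (z - a) by rewrite subrKC.
  set x := z - a in zd xE; have fx : normc (f (a + x)) = e by rewrite -xE.
  have xr := lvl_w _ zd fx.
  have x0 : x != 0.
    by apply/eqP => xz; move: xr rho0; rewrite xz normc0 mul0r => <-; rewrite ltxx.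
  split.
    have [|th thI xth] := disk_angle _ x0; first by rewrite -xE.
    exists th => //; rewrite xE /gam; congr (_ + _).
    (* [x] and the point of [gam] on the same ray have the same image under w |-> G(w) w, which the
       lower isometry bound makes injective. *)
    have PsiX : (G x)%:C * x = rho%:C * E th.
      by rewrite {2}xth -EE mulrA -rmorphM/= [G x * _]mulrC xr.
    have [+ _] := P _ _ (wd th) zd; rewrite PsiE PsiX subrr normc0.
    rewrite pmulr_rle0// => h; apply/eqP; rewrite -subr_eq0 -normc_eq0.
    by rewrite eq_le h normc_ge0.
  rewrite xE; have [_ GL _ _ B] := H _ zd; apply: le_trans B _.
  rewrite ler_wpM2l ?(ltW lam0)// ler_wpM2l ?(ltW kM0)// lerXn2r ?nnegrE ?normc_ge0//.
    by rewrite mulr_ge0 ?ltW.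
  by rewrite -xr mulrCA ler_peMr ?normc_ge0// -ler_pdivrMl// mulr1.
- have := @hausdorff1_curve_ge _ gam tau (Theta - tau) (lam^-2 * rho) sig (lam^-1 * rho * d1).
  have sI s s' : s \in `[tau, Theta - tau] -> s' \in `[tau, Theta - tau] -> `|s - s'| <= Theta * lam^-1.
    rewrite !in_itv/= ler_norml => ? ?; lra.
  (* The k + 4 powers of [lam]: one for f', k for |w|^k, two for the speed of the curve (isometry
     and chord), one for the shortened angle. *)
  move=> HH; apply: (@le_trans _ _
    ((lam^-1 * (k.+1%:R * M * (rho / lam) ^+ k))%:E * (lam^-2 * rho * (Theta - tau - tau))%:E)%E).
    rewrite tauE -EFinM lee_fin -rhoK !exprS exprMn exprVn le_eqVlt; apply/orP; left.
    by apply/eqP; field; rewrite expf_neq0 ?gt_eqF.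
  apply: lee_wpmul2l; first by rewrite lee_fin.
  apply: HH.
  + by rewrite mulr_gt0// invr_gt0 exprn_gt0.
  + by rewrite !mulr_gt0.
  + move=> s s' sI1 sI2 ss; apply: le_trans (gam_lo s s').
    rewrite (_ : lam^-2 * rho * `|s - s'| = lam^-1 * rho * (lam^-1 * `|s - s'|)); last first.
      by field; rewrite gt_eqF.
    by rewrite ler_wpM2l ?C1// mulr_ge0// ltW.
  + move=> s s' sI1 sI2 ss; apply: le_trans (gam_lo s s').
    by rewrite ler_wpM2l ?C2 ?ss ?sI// mulr_ge0// ltW.
- have HH := @hausdorff1_curve_le _ gam 0 Theta (lam * rho) T0.
  apply: (@le_trans _ _
    ((lam * (k.+1%:R * M * (lam * rho) ^+ k))%:E * (lam * rho * (Theta - 0))%:E)%E).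
    apply: lee_wpmul2l; first by rewrite lee_fin.
    by apply: HH; [rewrite mulr_ge0// ltW|move=> *; exact: gam_up].
  rewrite -EFinM lee_fin -rhoK subr0.
  (* Only k + 2 powers occur here; the exponent is raised to match the lower bound. *)
  rewrite (_ : _ * (lam * rho * Theta) = lam ^+ k.+2 * (Theta * k.+1%:R * (M * rho ^+ k.+1))).
    rewrite ler_wpM2r//; first by rewrite !mulr_ge0// ?ltW// exprn_gt0.
    by apply: ler_weXn2l; [exact: ltW|rewrite !ltnS; exact: leqW].
  by rewrite exprMn !exprS; ring.
Qed.

End Arc.

(** * Moments of discs *)

Section DiscArea.
Context {R : realType}.
Local Notation mu := (@lebesgue_measure R).
Local Notation plane := (measurableTypeR R * measurableTypeR R)%type.
Implicit Types (a : R * R) (t b c x : R).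

(** The integrand is the length of the vertical chord at x of a disc of radius t. The substitution x
    = c + t sin turns it into 2 t^2 cos^2. *)
Lemma integral_semicircle c t : 0 < t ->
  (\int[mu]_(x in `[(c - t)%R, (c + t)%R]) (2 * Num.sqrt (t ^+ 2 - (x - c) ^+ 2))%:E = (pi * t ^+ 2)%:E)%E.
Proof.
move=> t0; pose F x := c + t * sin x.
pose G x := 2 * Num.sqrt (t ^+ 2 - (x - c) ^+ 2).
have pi2 : - (pi / 2) < pi / 2 :> R by rewrite gtrN// divr_gt0// pi_gt0.
have dF x : is_derive x 1 F (t * cos x).
  by apply: is_derive_eq; rewrite add0r mul1r.
have dFE : F^`()%classic = (fun x => t * cos x).
  by apply/funext => x; rewrite derive1E derive_val.
have cF : continuous F by move=> x; apply/differentiable_continuous/derivable1_diffP.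
have cdF : continuous (fun x : R => t * cos x).
  by move=> x; apply: cvgM; [exact: cvg_cst|exact: continuous_cos].
have FL : F (- (pi / 2)) = c - t by rewrite /F sinN sin_pihalf mulrN1.
have FR : F (pi / 2) = c + t by rewrite /F sin_pihalf mulr1.
have cG : continuous G.
  move=> x; apply: cvgM; first exact: cvg_cst.
  apply: (@continuous_comp _ _ _ (fun x => t ^+ 2 - (x - c) ^+ 2) Num.sqrt); last exact: sqrt_continuous.
  apply: cvgB; first exact: cvg_cst.
  by apply: (@cvgM _ _ _ _ (fun x => x - c) (fun x => x - c));
    (apply: cvgB; [exact: cvg_id|exact: cvg_cst]).
have := @integration_by_substitution_increasing R F G (- (pi / 2)) (pi / 2) (ltW pi2).
rewrite FL FR dFE => -> //; first last.
- exact: continuous_subspaceT.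
- split; first by move=> x _; have [] := dF x.
  + exact/cvg_at_right_filter/cF.
  + exact/cvg_at_left_filter/cF.
- by apply/cvg_ex; eexists; exact/cvg_at_left_filter/cdF.
- by apply/cvg_ex; eexists; exact/cvg_at_right_filter/cdF.
- by move=> x y xI yI xy; rewrite /F ltrD2l ltr_pM2l// ltr_sin.
pose K x := t ^+ 2 * (x + sin x * cos x).
have dK x : is_derive x 1 K (t ^+ 2 * (1 + (cos x * cos x - sin x * sin x))).
  by apply: is_derive_eq; rewrite !/(_ *: _) /=; ring.
have dKE : K^`()%classic = (fun x => t ^+ 2 * (1 + (cos x * cos x - sin x * sin x))).
  by apply/funext => x; rewrite derive1E derive_val.
have cK : continuous K by move=> x; apply/differentiable_continuous/derivable1_diffP; case: (dK x).
transitivity (\int[mu]_(x in `[(- (pi / 2))%R, (pi / 2)%R])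
   (t ^+ 2 * (1 + (cos x * cos x - sin x * sin x)))%:E)%E.
  apply: eq_integral => x; rewrite inE/= in_itv/= => xI; congr (_%:E).
  have cx : 0 <= cos x by exact: cos_ge0_pihalf.
  change (G (F x) * (t * cos x) = t ^+ 2 * (1 + (cos x * cos x - sin x * sin x))).
  rewrite /G /F (_ : c + t * sin x - c = t * sin x); last by ring.
  rewrite (_ : t ^+ 2 - (t * sin x) ^+ 2 = (t * cos x) ^+ 2); last first.
    by rewrite exprMn exprMn cos2sin2; ring.
  rewrite sqrtr_sqr ger0_norm ?mulr_ge0 ?(ltW t0)//.
  have -> : sin x * sin x = 1 - cos x ^+ 2 by rewrite -expr2 sin2cos2.
  ring.
rewrite (@continuous_FTC2 R _ K)//.
- rewrite -EFinB; congr (_%:E); rewrite /K cosN cos_pihalf !mulr0 !addr0; by field.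
- apply: continuous_subspaceT => x; apply: cvgM; first exact: cvg_cst.
  apply: cvgD; first exact: cvg_cst.
  by apply: cvgB; apply: cvgM; [exact: continuous_cos|exact: continuous_cos|
    exact: continuous_sin|exact: continuous_sin].
- split; first by move=> x _; have [] := dK x.
  + exact/cvg_at_right_filter/cK.
  + exact/cvg_at_left_filter/cK.
- by move=> x _; rewrite dKE.
Qed.

Definition sqdist a (w : plane) : R := (w.1 - a.1) ^+ 2 + (w.2 - a.2) ^+ 2.

Lemma sqdist_ge0 a w : 0 <= sqdist a w.
Proof. by rewrite addr_ge0// sqr_ge0. Qed.

Lemma measurable_sqdist a : measurable_fun [set: plane] (sqdist a).
Proof.
apply: measurable_funD; apply: measurable_funX; apply: measurable_funB;
  by [exact: measurable_fst|exact: measurable_snd|exact: measurable_cst].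
Qed.

(** [b] is the squared radius, so that the area is linear in [b]. *)
Definition disc a b : set plane := [set w | sqdist a w < b].

Lemma measurable_disc a b : measurable (disc a b).
Proof.
rewrite (_ : disc a b = [set: plane] `&` sqdist a @^-1` `]-oo, b[).
  exact: measurable_sqdist.
by apply/seteqP; split => w; rewrite /disc/= in_itv/=; [split|case].
Qed.

Lemma area_disc a b : 0 <= b -> area R (disc a b) = (pi * b)%:E.
Proof.
(* [Num.sqrt] is 0 at negative arguments, so the section formula remains valid, with an empty
   interval, beyond the disc. *)
move=> b0; pose s x := Num.sqrt (b - (x - a.1) ^+ 2).
have sec x : xsection (disc a b) x = `](a.2 - s x), (a.2 + s x)[%classic.
  apply/seteqP; split => y; rewrite xsectionE/= /disc /sqdist/= in_itv/= => H.
    have : `|y - a.2| < s x.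
      rewrite -sqrtr_sqr ltr_sqrt; first lra.
      have := sqr_ge0 (y - a.2); lra.
    by rewrite ltr_norml; lra.
  have ys : `|y - a.2| < s x by rewrite ltr_norml; lra.
  have s0 : 0 < s x := le_lt_trans (normr_ge0 _) ys.
  have p0 : 0 < b - (x - a.1) ^+ 2 by rewrite -sqrtr_gt0.
  move: ys; rewrite -sqrtr_sqr ltr_sqrt//; lra.
transitivity (\int[mu]_x (2 * s x)%:E)%E.
  apply: eq_integral => x _; rewrite /= sec lebesgue_measure_itv/= lte_fin.
  case: ltP => H; first by rewrite -EFinD; congr (_%:E); ring.
  have : s x <= 0 by lra.
  rewrite le_eqVlt => /orP[/eqP ->|]; first by rewrite mulr0.
  by rewrite ltNge sqrtr_ge0.
have [bz|b1] := eqVneq b 0.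
  rewrite bz mulr0 integral0_eq// => x _; rewrite /s bz ler0_sqrtr ?mulr0//.
  by rewrite sub0r oppr_le0 sqr_ge0.
pose t := Num.sqrt b.
have t0 : 0 < t by rewrite sqrtr_gt0 lt_def b1.
have tb : t ^+ 2 = b by rewrite sqr_sqrtr.
rewrite -tb -(integral_semicircle a.1 t0) [RHS]integral_mkcond.
apply: eq_integral => x _; rewrite patchE; case: ifPn; first by rewrite /s -tb.
rewrite notin_setE/= in_itv/= => xI; rewrite /s ler0_sqrtr ?mulr0//.
rewrite -tb subr_le0 -[leRHS]real_normK ?num_real// lerXn2r ?nnegrE ?(ltW t0)//.
by rewrite leNgt; apply/negP; rewrite ltr_norml => ?; apply: xI; lra.
Qed.

End DiscArea.

(** The integral of a nonnegative function is a supremum over simple functions below it, hence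
    monotone for arbitrary functions. *)
Lemma le_integralT d (T : measurableType d) (R : realType) (mu : {measure set T -> \bar R})
  (f g : T -> \bar R) : (forall x, 0 <= f x)%E -> (forall x, f x <= g x)%E ->
  (\int[mu]_x f x <= \int[mu]_x g x)%E.
Proof.
move=> f0 fg.
rewrite !ge0_integralTE//; last by move=> x; exact: le_trans (f0 x) (fg x).
apply: ereal_sup_le => _ [h hf <-]; exists h => // x; exact: le_trans (hf x) (fg x).
Qed.

Section MomentIntegral.
Context {R : realType}.
Local Notation plane := (measurableTypeR R * measurableTypeR R)%type.
Implicit Types (a : R * R) (b : R) (j n : nat).
Local Open Scope ereal_scope.

(** Up to a constant, the integral of the leading part of |f'|^2 near a zero of multiplicity j +
    1. *)
Definition moment a j (X : set plane) := \int[area R]_(w in X) (sqdist a w ^+ j)%:E.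

Lemma measurable_moment a j (X : set plane) :
  measurable_fun X (fun w => (sqdist a w ^+ j)%:E).
Proof.
apply/measurable_EFinP; apply: measurable_funX.
exact: measurable_funS (measurable_sqdist a).
Qed.

Lemma moment_ge0 a j X : 0 <= moment a j X.
Proof. by apply: integral_ge0 => w _; rewrite lee_fin exprn_ge0// sqdist_ge0. Qed.

Lemma momentU a j X Y : measurable X -> measurable Y -> X `&` Y = set0 ->
  moment a j (X `|` Y) = moment a j X + moment a j Y.
Proof.
move=> mX mY XY; apply: ge0_integral_setU => //.
- exact: measurable_moment.
- by move=> w _; rewrite lee_fin exprn_ge0// sqdist_ge0.
- exact/disj_set2P.
Qed.

Lemma le_moment a j X Y : measurable X -> measurable Y -> X `<=` Y ->
  moment a j X <= moment a j Y.
Proof.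
move=> mX mY XY; apply: ge0_subset_integral => //; first exact: measurable_moment.
by move=> w _; rewrite lee_fin exprn_ge0// sqdist_ge0.
Qed.

Lemma moment_le_area a j X b : measurable X -> (0 <= b)%R ->
  X `<=` [set w | sqdist a w <= b]%R -> moment a j X <= (b ^+ j)%:E * area R X.
Proof.
move=> mX b0 Xb; rewrite -integral_cst//; apply: ge0_le_integral => //.
- by move=> w _; rewrite lee_fin exprn_ge0// sqdist_ge0.
- exact: measurable_moment.
- by move=> w /Xb/= wb; rewrite lee_fin lerXn2r// nnegrE ?sqdist_ge0.
Qed.

Lemma moment_ge_area a j X b : measurable X -> (0 <= b)%R ->
  X `<=` [set w | b <= sqdist a w]%R -> (b ^+ j)%:E * area R X <= moment a j X.
Proof.
move=> mX b0 Xb; rewrite -integral_cst//; apply: ge0_le_integral => //.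
- by move=> w _; rewrite lee_fin exprn_ge0.
- exact: measurable_moment.
- by move=> w /Xb/= wb; rewrite lee_fin lerXn2r// nnegrE ?sqdist_ge0.
Qed.

(* Slicing the disc into n annuli of equal area, both the moment and its value
   [pi * b ^+ j.+1 / j.+1] telescope, up to an error of order 1/n. *)
Lemma moment_disc a j b : (0 <= b)%R ->
  moment a j (disc a b) = (pi * b ^+ j.+1 / j.+1%:R)%:E.
Proof.
move=> b0.
have mfin c : (0 <= c)%R -> moment a j (disc a c) \is a fin_num.
  move=> c0; rewrite ge0_fin_numE ?moment_ge0//.
  apply: le_lt_trans (moment_le_area (b := c) _ _ _ _) _ => //.
  - exact: measurable_disc.
  - by move=> w; rewrite /disc/= => /ltW.
  - by rewrite area_disc// -EFinM ltry.
pose J c := fine (moment a j (disc a c)).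
have JE c : (0 <= c)%R -> moment a j (disc a c) = (J c)%:E by move=> c0; rewrite fineK// mfin.
pose V c := (pi * c ^+ j.+1 / j.+1%:R : R)%R.
have J0 : J 0%R = 0%R.
  have D0 : disc a 0%R = set0.
    by apply/seteqP; split => w //; rewrite /disc/= ltNge sqdist_ge0.
  by rewrite /J D0 /moment integral_set0.
(* On the annulus the integrand lies between c^j and c'^j, and the area is pi (c' - c). *)
have Jstep c c' : (0 <= c)%R -> (c <= c')%R ->
    (c ^+ j * (pi * (c' - c)) <= J c' - J c <= c' ^+ j * (pi * (c' - c)))%R.
  move=> c0 cc'; have c'0 := le_trans c0 cc'.
  have mD : measurable (disc a c' `\` disc a c) by apply: measurableD; exact: measurable_disc.
  have cD : disc a c `<=` disc a c' by move=> w; rewrite /disc/= => /lt_le_trans; exact.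
  have DE : disc a c' = disc a c `|` (disc a c' `\` disc a c) by rewrite setDUK.
  have I0 : disc a c `&` (disc a c' `\` disc a c) = set0 by rewrite setDIK.
  have mc := measurable_disc a c.
  have EJ : (J c')%:E = (J c)%:E + moment a j (disc a c' `\` disc a c).
    by rewrite -!JE// {1}DE momentU.
  have EA : (pi * c')%:E = (pi * c)%:E + area R (disc a c' `\` disc a c).
    by rewrite -(area_disc a c'0) -(area_disc a c0) {1}DE measureU.
  have EA' : area R (disc a c' `\` disc a c) = (pi * (c' - c))%:E.
    move: EA; case: (area R _) => [x|//|//] [E]; congr (_%:E); lra.
  have B1 := @moment_le_area a j _ c' mD c'0.
  have B2 := @moment_ge_area a j _ c mD c0.
  move: EJ B1 B2; rewrite EA'; case: (moment a j _) => [x|//|//] [E] B1 B2.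
  have {}B1 : (x <= c' ^+ j * (pi * (c' - c)))%R.
    by rewrite -lee_fin EFinM; apply: B1 => w []; rewrite /disc/= => /ltW.
  have {}B2 : (c ^+ j * (pi * (c' - c)) <= x)%R.
    by rewrite -lee_fin EFinM; apply: B2 => w [_]; rewrite /disc/= => /negP; rewrite -leNgt.
  by rewrite E; apply/andP; split; lra.
(* The increment of V is pi (c' - c) times the mean of the j + 1 products c'^(j-i) c^i, each between
   c^j and c'^j. *)
have Vstep c c' : (0 <= c)%R -> (c <= c')%R ->
    (c ^+ j * (pi * (c' - c)) <= V c' - V c <= c' ^+ j * (pi * (c' - c)))%R.
  move=> c0 cc'; have c'0 := le_trans c0 cc'.
  have -> : (V c' - V c = (\sum_(i < j.+1) c' ^+ (j - i) * c ^+ i) / j.+1%:R * (pi * (c' - c)))%R.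
    rewrite /V -mulrBl -mulrBr subrXX /=.
    by move: (j.+1%:R^-1 : R)%R => x; ring.
  have p0 : (0 <= pi * (c' - c))%R by rewrite mulr_ge0 ?pi_ge0// subr_ge0.
  have jn : (j.+1%:R = \sum_(i < j.+1) 1 :> R)%R by rewrite sumr_const card_ord.
  have ij (i : 'I_j.+1) : (j - i + i = j)%N by rewrite subnK// -ltnS.
  apply/andP; split; apply: ler_wpM2r => //.
    rewrite ler_pdivlMr// jn mulr_sumr; apply: ler_sum => i _.
    have -> : (c ^+ j = c ^+ (j - i) * c ^+ i)%R by rewrite -exprD ij.
    by rewrite mulr1 ler_wpM2r ?exprn_ge0// lerXn2r.
  rewrite ler_pdivrMr// jn mulr_sumr; apply: ler_sum => i _.
  have -> : (c' ^+ j = c' ^+ (j - i) * c' ^+ i)%R by rewrite -exprD ij.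
  by rewrite mulr1 ler_wpM2l ?exprn_ge0// lerXn2r.
rewrite JE//; congr (_%:E); rewrite -/(V b).
(* The increments of J and V lie in a common interval of length (c'^j - c^j) pi h; these lengths
   telescope. *)
have bound n i : (i <= n.+1)%N ->
    (`|J (i%:R * (b / n.+1%:R)) - V (i%:R * (b / n.+1%:R))| <=
     (i%:R * (b / n.+1%:R)) ^+ j * (pi * (b / n.+1%:R)))%R.
  have h0 : (0 <= b / n.+1%:R)%R by rewrite divr_ge0.
  move: (b / n.+1%:R)%R h0 => h h0 _.
  elim: i => [|i IH]; first by rewrite mul0r J0 /V expr0n/= mulr0 mul0r subrr normr0
    mulr_ge0 ?exprn_ge0// mulr_ge0 ?pi_ge0.
  have c0 : (0 <= i%:R * h)%R by rewrite mulr_ge0.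
  have hS : (i.+1%:R * h = i%:R * h + h)%R by rewrite -natr1 mulrDl mul1r.
  have cc : (i%:R * h <= i.+1%:R * h)%R by rewrite hS lerDl.
  have := Jstep _ _ c0 cc; have := Vstep _ _ c0 cc.
  rewrite (_ : (i.+1%:R * h - i%:R * h = h)%R); last by rewrite hS addrAC subrr add0r.
  move: IH; rewrite !ler_norml; lra.
apply/eqP; rewrite -subr_eq0 -normr_le0; apply/ler_addgt0Pr => e e0; rewrite add0r.
pose K := (b ^+ j * (pi * b))%R.
have K0 : (0 <= K)%R by rewrite mulr_ge0 ?exprn_ge0// mulr_ge0 ?pi_ge0.
pose n := Num.bound (K / e).
have nb : (n.+1%:R * (b / n.+1%:R) = b)%R by rewrite mulrC divfK.
have := bound n n.+1 (leqnn _); rewrite nb => /le_trans; apply.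
rewrite (_ : (_ * _ = K / n.+1%:R)%R); last by rewrite /K !mulrA.
rewrite ler_pdivrMr// mulrC -ler_pdivrMr//.
apply: le_trans (ltW (archi_boundP _)) _; first by rewrite divr_ge0// ltW.
by rewrite ler_nat.
Qed.

End MomentIntegral.

Section Reflection.
Context {R : realType}.
Local Notation mu := (@lebesgue_measure R).
Local Notation plane := (measurableTypeR R * measurableTypeR R)%type.
Local Open Scope ereal_scope.

Definition reflect1 (c : R) (x : measurableTypeR R) : measurableTypeR R := (2 * c - x)%R.

Lemma measurable_reflect1 c : measurable_fun [set: measurableTypeR R] (reflect1 c).
Proof. by apply: measurable_funB; [exact: measurable_cst|exact: measurable_id]. Qed.

Lemma lebesgue_reflect1 c (A : set (measurableTypeR R)) : measurable A ->
  mu (reflect1 c @^-1` A) = mu A.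
Proof.
move=> mA; apply/esym.
apply: (@lebesgue_measure_unique R (pushforward mu (reflect1 c))) => //.
  exact: measurable_reflect1.
move=> mphi _ [[x y]] _ <-; change (mu `]x, y] = mu (reflect1 c @^-1` `]x, y])).
(* Reflection moves the closed end of the interval to the other side, which does not change its
   measure. *)
rewrite (_ : reflect1 c @^-1` _ = `[(2 * c - y)%R, (2 * c - x)%R[%classic).
  rewrite !lebesgue_measure_itv/= !lte_fin ltrD2l ltrN2.
  by case: ifP => // _; rewrite -!EFinD; congr (_%:E); ring.
apply/seteqP; split => t; rewrite /reflect1/= !in_itv/=; lra.
Qed.

Definition reflect (a : R * R) (w : plane) : plane := (reflect1 a.1 w.1, reflect1 a.2 w.2).

Lemma sqdist_reflect a w : sqdist a (reflect a w) = sqdist a w.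
Proof. by rewrite /sqdist /reflect /reflect1/=; ring. Qed.

Lemma measurable_reflect a : measurable_fun [set: plane] (reflect a).
Proof.
apply: measurable_fun_pair.
  exact: measurableT_comp (measurable_reflect1 a.1) measurable_fst.
exact: measurableT_comp (measurable_reflect1 a.2) measurable_snd.
Qed.

Lemma area_setX (A B : set (measurableTypeR R)) : measurable A -> measurable B ->
  area R (A `*` B) = mu A * mu B.
Proof. exact: product_measure1E. Qed.

Lemma area_reflect a (X : set plane) : measurable X ->
  area R (reflect a @^-1` X) = area R X.
Proof.
move=> mX; apply/esym.
apply: (@product_measure_unique _ _ _ _ R mu mu (pushforward (area R) (reflect a))) => //.
  exact: measurable_reflect.
move=> mphi A B mA mB; change (area R (reflect a @^-1` (A `*` B)) = mu A * mu B).
rewrite (_ : reflect a @^-1` _ = (reflect1 a.1 @^-1` A) `*` (reflect1 a.2 @^-1` B))//.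
have mA' : measurable (reflect1 a.1 @^-1` A).
  by rewrite -[X in measurable X]setTI; exact: measurable_reflect1.
have mB' : measurable (reflect1 a.2 @^-1` B).
  by rewrite -[X in measurable X]setTI; exact: measurable_reflect1.
by rewrite area_setX// !lebesgue_reflect1.
Qed.

Lemma moment_reflect a j (X : set plane) : measurable X ->
  moment a j (reflect a @^-1` X) = moment a j X.
Proof.
move=> mX; rewrite /moment.
transitivity (\int[pushforward (area R) (reflect a)]_(w in X) (sqdist a w ^+ j)%:E).
  rewrite ge0_integral_pushforward//; last first.
  - by move=> w _; rewrite lee_fin exprn_ge0// sqdist_ge0.
  - exact: measurable_moment.
  - exact: measurable_reflect.
  by apply: eq_integral => w _ /=; rewrite sqdist_reflect.
apply: eq_measure_integral => [|mphi A mA _]; first exact: measurable_reflect.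
exact: area_reflect.
Qed.

Definition swap (w : plane) : plane := (w.2, w.1).

Lemma measurable_swap : measurable_fun [set: plane] swap.
Proof. by apply: measurable_fun_pair; [exact: measurable_snd|exact: measurable_fst]. Qed.

Lemma area_swap (X : set plane) : measurable X -> area R (swap @^-1` X) = area R X.
Proof.
move=> mX; apply/esym.
apply: (@product_measure_unique _ _ _ _ R mu mu (pushforward (area R) swap)) => //.
  exact: measurable_swap.
move=> mphi A B mA mB; change (area R (swap @^-1` (A `*` B)) = mu A * mu B).
rewrite (_ : swap @^-1` _ = B `*` A); last by apply/seteqP; split => w [].
by rewrite area_setX// muleC.
Qed.

Lemma area_le_sections (X : set plane) (c r L : R) : measurable X -> (0 <= r)%R -> (0 <= L)%R ->
  X `<=` [set w | `|w.1 - c| <= r]%R ->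
  (forall x, exists m : R, xsection X x `<=` `[(m - L)%R, (m + L)%R]) ->
  area R X <= (4 * r * L)%:E.
Proof.
move=> mX r0 L0 Xr XL.
apply: (@le_trans _ _ (\int[mu]_(x in `[(c - r)%R, (c + r)%R]) (2 * L)%:E)).
  rewrite [leRHS]integral_mkcond; apply: le_integralT => [x|x]; first exact: measure_ge0.
  rewrite patchE; case: ifPn => [_|]; last first.
    rewrite notin_setE/= in_itv/= => xr; rewrite /= (_ : xsection X x = set0) ?measure0//.
    apply/seteqP; split => y //; rewrite xsectionE/= => /Xr/=.
    by rewrite ler_norml => H; apply: xr; lra.
  have [m Xm] := XL x.
  apply: (@le_trans _ _ (mu `[(m - L)%R, (m + L)%R])).
    by apply: le_measure; rewrite ?inE//; exact: measurable_xsection.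
  rewrite lebesgue_measure_itv/= lte_fin; case: ifP => _; last by rewrite lee_fin mulr_ge0.
  by rewrite -EFinD lee_fin; lra.
rewrite integral_cst//= lebesgue_measure_itv/= lte_fin; case: ifP => _.
  by rewrite -EFinD -EFinM lee_fin; lra.
by rewrite mule0 lee_fin !mulr_ge0.
Qed.

(** For a unit vector [v]: the points within [s] of the line through [a] with normal [v], cut down
    to a square of half side [r]. *)
Definition strip (a v : R * R) (r s : R) : set plane :=
  [set w | [/\ `|w.1 - a.1| <= r, `|w.2 - a.2| <= r &
     `|v.1 * (w.1 - a.1) + v.2 * (w.2 - a.2)| <= s]%R].

Lemma measurable_strip a v r s : measurable (strip a v r s).
Proof.
have m1 : measurable_fun [set: plane] (fun w : plane => w.1 - a.1)%R.
  by apply: measurable_funB; [exact: measurable_fst|exact: measurable_cst].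
have m2 : measurable_fun [set: plane] (fun w : plane => w.2 - a.2)%R.
  by apply: measurable_funB; [exact: measurable_snd|exact: measurable_cst].
have m3 : measurable_fun [set: plane] (fun w : plane => v.1 * (w.1 - a.1) + v.2 * (w.2 - a.2))%R.
  by apply: measurable_funD; apply: measurable_funM => //; exact: measurable_cst.
have P (phi : plane -> R) (t : R) : measurable_fun [set: plane] phi ->
    measurable [set w | `|phi w| <= t]%R.
  move=> mphi; rewrite (_ : mkset _ = [set: plane] `&` phi @^-1` `[(- t)%R, t]).
    exact: mphi.
  by apply/seteqP; split => w /=; rewrite in_itv/= -ler_norml; [split|case].
rewrite (_ : strip a v r s = [set w | `|w.1 - a.1| <= r]%R `&` [set w | `|w.2 - a.2| <= r]%R `&`
  [set w | `|v.1 * (w.1 - a.1) + v.2 * (w.2 - a.2)| <= s]%R).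
  by apply: measurableI; [apply: measurableI|]; apply: P.
by apply/seteqP; split => w; [case|case => -[]].
Qed.

(** A vertical section of the slab has half length s / |v.2| <= 2 s. *)
Lemma area_strip_snd a v r s : (0 <= r)%R -> (0 <= s)%R -> (1 / 2 <= `|v.2|)%R ->
  area R (strip a v r s) <= (8 * r * s)%:E.
Proof.
move=> r0 s0 v2; rewrite (_ : 8 * r * s = 4 * r * (2 * s))%R; last by ring.
apply: area_le_sections (a.1) _ _ (measurable_strip _ _ _ _) r0 _ _ _.
- by rewrite mulr_ge0.
- by move=> w [].
move=> x; exists (a.2 - v.1 * (x - a.1) / v.2)%R => y; rewrite xsectionE/= => -[/= _ _ H].
have vn : v.2 != 0%R by rewrite -normr_gt0 (lt_le_trans _ v2)// divr_gt0.
rewrite in_itv/= -ler_distlC distrC.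
have -> : (y - (a.2 - v.1 * (x - a.1) / v.2) = (v.1 * (x - a.1) + v.2 * (y - a.2)) / v.2)%R.
  by field.
rewrite normrM normfV ler_pdivrMr ?normr_gt0//; apply: le_trans H _.
have : (2 * s * (1 / 2) <= 2 * s * `|v.2|)%R by rewrite ler_wpM2l// mulr_ge0.
by rewrite (_ : 2 * s * (1 / 2) = s)%R//; field.
Qed.

(** One coordinate of a unit vector is at least 1/2 in modulus; exchanging the coordinates reduces
    to the second one. *)
Lemma area_strip a v r s : (0 <= r)%R -> (0 <= s)%R -> (v.1 ^+ 2 + v.2 ^+ 2 = 1)%R ->
  area R (strip a v r s) <= (8 * r * s)%:E.
Proof.
move=> r0 s0 v1; have [v2|v2] := leP (1 / 2 : R)%R `|v.2|%R; first exact: area_strip_snd.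
rewrite -area_swap; last exact: measurable_strip.
rewrite (_ : swap @^-1` _ = strip (a.2, a.1) (v.2, v.1) r s); last first.
  by apply/seteqP; split => w [/= *]; split => //=; rewrite addrC.
apply: area_strip_snd => //=; rewrite leNgt; apply/negP => v3.
have : (`|v.1| ^+ 2 < (1 / 2) ^+ 2)%R by rewrite ltr_pXn2r// nnegrE// divr_ge0.
have : (`|v.2| ^+ 2 < (1 / 2) ^+ 2)%R by rewrite ltr_pXn2r// nnegrE// divr_ge0.
rewrite !real_normK ?num_real// expr2; lra.
Qed.

End Reflection.

Section DiscInUnitDisc.
Context {R : realType}.
Local Notation plane := (measurableTypeR R * measurableTypeR R)%type.

Definition unit_disc2 : set plane := disc (0, 0)%R 1.

Lemma moment_interior (a : R * R) j : (a.1 ^+ 2 + a.2 ^+ 2 < 1)%R ->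
  exists2 r0 : R, 0 < r0 & forall r, 0 < r < r0 ->
    moment a j (disc a (r ^+ 2) `&` unit_disc2) = (pi * (r ^+ 2) ^+ j.+1 / j.+1%:R)%:E.
Proof.
move=> a1; pose n := Num.sqrt (a.1 ^+ 2 + a.2 ^+ 2).
have n0 : 0 <= n := sqrtr_ge0 _.
have nE : n ^+ 2 = a.1 ^+ 2 + a.2 ^+ 2 by rewrite sqr_sqrtr// addr_ge0// sqr_ge0.
have n1 : n < 1 by rewrite -(@ltr_pXn2r _ 2) ?nnegrE// nE expr1n.
exists (1 - n); first by rewrite subr_gt0.
move=> r /andP[r0 rn]; rewrite setIidl; last first.
  move=> [x y]; rewrite /unit_disc2 /disc /sqdist/= !subr0 => H.
  have := @normc_ge0 _ ((x - a.1) +i* (y - a.2)) => N0.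
  have H' : normc ((x - a.1) +i* (y - a.2)) < r.
    by rewrite -(@ltr_pXn2r _ 2) ?nnegrE ?(ltW r0)// normc_sqr.
  have N1 : normc (a.1 +i* a.2) = n by [].
  have N2 : normc (x +i* y) < 1.
    have := le_normcD ((x - a.1) +i* (y - a.2)) (a.1 +i* a.2).
    by rewrite (_ : _ + _ = x +i* y); [lra|simpc; rewrite !subrK].
  by rewrite -(expr1n _ 2) -(normc_sqr (x +i* y)) ltr_pXn2r ?nnegrE ?normc_ge0.
by rewrite moment_disc// sqr_ge0.
Qed.

(* Reflection in the boundary point a maps the part of the disc that lies inside
   the unit disc outside of it; what these two parts miss is contained in a strip
   of width of order r^2 around the tangent at a. *)
Lemma moment_boundary (a : R * R) j (r : R) : (a.1 ^+ 2 + a.2 ^+ 2 = 1)%R -> 0 < r ->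
  exists x : R, [/\ moment a j (disc a (r ^+ 2) `&` unit_disc2) = x%:E,
    2 * x <= pi * (r ^+ 2) ^+ j.+1 / j.+1%:R &
    pi * (r ^+ 2) ^+ j.+1 / j.+1%:R <= 2 * x + 4 * r * (r ^+ 2) ^+ j.+1].
Proof.
move=> a1 r0; set b := r ^+ 2; set X := disc a b `&` unit_disc2.
have b0 : 0 < b by rewrite exprn_gt0.
have mX : measurable X by apply: measurableI; exact: measurable_disc.
pose Y : set plane := reflect a @^-1` X.
have mY : measurable Y by rewrite -[Y]setTI; exact: measurable_reflect.
have mD := measurable_disc a b.
have XD : X `<=` disc a b by move=> w [].
have YD : Y `<=` disc a b by move=> w []; rewrite /disc/= sqdist_reflect.
(* With w = a + v the reflected point is a - v, and |a + v|^2 + |a - v|^2 = 2 + 2 |v|^2 is not below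
   2. *)
have XY : X `&` Y = set0.
  apply/seteqP; split => // -[x y] [[_ H1] [_ H2]]; move: H1 H2.
  rewrite /unit_disc2 /disc /sqdist /reflect /reflect1/= !subr0 => H1 H2.
  have := sqr_ge0 (x - a.1); have := sqr_ge0 (y - a.2).
  move: H1 H2 a1; rewrite !expr2 => H1 H2 H3 H4 H5; nra.
have EY : moment a j Y = moment a j X by exact: moment_reflect.
have XYD : (moment a j X + moment a j X <= moment a j (disc a b))%E.
  rewrite -{2}EY -momentU//; apply: le_moment => //; first exact: measurableU.
  by move=> w [/XD|/YD].
(* If neither a + v nor a - v lies in the unit disc, then 2 |<a, v>| <= |v|^2 < b; the normal of the
   tangent is [a] itself. *)
pose S := strip a a r (b / 2).
pose Z := disc a b `\` (X `|` Y).
have mZ : measurable Z by apply: measurableD => //; exact: measurableU.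
have ZS : Z `<=` S.
  move=> [x y] [H nXY].
  have H1 : ~ unit_disc2 (x, y) by move=> ?; apply: nXY; left.
  have H2 : ~ unit_disc2 (reflect a (x, y)).
    by move=> ?; apply: nXY; right; split => //; rewrite /disc/= sqdist_reflect.
  move: H H1 H2; rewrite /unit_disc2 /disc /sqdist /reflect /reflect1/= !subr0.
  move=> H /negP; rewrite -leNgt => H1 /negP; rewrite -leNgt => H2.
  have s1 := sqr_ge0 (x - a.1); have s2 := sqr_ge0 (y - a.2).
  have K t : t ^+ 2 < b -> `|t| <= r.
    move=> tb; apply: ltW; rewrite -(@ltr_pXn2r _ 2) ?nnegrE ?(ltW r0)//.
    by rewrite real_normK ?num_real.
  split => /=.
  - by apply: K; lra.
  - by apply: K; lra.
  - rewrite ler_norml; move: H H1 H2 a1; rewrite !expr2; nra.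
have DE : disc a b = (X `|` Y) `|` Z by rewrite setDUK// => w [/XD|/YD].
have MD : moment a j (disc a b) = (pi * b ^+ j.+1 / j.+1%:R)%:E by rewrite moment_disc// ltW.
have MZ : (moment a j Z <= (4 * r * b ^+ j.+1)%:E)%E.
  apply: le_trans (moment_le_area (b := b) j mZ (ltW b0) _) _.
    by move=> w [+ _]; rewrite /disc/= => /ltW.
  have AZ : (area R Z <= (8 * r * (b / 2))%:E)%E.
    apply: le_trans (area_strip a (ltW r0) _ a1); last by rewrite divr_ge0// ltW.
    by apply: le_measure; rewrite ?inE//; exact: measurable_strip.
  apply: le_trans (lee_wpmul2l _ AZ) _; first by rewrite lee_fin exprn_ge0// ltW.
  rewrite -EFinM lee_fin exprS le_eqVlt; apply/orP; left; by apply/eqP; field.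
have DU : (moment a j (disc a b) <= moment a j X + moment a j X + (4 * r * b ^+ j.+1)%:E)%E.
  rewrite {1}DE momentU//; [|exact: measurableU|by rewrite setDIK].
  by rewrite momentU// EY; apply: leeD.
move: XYD DU; rewrite MD; move: (pi * b ^+ j.+1 / j.+1%:R) (4 * r * b ^+ j.+1) => V W.
case: (moment a j X) (moment_ge0 a j X) => [x|//|//] _ A B; exists x; split => //.
- by move: A; rewrite -EFinD lee_fin; lra.
- by move: B; rewrite -!EFinD lee_fin; lra.
Qed.

End DiscInUnitDisc.

(** * Sublevel sets near a zero *)

Section LevelArea.
Context {R : realType}.
Local Notation plane := (measurableTypeR R * measurableTypeR R)%type.
Definition pt (z : R[i]) : R * R := (Re z, Im z).

Definition cpx (w : plane) : R[i] := w.1 +i* w.2.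

(** The counterpart of [arc_estimate]. On a sublevel set |f'| is not nearly constant, so the bounds
    keep the factor |w|^(2k), and [c] and [C] multiply a moment. *)
Definition area_estimate (f : R[i] -> R[i]) (a : R[i]) (k : nat) (Theta : R) :=
  forall lam delta : R, 1 < lam -> 0 < delta ->
  exists d e0 : R, [/\ 0 < d, d <= delta, 0 < e0 &
    forall e, 0 < e < e0 -> exists (X Y : set plane) (c C : R),
    [/\ measurable X, measurable Y, 0 <= c & 0 <= C] /\
    [/\ forall w, X w -> [/\ sublevel_set f e (cpx w), normc (cpx w - a) < d &
          c * sqdist (pt a) w ^+ k <= normc (derive1 f (cpx w)) ^+ 2],
        forall w, sublevel_set f e (cpx w) -> normc (cpx w - a) < d ->
          Y w /\ normc (derive1 f (cpx w)) ^+ 2 <= C * sqdist (pt a) w ^+ k,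
        ((lam ^- (2 * k + 5) * (Theta / 2 * k.+1%:R * e ^+ 2))%:E <= c%:E * moment (pt a) k X)%E &
        (C%:E * moment (pt a) k Y <= (lam ^+ (2 * k + 5) * (Theta / 2 * k.+1%:R * e ^+ 2))%:E)%E]].

Variables (f g : R[i] -> R[i]) (a : R[i]) (k : nat) (Theta : R).
Hypothesis dg : \forall z \near a, derivable g z 1.
Hypothesis ga : g a != 0.
Hypothesis fE : \forall z \near a, f z = (z - a) ^+ k.+1 * g z.
Hypothesis Theta_gt0 : 0 < Theta.

Hypothesis moment_near : forall lam : R, 1 < lam -> exists2 r0 : R, 0 < r0 &
  forall r, 0 < r < r0 -> exists x : R,
    [/\ moment (pt a) k (disc (pt a) (r ^+ 2) `&` unit_disc2) = x%:E,
        lam^-1 * (Theta / 2 * (r ^+ 2) ^+ k.+1 / k.+1%:R) <= x &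
        x <= Theta / 2 * (r ^+ 2) ^+ k.+1 / k.+1%:R].

Lemma sqdist_pt w : sqdist (pt a) w = normc (cpx w - a) ^+ 2.
Proof. by rewrite normc_sqr ReB ImB. Qed.

Lemma unit_disc2E w : unit_disc2 w <-> unit_disk (cpx w).
Proof.
rewrite /unit_disc2 /disc /= (_ : sqdist (0, 0) w = normc (cpx w) ^+ 2); last first.
  by rewrite normc_sqr /sqdist/= !subr0.
change (normc (cpx w) ^+ 2 < 1 <-> normc (cpx w) < 1).
by rewrite -[X in _ < X <-> _](expr1n _ 2) ltr_pXn2r ?nnegrE ?normc_ge0.
Qed.

Let M := normc (g a).

Let M_gt0 : 0 < M. Proof. by rewrite normc_gt0. Qed.

Lemma level_area : area_estimate f a k Theta.
Proof.
move=> lam delta lam1 delta0.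
have lam0 : 0 < lam := lt_trans ltr01 lam1.
have li1 : lam^-1 < 1 by rewrite invf_lt1.
have li0 : 0 < lam^-1 by rewrite invr_gt0.
have [d [G [d0 dd H _]]] := local_form dg ga fE lam1 delta0.
have [r0 r00 mom] := moment_near lam1.
pose m := Num.min d r0 / lam.
have m0 : 0 < m by rewrite divr_gt0// lt_min d0.
exists d, (M * m ^+ k.+1); split => //; first by rewrite mulr_gt0// exprn_gt0.
move=> e /andP[e0 em].
pose rho := nroot k.+1 (e / M).
have rho0 : 0 < rho by rewrite nroot_gt0// divr_gt0.
have rhoK : M * rho ^+ k.+1 = e.
  by rewrite nrootK// ?divr_ge0 ?(ltW e0) ?(ltW M_gt0)// mulrC divfK// gt_eqF.
have rhom : lam * rho < Num.min d r0.
  rewrite mulrC -ltr_pdivlMr// -/m -(@ltr_pXn2r _ k.+1) ?nnegrE ?(ltW rho0) ?(ltW m0)//.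
  by rewrite -(ltr_pM2l M_gt0) rhoK.
have /andP[rhod rhor] : (lam * rho < d) && (lam * rho < r0) by rewrite -lt_min.
have rho_lam : rho / lam < rho by rewrite gtr_pMr.
have rho_lam' : rho < lam * rho by rewrite ltr_pMl.
have rl0 : 0 < rho / lam by rewrite divr_gt0.
have lr0 : 0 < lam * rho by rewrite mulr_gt0.
(* The condition |f| < e says |w| G(w) < rho; with G between 1/lam and lam, the sublevel set lies
   between these two discs inside the unit disc. *)
pose X := disc (pt a) ((rho / lam) ^+ 2) `&` @unit_disc2 R.
pose Y := disc (pt a) ((lam * rho) ^+ 2) `&` @unit_disc2 R.
pose c := (lam^-1 * (k.+1%:R * M)) ^+ 2; pose C := (lam * (k.+1%:R * M)) ^+ 2.
have kM0 : 0 < k.+1%:R * M by rewrite mulr_gt0.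
have discE w r : 0 < r -> disc (pt a) (r ^+ 2) w <-> normc (cpx w - a) < r.
  move=> r1; rewrite /disc/= sqdist_pt ltr_pXn2r ?nnegrE ?normc_ge0 ?(ltW r1)//.
exists X, Y, c, C; split; split.
- by apply: measurableI; exact: measurable_disc.
- by apply: measurableI; exact: measurable_disc.
- exact: sqr_ge0.
- exact: sqr_ge0.
- move=> w [/(discE _ _ rl0) wr /unit_disc2E wD].
  have wd : normc (cpx w - a) < d by lra.
  have [fw GL GU DL DU] := H _ wd; rewrite subrKC in fw DL DU.
  have n0 := normc_ge0 (cpx w - a).
  have G0 : 0 <= G (cpx w - a) by rewrite (le_trans (ltW li0)).
  split => //.
    split => //; rewrite fw -rhoK ltr_pM2l// ltr_pXn2r ?nnegrE ?mulr_ge0 ?(ltW rho0)//.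
    apply: (@le_lt_trans _ _ (normc (cpx w - a) * lam)); first by rewrite ler_wpM2l.
    by rewrite -ltr_pdivlMr.
  rewrite sqdist_pt -exprM mulnC exprM -exprMn lerXn2r ?nnegrE ?normc_ge0//; last first.
    by rewrite -mulrA.
  by rewrite !mulr_ge0 ?exprn_ge0 ?(ltW li0) ?(ltW M_gt0).
- move=> w [wD fwe] wd.
  have [fw GL GU DL DU] := H _ wd; rewrite subrKC in fw DL DU.
  have n0 := normc_ge0 (cpx w - a).
  have G0 : 0 <= G (cpx w - a) by rewrite (le_trans (ltW li0)).
  split.
    split; last exact/unit_disc2E.
    apply/(discE _ _ lr0).
    have : normc (cpx w - a) * G (cpx w - a) < rho.
      rewrite -(@ltr_pXn2r _ k.+1) ?nnegrE ?mulr_ge0 ?(ltW rho0)//.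
      by rewrite -(ltr_pM2l M_gt0) -fw rhoK.
    rewrite -(ltr_pM2l lam0); apply: le_lt_trans.
    by rewrite mulrCA ler_peMr// -ler_pdivrMl// mulr1.
  rewrite sqdist_pt -exprM mulnC exprM -exprMn lerXn2r ?nnegrE ?normc_ge0//; last first.
    by rewrite -mulrA.
  by rewrite !mulr_ge0 ?exprn_ge0 ?(ltW lam0) ?(ltW M_gt0).
- have [|x [xE xL xU]] := mom (rho / lam).
    by rewrite rl0 (lt_trans rho_lam)// (lt_trans rho_lam').
  rewrite xE -EFinM lee_fin.
  apply: le_trans (ler_wpM2l (sqr_ge0 _) xL).
  (* The 2 k + 5 powers of [lam]: two from [c], 2 k + 2 from the radius, one from the moment. *)
  rewrite -rhoK le_eqVlt; apply/orP; left; apply/eqP.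
  have E1 : lam ^+ (2 * k + 5) = (lam ^+ k) ^+ 2 * lam ^+ 5 by rewrite exprD mulnC exprM.
  have E2 : ((rho / lam) ^+ 2) ^+ k.+1 = (rho ^+ k / lam ^+ k) ^+ 2 * (rho / lam) ^+ 2.
    by rewrite exprS mulrC exprAC expr_div_n.
  have L0 : lam ^+ k != 0 by rewrite expf_neq0 ?gt_eqF.
  rewrite E1 E2 /c (exprS rho k); move: (lam ^+ k) (rho ^+ k) L0 => L P L0; field.
  by rewrite L0 gt_eqF// lt0r_neq0//= ltr_wpDr.
- have [|x [xE xL xU]] := mom (lam * rho); first by rewrite lr0.
  rewrite xE -EFinM lee_fin.
  apply: le_trans (ler_wpM2l (sqr_ge0 _) xU) _.
  (* The upper bound on the moment has no factor [lam], which leaves one power to spare. *)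
  rewrite [leLHS](_ : _ = lam ^+ (2 * k + 4) * (Theta / 2 * k.+1%:R * (M * rho ^+ k.+1) ^+ 2)).
    rewrite rhoK ler_wpM2r//; last by rewrite ler_weXn2l ?leq_add2l// ltW.
    by rewrite !mulr_ge0 ?sqr_ge0 ?divr_ge0// ltW.
  have E1 : lam ^+ (2 * k + 4) = (lam ^+ k) ^+ 2 * lam ^+ 4 by rewrite exprD mulnC exprM.
  have E2 : ((lam * rho) ^+ 2) ^+ k.+1 = (lam ^+ k * rho ^+ k) ^+ 2 * (lam * rho) ^+ 2.
    by rewrite exprS mulrC exprAC exprMn.
  rewrite E1 E2 /C (exprS rho k); move: (lam ^+ k) (rho ^+ k) => L P; field.
  by rewrite lt0r_neq0//= ltr_wpDr.
Qed.

End LevelArea.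

(** * From local to global asymptotics *)

Section Assembly.
Context {d : measure_display} {T : measurableType d} {R : realType}.
Variable mu : {measure set T -> \bar R}.
Variables (I : finType) (F : R -> T -> \bar R) (B : I -> R -> set T) (A : I -> R) (n : nat).
Hypothesis F_ge0 : forall e x, (0 <= F e x)%E.
Hypothesis A_ge0 : forall i, 0 <= A i.

(* The bounds l and h are measurable, so that no measurability of F is needed. *)
Definition squeezed i (eta delta e : R) := exists l h : T -> \bar R,
  [/\ measurable_fun setT l, measurable_fun setT h,
      forall x, (0 <= l x)%E & forall x, (0 <= h x)%E] /\
  [/\ forall x, (l x <= F e x)%E /\ (~ B i delta x -> l x = 0%E),
      forall x, B i delta x -> (F e x <= h x)%E,
      (((1 - eta) * (A i * e ^+ n))%:E <= \int[mu]_x l x)%E &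
      (\int[mu]_x h x <= ((1 + eta) * (A i * e ^+ n))%:E)%E].

(** The bounds are extended by zero outside X and Y. Where F vanishes the upper bound is trivial, so
    Y has to contain only the points of B with F nonzero. *)
Lemma squeezed_restrict i (eta delta e : R) (X Y : set T) (a b : T -> \bar R) :
  measurable X -> measurable Y -> measurable_fun X a -> measurable_fun Y b ->
  (forall x, 0 <= a x)%E -> (forall x, 0 <= b x)%E ->
  (forall x, X x -> (a x <= F e x)%E /\ B i delta x) ->
  (forall x, B i delta x -> F e x <> 0%E -> Y x /\ (F e x <= b x)%E) ->
  (((1 - eta) * (A i * e ^+ n))%:E <= \int[mu]_(x in X) a x)%E ->
  (\int[mu]_(x in Y) b x <= ((1 + eta) * (A i * e ^+ n))%:E)%E ->
  squeezed i eta delta e.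
Proof.
move=> mX mY ma mb a0 b0 aF Fb la ub; exists (a \_ X), (b \_ Y); split; split.
- by apply/(measurable_restrictT _ _).1.
- by apply/(measurable_restrictT _ _).1.
- by move=> x; rewrite patchE; case: ifP.
- by move=> x; rewrite patchE; case: ifP.
- move=> x; rewrite patchE; case: ifPn => [/set_mem/aF[aFx Bx]|_]; first by split.
  by split; first exact: F_ge0.
- move=> x Bx; have [->|/eqP Fx] := eqVneq (F e x) 0%E; first by rewrite patchE; case: ifP.
  by have [Yx Fbx] := Fb x Bx Fx; rewrite patchE mem_set.
- by rewrite -integral_mkcond.
- by rewrite -integral_mkcond.
Qed.

Hypothesis local : forall i eta delta0, 0 < eta -> 0 < delta0 ->
  exists delta e0 : R, [/\ 0 < delta, delta <= delta0, 0 < e0 &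
    forall e, 0 < e < e0 -> squeezed i eta delta e].
Hypothesis separated : exists2 delta0 : R, 0 < delta0 & forall i j delta delta' x, i != j ->
  delta <= delta0 -> delta' <= delta0 -> B i delta x -> B j delta' x -> False.
Hypothesis covered : forall delta : I -> R, (forall i, 0 < delta i) ->
  exists2 e0 : R, 0 < e0 & forall e x, 0 < e < e0 -> F e x <> 0%E ->
    exists i, B i (delta i) x.

Lemma fin_uniform_pos (J : finType) (c : J -> R) : (forall i, 0 < c i) ->
  exists2 e : R, 0 < e & forall i, e <= c i.
Proof.
(* The initial value 1 is the witness when [J] is empty. *)
move=> c0; exists (\big[Num.min/1]_i c i).
  by elim/big_ind : _ => // x y x0 y0; rewrite lt_min x0.
by move=> i; rewrite (bigD1 i)//= ge_min lexx.
Qed.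

(** The lower functions have disjoint supports, so at each point their sum is a single one of them
    or 0; the sum of the upper functions dominates F because each point with F nonzero lies near
    some zero. *)
Lemma integral_squeeze (eta : R) : 0 < eta -> exists2 e0 : R, 0 < e0 & forall e, 0 < e < e0 ->
  (((1 - eta) * (\sum_i A i * e ^+ n))%:E <= \int[mu]_x F e x)%E /\
  (\int[mu]_x F e x <= ((1 + eta) * (\sum_i A i * e ^+ n))%:E)%E.
Proof.
move=> eta0; have [delta0 delta00 sep] := separated.
have /choice[delta loc] : forall i, exists delta : R, [/\ 0 < delta, delta <= delta0 &
    exists2 e0 : R, 0 < e0 & forall e, 0 < e < e0 -> squeezed i eta delta e].
  move=> i; have [delta [e0 [? ? ? ?]]] := local i eta0 delta00.
  by exists delta; split => //; exists e0.
have /choice[e1 e1P] : forall i, exists e1 : R, 0 < e1 /\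
    forall e, 0 < e < e1 -> squeezed i eta (delta i) e.
  by move=> i; have [_ _ [e1 ? ?]] := loc i; exists e1.
have [e2 e20 e2P] : exists2 e0 : R, 0 < e0 & forall e x, 0 < e < e0 -> F e x <> 0%E ->
    exists i, B i (delta i) x.
  by apply: covered => i; have [] := loc i.
have [e3 e30 e3P] := fin_uniform_pos (fun i => (e1P i).1).
exists (Num.min e2 e3); first by rewrite lt_min e20.
move=> e /andP[e0]; rewrite lt_min => /andP[ee2 ee3].
have /choice[l] : forall i, exists l : T -> \bar R, exists h : T -> \bar R,
  [/\ measurable_fun setT l, measurable_fun setT h,
      forall x, (0 <= l x)%E & forall x, (0 <= h x)%E] /\
  [/\ forall x, (l x <= F e x)%E /\ (~ B i (delta i) x -> l x = 0%E),
      forall x, B i (delta i) x -> (F e x <= h x)%E,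
      (((1 - eta) * (A i * e ^+ n))%:E <= \int[mu]_x l x)%E &
      (\int[mu]_x h x <= ((1 + eta) * (A i * e ^+ n))%:E)%E].
  by move=> i; apply: (e1P i).2; rewrite e0 (lt_le_trans ee3).
move=> /choice[h lh]; split.
  apply: (@le_trans _ _ (\int[mu]_x (\sum_i l i x)%E)%E).
    rewrite ge0_integral_sum//; last 2 first.
    - by move=> i; have [[]] := lh i.
    - by move=> i x _; have [[]] := lh i.
    rewrite mulr_sumr -sumEFin; apply: lee_sum => i _.
    by have [_ []] := lh i.
  apply: le_integralT => x; first by apply: sume_ge0 => i _; have [[]] := lh i.
  have [[i Bi]|nB] := pselect (exists i, B i (delta i) x).
    rewrite (bigD1 i)//= big1 ?adde0; first by have [_ [+ _ _ _]] := lh i => /(_ x)[].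
    move=> j ji; have [_ [+ _ _ _]] := lh j => /(_ x)[_]; apply => Bj.
    have [_ di _] := loc i; have [_ dj _] := loc j.
    exact: sep ji dj di Bj Bi.
  rewrite big1; first exact: F_ge0.
  move=> j _; have [_ [+ _ _ _]] := lh j => /(_ x)[_]; apply => Bj.
  by apply: nB; exists j.
apply: (@le_trans _ _ (\int[mu]_x (\sum_i h i x)%E)%E).
  apply: le_integralT => x; first exact: F_ge0.
  have h0 : (0 <= \sum_i h i x)%E by apply: sume_ge0 => i _; have [[]] := lh i.
  have [->//|/eqP Fx] := eqVneq (F e x) 0%E.
  have [|i Bi] := e2P e x _ Fx; first by rewrite e0.
  apply: (@le_trans _ _ (h i x)); first by have [_ [_ + _ _]] := lh i; exact.
  rewrite (bigD1 i)//= leeDl// sume_ge0// => j _; by have [[]] := lh j.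
rewrite ge0_integral_sum//; last 2 first.
- by move=> i; have [[]] := lh i.
- by move=> i x _; have [[]] := lh i.
rewrite mulr_sumr -sumEFin; apply: lee_sum => i _.
by have [_ []] := lh i.
Qed.

Lemma integral_asymptotics : exists h : R -> R, h =o_ (0^'+) (fun e : R => e ^+ n) /\
  \forall e \near 0^'+, (\int[mu]_x F e x)%E = ((\sum_i A i) * e ^+ n + h e)%:E.
Proof.
set S := \sum_i A i.
have S0 : 0 <= S by exact: sumr_ge0.
pose h e := fine (\int[mu]_x F e x)%E - S * e ^+ n.
have SE e : \sum_i A i * e ^+ n = S * e ^+ n by rewrite mulr_suml.
have near0 (e0 : R) (P : R -> Prop) : 0 < e0 -> (forall e, 0 < e < e0 -> P e) ->
    \forall e \near 0^'+, P e.
  move=> e00 H; near=> e; apply: H; apply/andP; split.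
    by near: e; exact: nbhs_right_gt.
  by near: e; exact: nbhs_right_lt.
have finF (eta e : R) : 0 <= S * e ^+ n ->
    (((1 - eta) * (S * e ^+ n))%:E <= \int[mu]_x F e x)%E ->
    (\int[mu]_x F e x <= ((1 + eta) * (S * e ^+ n))%:E)%E ->
    exists2 x : R, (\int[mu]_x F e x)%E = x%:E & `|x - S * e ^+ n| <= eta * (S * e ^+ n).
  move=> H0; case: (\int[mu]_x F e x)%E => [x| |] //; rewrite ?lee_fin => H1 H2.
  by exists x => //; rewrite ler_norml; lra.
have Se (e : R) : 0 < e -> 0 <= S * e ^+ n by move=> e0; rewrite mulr_ge0// exprn_ge0// ltW.
exists h; split.
  apply/eqoP => eps eps0.
  (* The relative error eta becomes eta * S <= eps; the summand 1 covers S = 0. *)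
  have eta0 : 0 < eps / (S + 1) by rewrite divr_gt0// ltr_wpDl.
  have [e0 e00 e0P] := integral_squeeze eta0.
  apply: near0 e00 _ => e /andP[ep ee].
  have [|L U] := e0P e; first by rewrite ep.
  rewrite !SE in L U; have [x xE xB] := finF _ _ (Se _ ep) L U.
  rewrite /h xE/=; apply: le_trans xB _.
  rewrite [`|e ^+ n|]ger0_norm; last by rewrite exprn_ge0// ltW.
  rewrite mulrA; apply: ler_wpM2r; first by rewrite exprn_ge0// ltW.
  rewrite mulrAC ler_pdivrMr ?ltr_wpDl// ler_wpM2l ?(ltW eps0)//.
  by rewrite lerDl.
(* Any fixed eta shows that the integral is finite for small e, so that [fine] in the definition of
   h loses nothing. *)
have [e0 e00 e0P] := integral_squeeze ltr01.
apply: near0 e00 _ => e /andP[ep ee].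
have [|L U] := e0P e; first by rewrite ep.
rewrite !SE in L U; have [x xE xB] := finF _ _ (Se _ ep) L U.
by rewrite /h xE/= subrKC.
Unshelve. all: by end_near. Qed.

End Assembly.

(** Converts a relative error eta into the distortion [lam]; both inequalities follow from lam^N <=
    1 + eta, because (1 - eta)(1 + eta) <= 1. *)
Lemma exp_near1 (R : realType) (N : nat) (eta : R) : 0 < eta ->
  exists lam : R, [/\ 1 < lam, lam ^+ N <= 1 + eta & 1 - eta <= lam ^- N].
Proof.
move=> eta0; have [lam lam1 lamN] : exists2 lam : R, 1 < lam & lam ^+ N <= 1 + eta.
  (* The (N+1)-st root of 1 + eta, which also makes sense for N = 0. *)
  exists (expR (ln (1 + eta) / N.+1%:R)).
    by rewrite -[X in X < _]expR0 ltr_expR divr_gt0// ln_gt0// ltrDl.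
  rewrite -expRM_natl -[leRHS]lnK ?posrE ?addr_gt0// ler_expR.
  rewrite mulrA ler_pdivrMr// [leRHS]mulrC ler_wpM2r ?ler_nat ?leqnSn//.
  by rewrite ltW// ln_gt0// ltrDl.
exists lam; split => //.
have l0 : 0 < lam ^+ N by rewrite exprn_gt0// (lt_trans ltr01).
have : (1 + eta)^-1 <= lam ^- N by rewrite lef_pV2 ?posrE// addr_gt0.
move=> H; apply: le_trans H; rewrite -[leRHS]mul1r ler_pdivlMr ?addr_gt0//.
by have := sqr_ge0 eta; rewrite expr2; lra.
Qed.

(** * Directions that point into the unit disk *)

Section Angles.
Context {R : realType}.
Implicit Types (c w q : R[i]).

Lemma cis_upper c : normc c = 1 -> 0 <= Im c -> exists2 th, th \in `[0, pi] & c = cis th.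
Proof.
move=> c1 c0; have := normc_sqr c; rewrite c1 expr1n => C.
have R1 : -1 <= Re c <= 1 by have := le_Re_normc c; rewrite c1 ler_norml.
exists (acos (Re c)); first by rewrite in_itv/= acos_ge0// acos_lepi.
rewrite /cis sin_acos// acosK ?in_itv//=.
rewrite (_ : 1 - Re c ^+ 2 = Im c ^+ 2); last by rewrite C; ring.
by rewrite sqrtr_sqr ger0_norm//; case: (c).
Qed.

Lemma cis_surj c : normc c = 1 -> exists2 th, th \in `[0, pi *+ 2] & c = cis th.
Proof.
move=> c1; have [c0|c0] := leP 0 (Im c).
  have [th thI ->] := cis_upper c1 c0; exists th => //.
  move: thI; rewrite !in_itv/= => /andP[-> /le_trans]; apply.
  by rewrite mulr2n lerDl pi_ge0.
have c1' : normc (c^*)%C = 1 by rewrite -c1; case: (c) => x y /=; rewrite sqrrN.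
have [|th thI cE] := cis_upper c1'; first by move: c0; case: (c) => x y /= /ltW; rewrite oppr_ge0.
exists (pi *+ 2 - th).
  by move: thI; rewrite !in_itv/= mulr2n => /andP[? ?]; have := @pi_ge0 R; lra.
rewrite /cis cosB sinB cos2pi sin2pi !mul0r !mul1r addr0 sub0r.
by have := congr1 conjc cE; rewrite conjcK.
Qed.

Lemma interior_angle w : w != 0 -> exists2 th, th \in `[0, pi *+ 2] &
  w = (normc w)%:C * (1 * cis th).
Proof.
move=> w0; have nw : 0 < normc w by rewrite normc_gt0.
have [|th thI E] := @cis_surj (w / (normc w)%:C).
  by rewrite normcM normcV normcR ger0_norm ?(ltW nw)// divff// gt_eqF.
exists th => //; rewrite mul1r -E mulrC divfK//.
by apply/eqP => -[] /eqP; rewrite gt_eqF.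
Qed.

Lemma interior_disk a (tau : R) : unit_disk a -> exists2 d : R, 0 < d &
  forall th t, th \in `[tau, pi *+ 2 - tau] -> 0 < t < d -> unit_disk (a + t%:C * (1 * cis th)).
Proof.
rewrite /unit_disk/= => a1; exists (1 - normc a); first by rewrite subr_gt0.
move=> th t _ /andP[t0 t1]; apply: le_lt_trans (le_normcD _ _) _.
by rewrite mul1r normcM normc_cis mulr1 normcR gtr0_norm//; lra.
Qed.

Lemma normc_sqrD c w : normc (c + w) ^+ 2 = normc c ^+ 2 + 2 * Re (w * (c^*)%C) + normc w ^+ 2.
Proof. by rewrite !normc_sqr; case: c w => x y [s t] /=; ring. Qed.

(** The tangent direction q i is taken as angle 0, so that - q has angle pi / 2. From |q + w|^2 = 1
    + 2 Re(w conj(q)) + |w|^2 < 1 it follows that Re(w conj(q)) < 0, which places w in the inner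
    half plane. *)
Lemma boundary_angle q w : unit_circle q -> unit_disk (q + w) -> w != 0 ->
  exists2 th, th \in `[0, pi] & w = (normc w)%:C * (q * 'i%C * cis th).
Proof.
rewrite /unit_circle /unit_disk/= => q1 qw w0; have nw : 0 < normc w by rewrite normc_gt0.
have nwC : (normc w)%:C != 0 by apply/eqP => -[] /eqP; rewrite gt_eqF.
have qq : (q^*)%C * q = 1.
  have := normc_sqr q; rewrite q1 expr1n => C.
  by rewrite -[1](_ : (1 : R)%:C = 1)// C; case: (q) => x y; simpc; congr (_ +i* _); rewrite /=; ring.
have ii : - 'i%C * 'i%C = 1 :> R[i] by rewrite mulNr -expr2 sqr_i opprK.
have nqc : normc (q^*)%C = 1 by rewrite -q1; case: (q) => x y /=; rewrite sqrrN.
pose c := w * (q^*)%C * - 'i%C / (normc w)%:C.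
have ni : normc (- 'i%C : R[i]) = 1 by rewrite /= oppr0 expr0n/= add0r sqrrN expr1n sqrtr1.
have c1 : normc c = 1.
  by rewrite /c !normcM normcV normcR nqc ni !mulr1 ger0_norm ?(ltW nw)// divff// gt_eqF.
have c0 : 0 <= Im c.
  have -> : Im c = - Re (w * (q^*)%C) / normc w.
    rewrite /c -[_^-1]/(((normc w)%:C)^-1) -fmorphV/=.
    by case: (w * (q^*)%C) => x y; simpc; rewrite /=; ring.
  rewrite divr_ge0 ?(ltW nw)//.
  have : normc (q + w) ^+ 2 < 1 by rewrite expr_lt1 ?normc_ge0.
  rewrite normc_sqrD q1 expr1n; have := sqr_ge0 (normc w); lra.
have [th thI E] := cis_upper c1 c0.
exists th => //; rewrite -E /c.
transitivity (w * ((q^*)%C * q) * (- 'i%C * 'i%C) * ((normc w)%:C / (normc w)%:C)).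
  by rewrite qq ii divff// !mulr1.
ring.
Qed.

Lemma boundary_disk q (tau : R) : unit_circle q -> 0 < tau -> exists2 d : R, 0 < d &
  forall th t, th \in `[tau, pi - tau] -> 0 < t < d ->
    unit_disk (q + t%:C * (q * 'i%C * cis th)).
Proof.
rewrite /unit_circle/= => q1 tau0.
(* For large tau no angle is left. *)
have [tp|pt] := leP tau (pi - tau); last first.
  by exists 1 => // th t; rewrite in_itv/= => /andP[/le_trans H /H]; rewrite leNgt pt.
have [|c cI cP] := @EVT_min R sin tau (pi - tau) tp.
  by apply: continuous_subspaceT => x; exact: continuous_sin.
have sc : 0 < sin c.
  by apply: sin_gt0_pi; move: cI; rewrite in_itv/= => /andP[? ?]; lra.
(* The squared modulus is 1 - t (2 sin th - t), below 1 as soon as t is less than the minimum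
   [sin c] of sin on the angles considered. *)
exists (sin c) => // th t thI /andP[t0 tc]; rewrite /unit_disk/=.
have -> : q + t%:C * (q * 'i%C * cis th) = q * (1 + t%:C * ('i%C * cis th)) by ring.
rewrite normcM q1 mul1r -(@ltr_pXn2r _ 2) ?nnegrE ?normc_ge0// expr1n.
rewrite normc_sqr /cis; simpc; rewrite /=.
have := cP _ thI; have := cos2Dsin2 th => C S.
rewrite (_ : _ + _ = 1 - t * (2 * sin th - t * (cos th ^+ 2 + sin th ^+ 2))); last by ring.
by rewrite C ltrBlDr ltrDl mulr_gt0//; lra.
Qed.

End Angles.

Section Moments.
Context {R : realType}.

Lemma moment_near_interior (a : R[i]) k : unit_disk a ->
  forall lam : R, 1 < lam -> exists2 r0 : R, 0 < r0 & forall r, 0 < r < r0 ->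
  exists x : R,
    [/\ moment (pt a) k (disc (pt a) (r ^+ 2) `&` unit_disc2) = x%:E,
        lam^-1 * (pi *+ 2 / 2 * (r ^+ 2) ^+ k.+1 / k.+1%:R) <= x &
        x <= pi *+ 2 / 2 * (r ^+ 2) ^+ k.+1 / k.+1%:R].
Proof.
move=> a1 lam lam1; have [|r0 r00 H] := @moment_interior R (pt a) k.
  have := normc_sqr a; rewrite /pt/= => <-.
  by rewrite expr_lt1 ?normc_ge0//; exact: a1.
exists r0 => // r rr; exists (pi * (r ^+ 2) ^+ k.+1 / k.+1%:R).
have -> : pi *+ 2 / 2 = pi :> R by field.
split => //; first exact: H.
rewrite ler_piMl ?invf_le1 ?(ltW lam1) ?(lt_trans ltr01)//.
by rewrite divr_ge0// mulr_ge0 ?pi_ge0// exprn_ge0// sqr_ge0.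
Qed.

Lemma moment_near_boundary (a : R[i]) k : unit_circle a ->
  forall lam : R, 1 < lam -> exists2 r0 : R, 0 < r0 & forall r, 0 < r < r0 ->
  exists x : R,
    [/\ moment (pt a) k (disc (pt a) (r ^+ 2) `&` unit_disc2) = x%:E,
        lam^-1 * (pi / 2 * (r ^+ 2) ^+ k.+1 / k.+1%:R) <= x &
        x <= pi / 2 * (r ^+ 2) ^+ k.+1 / k.+1%:R].
Proof.
move=> a1 lam lam1.
have lam0 : 0 < lam := lt_trans ltr01 lam1.
have li : 0 < 1 - lam^-1 by rewrite subr_gt0 invf_lt1.
have a2 : (pt a).1 ^+ 2 + (pt a).2 ^+ 2 = 1.
  by have := normc_sqr a; rewrite /pt/= => <-; rewrite a1 expr1n.
have p0 : 0 < pi / k.+1%:R :> R by rewrite divr_gt0// pi_gt0.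
(* For such r the strip error is at most the fraction 1 - 1/lam of the full moment. *)
exists ((1 - lam^-1) * (pi / k.+1%:R) / 4); first by rewrite divr_gt0// mulr_gt0.
move=> r /andP[r0 rr]; have [x [xE xU xL]] := moment_boundary k a2 r0.
have VE : pi / 2 * (r ^+ 2) ^+ k.+1 / k.+1%:R = (pi * (r ^+ 2) ^+ k.+1 / k.+1%:R) / 2.
  by move: (k.+1%:R^-1 : R) => y; field.
exists x; rewrite VE; split => //; last by rewrite ler_pdivlMr// mulrC.
have Q0 : 0 <= (r ^+ 2) ^+ k.+1 by rewrite exprn_ge0// sqr_ge0.
have : 4 * r * (r ^+ 2) ^+ k.+1 <= (1 - lam^-1) * (pi / k.+1%:R) * (r ^+ 2) ^+ k.+1.
  rewrite ler_wpM2r// ltW// mulrC; move: rr.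
  by rewrite ltr_pdivlMr.
rewrite -(mulrA (1 - _)) (mulrAC pi); move: xL.
move: (pi * (r ^+ 2) ^+ k.+1 / k.+1%:R) (4 * r * (r ^+ 2) ^+ k.+1) => V W.
by rewrite mulrBl mul1r mulrA; lra.
Qed.

End Moments.

(** * Multiplicity, isolation and compactness of the zeros *)

Section ZeroStructure.
Context {R : realType}.
Implicit Types (f : R[i] -> R[i]) (z a : R[i]).

(** With k = 0 the factorization would give f a = g a, which is nonzero. *)
Lemma zero_multiplicity_succ f a k : f a = 0 -> zero_multiplicity f a k ->
  exists2 k', k = k'.+1 & exists g : R[i] -> R[i], [/\ \forall z \near a, derivable g z 1, g a != 0 &
    \forall z \near a, f z = (z - a) ^+ k'.+1 * g z].
Proof.
move=> fa [g [dg ga fE]]; case: k fE => [fE|k fE]; last by exists k => //; exists g.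
by move: ga; have := nbhs_singleton fE; rewrite fa expr0 mul1r => <-; rewrite eqxx.
Qed.

Lemma holomorphic_continuous_normc f z eta : derivable f z 1 -> 0 < eta ->
  exists2 d : R, 0 < d & forall z', normc (z' - z) < d -> normc (f z' - f z) < eta.
Proof.
move=> /derivable_cdiff df eta0; have [d d0 dP] := df 1 ltr01.
pose L := normc (derive1 f z) + 1.
have L0 : 0 < L by rewrite ltr_wpDl// normc_ge0.
exists (Num.min d (eta / L)); first by rewrite lt_min d0 divr_gt0.
move=> z'; rewrite lt_min => /andP[/dP + ]; rewrite mul1r ltr_pdivlMr// (mulrC _ L) => H.
apply: le_lt_trans; rewrite -(subrK (derive1 f z * (z' - z)) (f z' - f z)).
apply: le_trans (le_normcD _ _) _; rewrite normcM /L mulrDl mul1r addrC; exact: lerD.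
Qed.

Lemma near_pair (x : R * R) (P : R * R -> Prop) : (exists2 d : R, 0 < d &
    forall y, normc ((y.1 - x.1) +i* (y.2 - x.2)) < d -> P y) -> \forall y \near x, P y.
Proof.
move=> [d d0 dP]; apply/nbhs_ballP; exists (d / 2); first by rewrite /= divr_gt0.
move=> y [/= y1 y2]; apply: dP; apply: le_lt_trans (normc_le_ReIm _) _ => /=.
move: y1 y2; rewrite -!ball_normE/= (distrC x.1) (distrC x.2); lra.
Qed.

(* Compactness of the square containing the closed disk, with the smallness of
   [e] as the parameter of the covering. *)
Lemma small_near_zeros (I : finType) (c : I -> R[i]) (delta : I -> R) f :
  (forall z, closed_unit_disk z -> derivable f z 1) ->
  (forall z, closed_unit_disk z -> f z = 0 -> exists i, c i = z) ->
  (forall i, 0 < delta i) ->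
  exists2 e0 : R, 0 < e0 & forall e z, 0 < e < e0 -> unit_disk z -> normc (f z) <= e ->
    exists i, normc (z - c i) < delta i.
Proof.
move=> df fz delta0.
pose P (e : R) (w : R * R) := unit_disk (w.1 +i* w.2) -> normc (f (w.1 +i* w.2)) <= e ->
  exists i, normc ((w.1 +i* w.2) - c i) < delta i.
have cK : compact (`[(-1 : R), 1]%classic `*` `[(-1 : R), 1]%classic).
  by apply: compact_setX; exact: segment_compact.
have dist (x y : R * R) : (y.1 - x.1) +i* (y.2 - x.2) = (y.1 +i* y.2) - (x.1 +i* x.2) by simpc.
have : \forall e \near (0 : R)^'+, `[(-1 : R), 1]%classic `*` `[(-1 : R), 1]%classic `<=` P e.
  move/compact_near_coveringP : cK; apply => x _.
  set z := x.1 +i* x.2.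
  (* Three cases: outside the closed disk there are no disk points nearby, at a zero the ball of
     radius [delta i] serves, and elsewhere |f| stays above half of its value. *)
  have local : exists2 N : R, 0 < N & exists2 d : R, 0 < d & forall e y, e < N ->
      normc ((y.1 +i* y.2) - z) < d -> P e y.
    have [z1|z1] := leP (normc z) 1; last first.
      exists 1 => //; exists (normc z - 1); first by rewrite subr_gt0.
      move=> e y _; rewrite /P; move: (y.1 +i* y.2) => v vz; rewrite /unit_disk/= => v1.
      exfalso; by have := le_normcB z v; rewrite (normc_distC z); lra.
    have [fz0|fz0] := eqVneq (f z) 0.
      have [i ci] := fz z z1 fz0; exists 1 => //; exists (delta i) => // e y _ yz _ _.
      by exists i; rewrite ci.
    have n0 : 0 < normc (f z) / 2 by rewrite divr_gt0// normc_gt0.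
    have [d d0 dP] := holomorphic_continuous_normc (df z z1) n0.
    exists (normc (f z) / 2) => //; exists d => // e y en; rewrite /P; move: (y.1 +i* y.2) => v /dP vz _ ve.
    exfalso; by have := le_normcB (f z) (f v); rewrite (normc_distC (f z)); lra.
  have [N N0 [d d0 dP]] := local.
  exists ([set y | normc ((y.1 +i* y.2) - z) < d], [set e | e < N]).
    split => /=; last exact: nbhs_right_lt.
    by apply: near_pair; exists d => // y; rewrite dist.
  by move=> [y e] [/= yz eN]; exact: dP.
rewrite near_withinE => /nbhs_ballP[e0 /= e00 H]; exists e0 => // e z /andP[ep ee] zD fe.
have := H e; rewrite -ball_normE/= sub0r normrN gtr0_norm// => /(_ ee ep (Re z, Im z)).
rewrite /P/=; case: z zD fe => x y zD fe /=; apply => //.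
split => /=; rewrite in_itv/= -ler_norml.
  by apply: le_trans (le_Re_normc (x +i* y)) (ltW zD).
by apply: le_trans (le_Im_normc (x +i* y)) (ltW zD).
Qed.

Lemma fin_separated (I : finType) (c : I -> R[i]) : injective c ->
  exists2 d : R, 0 < d & forall i j (delta delta' : R) x, i != j -> delta <= d -> delta' <= d ->
    normc (x - c i) < delta -> normc (x - c j) < delta' -> False.
Proof.
(* Half the mutual distances; the value 1 on the diagonal only keeps the minimum positive. *)
move=> cinj; pose D (ij : I * I) := if ij.1 == ij.2 then 1 else normc (c ij.1 - c ij.2) / 2.
have [|d d0 dP] := @fin_uniform_pos R _ D.
  move=> [i j]; rewrite /D/=; case: eqVneq => // ij.
  by rewrite divr_gt0// normc_gt0 subr_eq0; apply: contra ij => /eqP/cinj ->.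
exists d => // i j delta delta' x ij di dj xi xj.
have := dP (i, j); rewrite /D/= (negbTE ij) => H.
have := le_normc_distD x (c i) (c j); rewrite (normc_distC (c i) x); lra.
Qed.

End ZeroStructure.

(** * Expansions for a finite family of zeros *)

Section Expansion.
Context {R : realType}.
Variables (f : R[i] -> R[i]) (I : finType) (c : I -> R[i]) (k : I -> nat) (Theta : I -> R).
Hypothesis df : forall z, closed_unit_disk z -> derivable f z 1.
Hypothesis fz : forall z, closed_unit_disk z -> f z = 0 -> exists i, c i = z.
Hypothesis c_inj : injective c.
Hypothesis Theta_gt0 : forall i, 0 < Theta i.

Lemma level_curve_expansion : (forall i, arc_estimate f (c i) (k i) (Theta i)) ->
  exists h : R -> R, h =o_ (0^'+) (fun e : R => e) /\ \forall e \near 0^'+,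
    (\int[arc_length R]_(z in level_curve f e) (normc (derive1 f z))%:E)%E =
    ((\sum_i Theta i * (k i).+1%:R) * e + h e)%:E.
Proof.
move=> est.
pose F (e : R) : caratheodory_type (hausdorff1_outer R) -> \bar R :=
  (fun z => (normc (derive1 f z))%:E) \_ (level_curve f e).
have FE e z : level_curve f e z -> F e z = (normc (derive1 f z))%:E.
  by move=> H; rewrite /F patchE mem_set.
have FN e z : F e z <> 0%E -> level_curve f e z.
  by rewrite /F patchE; case: ifPn => // /set_mem.
pose B i (d : R) : set (caratheodory_type (hausdorff1_outer R)) := [set z | normc (z - c i) < d].
have [|i|i eta delta0 eta0 delta00|||h [ho hE]] :=
    @integral_asymptotics _ _ R (arc_length R) I F B (fun i => Theta i * (k i).+1%:R) 1.
- by move=> e z; rewrite /F patchE; case: ifP => // _; rewrite lee_fin normc_ge0.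
- by rewrite mulr_ge0// ltW.
- have [lam [lam1 lamU lamL]] := exp_near1 (k i).+4 eta0.
  have [d [e0 [d0 dd e00 H]]] := est i lam delta0 lam1 delta00.
  exists d, e0; split => // e ee; have /andP[e_gt0 _] := ee.
  have [S [T [x [y [[mS mT x0 y0] [HS HT lS uT]]]]]] := H e ee.
  have A0 : 0 <= Theta i * (k i).+1%:R * e by rewrite !mulr_ge0 ?(ltW e_gt0)// ltW.
  apply: (@squeezed_restrict _ _ _ (arc_length R) _ F B _ _ _ _ _ _ _ S T (cst x%:E) (cst y%:E)) => //.
  + by move=> e' z; rewrite /F patchE; case: ifP => // _; rewrite lee_fin normc_ge0.
  + by move=> z /HS[zf za xz]; rewrite FE// lee_fin.
  + move=> z Bz /FN zf; rewrite FE// lee_fin; exact: HT.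
  + rewrite integral_cst//; apply: le_trans lS.
    by rewrite lee_fin expr1 ler_wpM2r.
  + rewrite integral_cst//; apply: le_trans uT _.
    by rewrite lee_fin expr1 ler_wpM2r.
- have [d0 d00 sep] := fin_separated c_inj.
  by exists d0 => // i j delta delta' x ij di dj; exact: sep.
- move=> delta delta0; have [e0 e00 H] := small_near_zeros df fz delta0.
  exists e0 => // e z ee /FN[zD ze]; apply: H ee zD _; by rewrite ze.
exists h; split => //; near=> e; rewrite integral_mkcond; near: e; exact: hE.
Unshelve. all: by end_near. Qed.

Lemma sublevel_set_expansion : (forall i, area_estimate f (c i) (k i) (Theta i)) ->
  exists h : R -> R, h =o_ (0^'+) (fun e : R => e ^+ 2) /\ \forall e \near 0^'+,
    (\int[area R]_(w in [set w : R * R | sublevel_set f e (w.1 +i* w.2)])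
       (normc (derive1 f (w.1 +i* w.2)) ^+ 2)%:E)%E =
    ((\sum_i Theta i / 2 * (k i).+1%:R) * e ^+ 2 + h e)%:E.
Proof.
move=> est.
pose F (e : R) : measurableTypeR R * measurableTypeR R -> \bar R :=
  (fun w => (normc (derive1 f (cpx w)) ^+ 2)%:E) \_ [set w | sublevel_set f e (cpx w)].
have FE e w : sublevel_set f e (cpx w) -> F e w = (normc (derive1 f (cpx w)) ^+ 2)%:E.
  by move=> H; rewrite /F patchE mem_set.
have FN e w : F e w <> 0%E -> sublevel_set f e (cpx w).
  by rewrite /F patchE; case: ifPn => // /set_mem.
pose B i (d : R) : set (measurableTypeR R * measurableTypeR R) :=
  [set w | normc (cpx w - c i) < d].
have [|i|i eta delta0 eta0 delta00|||h [ho hE]] :=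
    @integral_asymptotics _ _ R (area R) I F B (fun i => Theta i / 2 * (k i).+1%:R) 2.
- by move=> e w; rewrite /F patchE; case: ifP => // _; rewrite lee_fin sqr_ge0.
- by rewrite mulr_ge0// divr_ge0// ltW.
- have [lam [lam1 lamU lamL]] := exp_near1 (2 * k i + 5) eta0.
  have [d [e0 [d0 dd e00 H]]] := est i lam delta0 lam1 delta00.
  exists d, e0; split => // e ee; have /andP[e_gt0 _] := ee.
  have [X [Y [x [y [[mX mY x0 y0] [HX HY lX uY]]]]]] := H e ee.
  have A0 : 0 <= Theta i / 2 * (k i).+1%:R * e ^+ 2.
    by rewrite !mulr_ge0 ?sqr_ge0// ?divr_ge0// ltW.
  pose s w : \bar R := (sqdist (pt (c i)) w ^+ k i)%:E.
  have s0 w : (0 <= s w)%E by rewrite lee_fin exprn_ge0// sqdist_ge0.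
  have ms (Z : set (measurableTypeR R * measurableTypeR R)) : measurable_fun Z s.
    exact: measurable_moment.
  apply: (@squeezed_restrict _ _ _ (area R) _ F B _ _ _ _ _ _ _ X Y
    (fun w => x%:E * s w)%E (fun w => y%:E * s w)%E) => //.
  + by move=> e' z; rewrite /F patchE; case: ifP => // _; rewrite lee_fin sqr_ge0.
  + exact: measurable_funeM.
  + exact: measurable_funeM.
  + by move=> w; rewrite mule_ge0.
  + by move=> w; rewrite mule_ge0.
  + by move=> w /HX[wf wa xw]; rewrite FE// lee_fin.
  + by move=> w Bw /FN wf; rewrite FE// lee_fin; exact: HY.
  + rewrite ge0_integralZl//; apply: le_trans lX.
    by rewrite lee_fin ler_wpM2r.
  + rewrite ge0_integralZl//; apply: le_trans uY _.
    by rewrite lee_fin ler_wpM2r.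
- have [d0 d00 sep] := fin_separated c_inj.
  by exists d0 => // i j delta delta' x ij di dj; exact: sep.
- move=> delta delta0; have [e0 e00 H] := small_near_zeros df fz delta0.
  exists e0 => // e w ee /FN[wD we]; apply: H ee wD _; exact: ltW.
exists h; split => //; near=> e; rewrite integral_mkcond; near: e; exact: hE.
Unshelve. all: by end_near. Qed.

End Expansion.

Section LocalEstimates.
Context {R : realType}.
Implicit Types (f g : R[i] -> R[i]) (a : R[i]).

Lemma interior_estimates f g a k : (\forall z \near a, derivable g z 1) -> g a != 0 ->
  (\forall z \near a, f z = (z - a) ^+ k.+1 * g z) -> unit_disk a ->
  arc_estimate f a k (pi *+ 2) /\ area_estimate f a k (pi *+ 2).
Proof.
move=> dg ga fE a1; have pi2 : 0 < pi *+ 2 :> R by rewrite mulrn_wgt0// pi_gt0.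
split.
  apply: (@level_arc _ f g a 1 k) => //; first exact: normc1.
    by move=> w _; exact: interior_angle.
  by move=> tau _; exact: interior_disk.
apply: (@level_area _ f g a k) => //.
exact: moment_near_interior.
Qed.

Lemma boundary_estimates f g a k : (\forall z \near a, derivable g z 1) -> g a != 0 ->
  (\forall z \near a, f z = (z - a) ^+ k.+1 * g z) -> unit_circle a ->
  arc_estimate f a k pi /\ area_estimate f a k pi.
Proof.
move=> dg ga fE a1; split.
  apply: (@level_arc _ f g a (a * 'i%C) k) => //.
  - by rewrite normcM a1 mul1r /= expr0n/= add0r expr1n sqrtr1.
  - exact: pi_gt0.
  - by rewrite mulr2n lerDl pi_ge0.
  - by move=> w; exact: boundary_angle.
  - by move=> tau; exact: boundary_disk.
apply: (@level_area _ f g a k) => //; first exact: pi_gt0.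
exact: moment_near_boundary.
Qed.

End LocalEstimates.

Unset Implicit Arguments.

Theorem theorem1p1 (R : realType) (U : set R[i]) (f : R[i] -> R[i])
  (oU : open U) (cU : connected U) (DU : closed_unit_disk `<=` U)
  (holf : holomorphic_on U f)
  (f_neq0 : exists z, U z /\ f z != 0)
  (f_zero : exists z, U z /\ f z = 0)
  (m : nat) (p : 'I_m -> R[i]) (k : 'I_m -> nat)
  (p_inj : injective p)
  (p_zeros : forall z, (unit_disk z /\ f z = 0) <-> exists j, p j = z)
  (p_mult : forall j, zero_multiplicity f (p j) (k j))
  (r : nat) (q : 'I_r -> R[i]) (l : 'I_r -> nat)
  (q_inj : injective q)
  (q_zeros : forall z, (unit_circle z /\ f z = 0) <-> exists nu, q nu = z)
  (q_mult : forall nu, zero_multiplicity f (q nu) (l nu)) :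
  (exists h : R -> R,
     h =o_ (0^'+) (fun e : R => e) /\
     \forall e \near 0^'+,
       (\int[arc_length R]_(z in level_curve f e) (normc (derive1 f z))%:E)%E =
       (2 * pi * (\sum_(j < m) (k j)%:R + 2^-1 * \sum_(nu < r) (l nu)%:R) * e
          + h e)%:E)
  /\
  (exists h : R -> R,
     h =o_ (0^'+) (fun e : R => e ^+ 2) /\
     \forall e \near 0^'+,
       (\int[area R]_(w in [set w : R * R | sublevel_set f e (w.1 +i* w.2)])
          (normc (derive1 f (w.1 +i* w.2)) ^+ 2)%:E)%E =
       (pi * (\sum_(j < m) (k j)%:R + 2^-1 * \sum_(nu < r) (l nu)%:R) * e ^+ 2
          + h e)%:E).
Proof.
(* Interior and boundary zeros form one finite family, distinguished only by the angle [Theta]. *)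
pose c (s : 'I_m + 'I_r) := match s with inl j => p j | inr nu => q nu end.
pose mult (s : 'I_m + 'I_r) := match s with inl j => k j | inr nu => l nu end.
pose Theta (s : 'I_m + 'I_r) : R := match s with inl _ => pi *+ 2 | inr _ => pi end.
have pP j : unit_disk (p j) /\ f (p j) = 0 by apply/p_zeros; exists j.
have qP nu : unit_circle (q nu) /\ f (q nu) = 0 by apply/q_zeros; exists nu.
have df z : closed_unit_disk z -> derivable f z 1 by move=> /DU; exact: holf.
have fz z : closed_unit_disk z -> f z = 0 -> exists s, c s = z.
  rewrite /closed_unit_disk/= le_eqVlt => /orP[/eqP z1 z0|z1 z0].
    by have [nu <-] := (q_zeros z).1 (conj z1 z0); exists (inr nu).
  by have [j <-] := (p_zeros z).1 (conj z1 z0); exists (inl j).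
have pq j nu : p j <> q nu.
  have [p1 _] := pP j; have [q1 _] := qP nu; move=> E.
  by move: p1; rewrite /unit_disk/= E q1 ltxx.
have c_inj : injective c.
  move=> [j|nu] [j'|nu'] /=; first by move/p_inj ->.
  - by move/pq.
  - by move/esym/pq.
  - by move/q_inj ->.
have Theta_gt0 s : 0 < Theta s.
  have pi0 := @pi_gt0 R; rewrite /Theta; case: s => [_|_] //.
  by rewrite mulr2n addr_gt0.
have est s : exists2 k', mult s = k'.+1 &
    arc_estimate f (c s) k' (Theta s) /\ area_estimate f (c s) k' (Theta s).
  case: s => [j|nu] /=.
    have [p1 p0] := pP j; have [k' -> [g [dg ga fE]]] := zero_multiplicity_succ p0 (p_mult j).
    by exists k' => //; exact: interior_estimates dg ga fE p1.
  have [q1 q0] := qP nu; have [k' -> [g [dg ga fE]]] := zero_multiplicity_succ q0 (q_mult nu).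
  by exists k' => //; exact: boundary_estimates dg ga fE q1.
(* The local estimates are indexed by the multiplicity minus one. *)
have mult_gt0 s : (mult s).-1.+1 = mult s by have [k' ->] := est s.
have arcs s : arc_estimate f (c s) (mult s).-1 (Theta s) by have [k' ->] := est s => -[].
have areas s : area_estimate f (c s) (mult s).-1 (Theta s) by have [k' ->] := est s => -[].
have sum_arc : \sum_s Theta s * (mult s).-1.+1%:R =
    2 * pi * (\sum_(j < m) (k j)%:R + 2^-1 * \sum_(nu < r) (l nu)%:R).
  under eq_bigr do rewrite mult_gt0.
  rewrite big_sumType/= -!mulr_sumr; move: (\sum_j _) (\sum_nu _) => V W.
  by rewrite mulr2n; field.
split; first by rewrite -sum_arc; exact: (level_curve_expansion df fz c_inj Theta_gt0 arcs).
have := sublevel_set_expansion df fz c_inj Theta_gt0 areas.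
(* Each area coefficient is half of the corresponding arc coefficient, so the sum already computed
   is reused. *)
under eq_bigr do rewrite mulrAC.
rewrite -mulr_suml sum_arc -[X in X / 2]mulrA.
by rewrite [X in X / 2]mulrC mulfK.
Qed.
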